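(* Let $\kappa\in(0,\frac12)$. For every probability measure $\mu$ on $(-1,1)$ and every $s\ge0$, $$\lim_{t\to\infty}\frac1t\int_s^t\mathbb{P}_{\mu,s}(X_u\in\cdot\mid\tau_X>t)\,du=\beta_{Bm}.$$
   Context: For $s\ge 0$ and $x\in\mathbb{R}$, let $\mathbb{P}_{x,s}$ be a probability measure under which $(X_t)_{t\ge s}$ is given by $X_t=\frac{x(s+1)^\kappa+W_{t-s}}{(t+1)^\kappa}$, with $W$ a standard Brownian motion started at $0$; $\tau_X:=\inf\{t\ge s:|X_t|=1\}$; $\mathbb{P}_{\mu,s}=\int\mathbb{P}_{x,s}\mu(dx)$. Let $\tilde B$ be a standard Brownian motion and $\tau_{\tilde B}=\inf\{t\ge0:|\tilde B_t|=1\}$. $\alpha_{Bm}$ is the unique quasi-stationary distribution of $\tilde B$ absorbed at $\pm1$, $\lambda_{Bm}=\pi^2/8$ satisfies $\mathbb{P}^{\tilde B}_{\alpha_{Bm}}(\tau_{\tilde B}>t)=e^{-\lambda_{Bm}t}$, $\eta_{Bm}(x):=\lim_{t\to\infty}e^{\lambda_{Bm}t}\mathbb{P}^{\tilde B}_x(\tau_{\tilde B}>t)$ (so $\int\eta_{Bm}d\alpha_{Bm}=1$), and $\beta_{Bm}(dx):=\eta_{Bm}(x)\alpha_{Bm}(dx)$. The limit is in the sense of weak convergence of measures. *)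

(* Defs.v *)
From HB Require Import structures.
From mathcomp Require Import all_boot all_order all_algebra.
From mathcomp Require Import all_classical all_reals all_analysis.
From mathcomp Require Import normal_distribution.
Set Implicit Arguments. Unset Strict Implicit. Unset Printing Implicit Defensive.
Import Order.TTheory GRing.Theory Num.Theory.
Import numFieldNormedType.Exports.
Local Open Scope classical_set_scope.
Local Open Scope ring_scope.

Definition is_std_BM {R : realType} {d : measure_display} {Omega : measurableType d}
  (P : probability Omega R) (W : R -> Omega -> R) : Prop :=
  (forall t, measurable_fun setT (W t)) /\
  (forall w, W 0 w = 0) /\
  (forall w, {within `[0, +oo[%classic, continuous (fun t => W t w)}) /\
  (forall (n : nat) (ts : nat -> R), ts 0%N = 0 ->
     (forall i, (i < n)%N -> ts i < ts i.+1) ->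
     forall A : nat -> set R, (forall i, measurable (A i)) ->
     P (\bigcap_(i < n) [set w | A i (W (ts i.+1) w - W (ts i) w)])
     = (\prod_(i < n) normal_prob 0 (Num.sqrt (ts i.+1 - ts i)) (A i))%E).

Definition Xproc {R : realType} {Omega : Type} (W : R -> Omega -> R)
  (kappa s x u : R) (w : Omega) : R :=
  (x * (s + 1) `^ kappa + W (u - s) w) / (u + 1) `^ kappa.

(* tau_X = inf { u >= s : |X_u| = 1 } (in \bar R, inf of empty set = +oo) *)
Definition tauX {R : realType} {Omega : Type} (W : R -> Omega -> R)
  (kappa s x : R) (w : Omega) : \bar R :=
  ereal_inf ((fun r => r%:E) @` [set r | s <= r /\ `|Xproc W kappa s x r w| = 1]).

Definition survX {R : realType} {Omega : Type} (W : R -> Omega -> R)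
  (kappa s x t : R) : set Omega :=
  [set w | (t%:E < tauX W kappa s x w)%E].

Definition Emu_f_surv {R : realType} {d : measure_display} {Omega : measurableType d}
  (P : probability Omega R) (W : R -> Omega -> R) (mu : probability R R)
  (kappa s : R) (f : R -> R) (u t : R) : \bar R :=
  (\int[mu]_x \int[P]_(w in survX W kappa s x t) (f (Xproc W kappa s x u w))%:E)%E.

Definition Pmu_surv {R : realType} {d : measure_display} {Omega : measurableType d}
  (P : probability Omega R) (W : R -> Omega -> R) (mu : probability R R)
  (kappa s t : R) : \bar R :=
  (\int[mu]_x P (survX W kappa s x t))%E.

(* integral of f against the measure
   nu_t := (1/t) int_s^t P_{mu,s}(X_u in . | tau_X > t) du *)
Definition cesaro_cond {R : realType} {d : measure_display} {Omega : measurableType d}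
  (P : probability Omega R) (W : R -> Omega -> R) (mu : probability R R)
  (kappa s : R) (f : R -> R) (t : R) : R :=
  t^-1 * Rintegral lebesgue_measure `[s, t]
           (fun u => fine (Emu_f_surv P W mu kappa s f u t) / fine (Pmu_surv P W mu kappa s t)).

Definition tauB {R : realType} {Omega : Type} (W : R -> Omega -> R) (x : R) (w : Omega)
  : \bar R :=
  ereal_inf ((fun r => r%:E) @` [set r | 0 <= r /\ `|x + W r w| = 1]).

Definition survB {R : realType} {Omega : Type} (W : R -> Omega -> R) (x t : R)
  : set Omega := [set w | (t%:E < tauB W x w)%E].

(* alpha is a quasi-stationary distribution of B~ absorbed at +-1:
   alpha is a probability measure on (-1,1) and for all t >= 0 and Borel A,
   P_alpha(B~_t in A | tau_B > t) = alpha(A)  (with P_alpha(tau_B > t) > 0). *)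
Definition is_QSD_Bm {R : realType} {d : measure_display} {Omega : measurableType d}
  (P : probability Omega R) (W : R -> Omega -> R) (alpha : probability R R) : Prop :=
  alpha `]-1, 1[%classic = 1%E /\
  forall t : R, 0 <= t -> forall A : set R, measurable A ->
    (0 < \int[alpha]_x P (survB W x t))%E /\
    (\int[alpha]_x P ([set w | A (x + W t w)%R] `&` survB W x t)
      = alpha A * \int[alpha]_x P (survB W x t))%E.

Definition lambda_Bm {R : realType} : R := pi ^+ 2 / 8.

(* Main.v *)
From mathcomp Require Import all_boot all_order all_algebra.
From mathcomp Require Import all_classical all_reals normedtype.
Import numFieldNormedType.Exports.
Require Import Defs.
From HB Require Import structures.
From mathcomp Require Import all_boot all_order all_algebra.
From mathcomp Require Import all_classical all_reals all_analysis.
From mathcomp Require Import normal_distribution.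
From mathcomp Require Import measurable_realfun ring lra.
Import Order.TTheory GRing.Theory Num.Theory.
Import numFieldNormedType.Exports.
Local Open Scope classical_set_scope.
Local Open Scope ring_scope.
Set Implicit Arguments. Unset Strict Implicit. Unset Printing Implicit Defensive.

(** Survival of X up to time t means that a Brownian path stays, at each time r after the start,
    inside the ball of radius [radius r], that is (s + r + 1)^kappa. As kappa < 1/2, these balls
    grow more slowly than diffusively, so a surviving path rescaled by the radius has time to
    equilibrate. Survival costs about exp(- lambda [clock]), where [clock] is the integral of
    [radius]^-2, and [clock] times the squared final radius is O(t) ([clock_le]).

    The core is a Laplace transform argument. Let [phi] x = cos(pi x / 2) be the Dirichlet ground
    state on (-1, 1) and let be be the mean of f under the density proportional to [phi]^2. Since
    (be - f) [phi] is orthogonal to [phi], the Fredholm alternative ([ode]) gives psi, zero at both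
    ends, with psi''/2 + lambda psi = (be - f) [phi]. Up to O(theta^2), the function [phi] + theta
    psi is then a positive eigenfunction of half the Laplacian plus theta f, with eigenvalue -
    lambda + theta be. Using it as a supersolution, [chain_upper] bounds
    E[exp(k int f(X)); survival] by a power of the radius times exp(- lambda [clock] + k be t +
    O(theta^2) [clock]), where k is about theta / radius^2. With [phi] as a subsolution,
    [chain_lower] and [psurv_ge] bound the survival probability below by a constant times about
    exp(- lambda [clock]).

    Jensen's inequality under the conditional law compares the two bounds ([cesaro_upper]). Division
    by k t gives theta (average - be) <= C theta^2 + o(1) ([cesaro_tilted]): the power of the radius
    contributes radius^2 ln t / t, which vanishes, again because kappa < 1/2. Small theta of either
    sign gives the limit be.

    That be is the integral of f against beta comes from a Dynkin formula for killed Brownian motion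
    ([dynkin]), by which a quasi-stationary law has density proportional to [phi] ([qsd_phi_int])
    and eta is proportional to [phi] ([eta_phi_int]).

    No stochastic calculus is used. Each estimate is proved on a time grid, where the path is a
    Gaussian random walk ([chain]) and Taylor's formula plays the part of Ito's; the mesh is then
    sent to 0. *)

(** * Bounded measurable functions *)

Section bounded_measurable.
Context {R : realType} {d : measure_display} {T : measurableType d}.
Implicit Types (F G : T -> R).

(** This class is stable under every operation used below and integrable for every probability, so
    it carries all integrability side conditions. *)
Definition bdmeas F : Prop :=
  measurable_fun setT F /\ exists M, forall x, `|F x| <= M.

Lemma bdmeas_cst (c : R) : bdmeas (fun=> c).
Proof. by split; [exact: measurable_cst|exists `|c|]. Qed.

Lemma bdmeasD F G : bdmeas F -> bdmeas G -> bdmeas (fun x => F x + G x).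
Proof.
move=> [mF [M hM]] [mG [N hN]]; split; first exact: measurable_funD.
by exists (M + N) => x; rewrite (le_trans (ler_normD _ _))// lerD.
Qed.

Lemma bdmeasM F G : bdmeas F -> bdmeas G -> bdmeas (fun x => F x * G x).
Proof.
move=> [mF [M hM]] [mG [N hN]]; split; first exact: measurable_funM.
by exists (M * N) => x; rewrite normrM ler_pM.
Qed.

Lemma bdmeasZ F (c : R) : bdmeas F -> bdmeas (fun x => c * F x).
Proof. by move=> bF; apply: bdmeasM => //; exact: bdmeas_cst. Qed.

Lemma bdmeasN F : bdmeas F -> bdmeas (fun x => - F x).
Proof.
move=> bF; rewrite (_ : (fun x => _) = (fun x => -1 * F x)); first exact: bdmeasZ.
by apply/funext => x; rewrite mulN1r.
Qed.

Lemma bdmeasB F G : bdmeas F -> bdmeas G -> bdmeas (fun x => F x - G x).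
Proof. by move=> bF bG; apply: bdmeasD => //; exact: bdmeasN. Qed.

Lemma bdmeas_norm F : bdmeas F -> bdmeas (fun x => `|F x|).
Proof.
move=> [mF [M hM]]; split; first exact: measurableT_comp.
by exists M => x; rewrite normr_id.
Qed.

Lemma bdmeas_indic (A : set T) : measurable A -> bdmeas (\1_A : T -> R).
Proof.
move=> mA; split; first exact: measurable_indic.
by exists 1 => x; rewrite indicE; case: (_ \in _); rewrite ?normr1 ?normr0.
Qed.

Lemma bdmeas_sum n (H : nat -> T -> R) : (forall i, (i < n)%N -> bdmeas (H i)) ->
  bdmeas (fun x => \sum_(i < n) H i x).
Proof.
elim: n => [|n IH] hH.
  rewrite (_ : (fun x => _) = fun=> 0); first exact: bdmeas_cst.
  by apply/funext => x; rewrite big_ord0.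
rewrite (_ : (fun x => _) = fun x => (\sum_(i < n) H i x) + H n x).
  by apply: bdmeasD; [apply: IH => i /ltnW/hH|exact: hH].
by apply/funext => x; rewrite big_ord_recr.
Qed.

Lemma bdmeas_prod n (H : nat -> T -> R) : (forall i, (i < n)%N -> bdmeas (H i)) ->
  bdmeas (fun x => \prod_(i < n) H i x).
Proof.
elim: n => [|n IH] hH.
  rewrite (_ : (fun x => _) = fun=> 1); first exact: bdmeas_cst.
  by apply/funext => x; rewrite big_ord0.
rewrite (_ : (fun x => _) = fun x => (\prod_(i < n) H i x) * H n x).
  by apply: bdmeasM; [apply: IH => i /ltnW/hH|exact: hH].
by apply/funext => x; rewrite big_ord_recr.
Qed.

Lemma bdmeas_expR F : bdmeas F -> bdmeas (fun x => expR (F x)).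
Proof.
move=> [mF [M hM]]; split; first exact: measurableT_comp.
exists (expR M) => x; rewrite ger0_norm ?expR_ge0// ler_expR.
by rewrite (le_trans (ler_norm _)).
Qed.

Lemma bdmeas_lim (H : nat -> T -> R) F M :
  (forall n, measurable_fun setT (H n)) -> (forall n x, `|H n x| <= M) ->
  (forall x, H ^~ x @ \oo --> F x) -> bdmeas F.
Proof.
move=> mH hM HF; split; first exact: (measurable_fun_cvg mH).
exists M => x; have /cvg_norm cF := HF x.
by apply: (cvgr_to_le cF); near=> n; exact: hM.
Unshelve. all: by end_near. Qed.

End bounded_measurable.

Lemma bdmeas_comp {R : realType} {d d' : measure_display} {T : measurableType d}
    {T' : measurableType d'} (F : T' -> R) (Y : T -> T') :
  bdmeas F -> measurable_fun setT Y -> bdmeas (fun x => F (Y x)).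
Proof.
move=> [mF [M hM]] mY; split; first exact: measurableT_comp.
by exists M => x; exact: hM.
Qed.

(** * Expectations of bounded measurable functions *)

Section expectation.
Context {R : realType} {d : measure_display} {T : measurableType d}.
Variable Q : probability T R.
Implicit Types (F G : T -> R).

Lemma bdmeas_integrable F : bdmeas F -> Q.-integrable setT (EFin \o F).
Proof.
move=> [mF [M hM]]; apply: measurable_bounded_integrable => //.
  by apply: (le_lt_trans (probability_le1 Q measurableT)); rewrite ltry.
by exists M; split; rewrite ?num_real // => x Mx y _; exact: le_trans (hM y) (ltW Mx).
Qed.

Lemma expectE F : bdmeas F -> (\int[Q]_x (F x)%:E)%E = (\int[Q]_x F x)%:E.
Proof. by move=> /bdmeas_integrable iF; rewrite fineK//; exact: integrable_fin_num. Qed.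

Lemma expect_cst (c : R) : \int[Q]_x c = c.
Proof.
rewrite Rintegral_cst// (_ : fine _ = 1) ?mulr1//.
by rewrite -[RHS]/(fine 1%E); congr fine; exact: probability_setT.
Qed.

Lemma expectD F G : bdmeas F -> bdmeas G ->
  \int[Q]_x (F x + G x) = \int[Q]_x F x + \int[Q]_x G x.
Proof. by move=> bF bG; apply: RintegralD => //; exact: bdmeas_integrable. Qed.

Lemma expectB F G : bdmeas F -> bdmeas G ->
  \int[Q]_x (F x - G x) = \int[Q]_x F x - \int[Q]_x G x.
Proof. by move=> bF bG; apply: RintegralB => //; exact: bdmeas_integrable. Qed.

Lemma expectZ F (c : R) : bdmeas F -> \int[Q]_x (c * F x) = c * \int[Q]_x F x.
Proof. by move=> bF; apply: RintegralZl => //; exact: bdmeas_integrable. Qed.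

Lemma le_expect F G : bdmeas F -> bdmeas G -> (forall x, F x <= G x) ->
  \int[Q]_x F x <= \int[Q]_x G x.
Proof.
by move=> bF bG FG; apply: le_Rintegral => //; exact: bdmeas_integrable.
Qed.

Lemma expect_le_bound F M : bdmeas F -> (forall x, `|F x| <= M) ->
  `|\int[Q]_x F x| <= M.
Proof.
move=> bF hM; apply: (le_trans (le_normr_Rintegral _ (bdmeas_integrable bF))) => //.
rewrite -[leRHS]expect_cst; apply: le_expect => //; first exact: bdmeas_norm.
exact: bdmeas_cst.
Qed.

Lemma expect_sum n (H : nat -> T -> R) : (forall i, bdmeas (H i)) ->
  \int[Q]_x (\sum_(i < n) H i x) = \sum_(i < n) \int[Q]_x H i x.
Proof.
move=> bH; elim: n => [|n IH].
  rewrite big_ord0 -[RHS]expect_cst; apply: eq_Rintegral => x _.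
  by rewrite big_ord0.
rewrite big_ord_recr/= -IH -expectD//; last exact: bdmeas_sum.
by apply: eq_Rintegral => x _; rewrite big_ord_recr.
Qed.

Lemma expect_indic (A : set T) : measurable A -> \int[Q]_x \1_A x = fine (Q A).
Proof. by move=> mA; rewrite /Rintegral integral_indic// setIT. Qed.

Lemma expect_cvg (H : nat -> T -> R) F M :
  (forall n, measurable_fun setT (H n)) -> (forall n x, `|H n x| <= M) ->
  (forall x, H ^~ x @ \oo --> F x) ->
  (\int[Q]_x H n x) @[n --> \oo] --> \int[Q]_x F x.
Proof.
move=> mH hM HF; have bF := bdmeas_lim mH hM HF.
have bH n : bdmeas (H n) by split => //; exists M.
have [] := @dominated_convergence _ _ _ Q setT measurableT
  (fun n x => (H n x)%:E) (fun x => (F x)%:E) (fun=> M%:E) _ _ _ _ _.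
- by move=> n; apply/measurable_EFinP.
- by apply/measurable_EFinP; case: bF.
- by apply: aeW => x _; apply: cvg_EFin; [exact: nearW|exact: HF].
- apply: (@eq_integrable _ _ _ _ _ _ (EFin \o cst M)) => //.
  exact: finite_measure_integrable_cst.
- by apply: aeW => x n _; rewrite lee_fin.
move=> _ _; rewrite expectE// => h.
have : EFin \o (fun n => \int[Q]_x H n x) @ \oo --> (\int[Q]_x F x)%:E.
  apply: cvg_trans h; apply: near_eq_cvg; near=> n => /=.
  by rewrite expectE.
by move/fine_cvgP => [].
Unshelve. all: by end_near. Qed.

End expectation.

(** * Random starting point: product of the initial law and path space *)

Section product_probability.
Context {R : realType} {d1 d2 : measure_display}
  {T1 : measurableType d1} {T2 : measurableType d2}.
Variables (mu : probability T1 R) (P : probability T2 R).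

(** A pair is a starting point together with a Brownian sample, so that P_mu becomes a single
    probability. The alias receives the probability structure. *)
Definition prodp : set (T1 * T2) -> \bar R := (mu \x P)%E.

HB.instance Definition _ := Measure.on prodp.

Let prodpT : prodp setT = 1%E.
Proof.
rewrite /prodp -setXTT product_measure1E//.
have -> : (mu : measure _ _) setT = 1%E by exact: probability_setT.
have -> : (P : measure _ _) setT = 1%E by exact: probability_setT.
by rewrite mule1.
Qed.

HB.instance Definition _ := @Measure_isProbability.Build _ _ R prodp prodpT.

Lemma expect_prod (F : T1 * T2 -> R) : bdmeas F ->
  \int[prodp]_z F z = \int[mu]_x \int[P]_y F (x, y).
Proof.
move=> bF; rewrite /Rintegral.
rewrite -(@integral12_prod_meas1 _ _ _ _ _ mu P (fun z => (F z)%:E)); last first.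
  exact: (@bdmeas_integrable _ _ _ prodp).
congr fine; apply: eq_integral => x _; rewrite /fubini_F expectE//.
apply: bdmeas_comp bF _; exact: pair1_measurable.
Qed.

End product_probability.

Lemma bdmeas_fubini {R : realType} {d1 d2 : measure_display} {T1 : measurableType d1}
    {T2 : measurableType d2} (P : probability T2 R) (F : T1 * T2 -> R) : bdmeas F ->
  bdmeas (fun x => \int[P]_y F (x, y)).
Proof.
move=> bF; have bFx x : bdmeas (fun y => F (x, y)).
  by apply: bdmeas_comp bF _; exact: pair1_measurable.
have [mF [M hM]] := bF.
have F0 z : 0 <= F z + M.
  by have := hM z; rewrite ler_norml => /andP[? _]; lra.
have bFM : bdmeas (fun z => F z + M) by apply: bdmeasD => //; exact: bdmeas_cst.
split; last by exists M => x; exact: expect_le_bound.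
(* Tonelli's measurability result needs a nonnegative integrand, hence the shift by the bound
   [M]. *)
have -> : (fun x => \int[P]_y F (x, y)) = (fun x => \int[P]_y (F (x, y) + M) - M).
  apply/funext => x; rewrite expectD//; last exact: bdmeas_cst.
  by rewrite expect_cst addrK.
apply: measurable_funB => //.
apply/measurable_EFinP.
rewrite (_ : _ \o _ = fubini_F P (fun z => (F z + M)%:E)).
  apply: measurable_fun_fubini_tonelli_F; last by move=> z; rewrite lee_fin.
  by apply/measurable_EFinP; case: bFM.
apply/funext => x; rewrite /fubini_F/= expectE//.
by apply: bdmeasD => //; exact: bdmeas_cst.
Qed.

(** * Change of variables for a weighted image measure *)

Section density.
Context {R : realType} {d d' : measure_display}
  {T : measurableType d} {U : measurableType d'}.
Variables (mu : {measure set T -> \bar R}) (m : {measure set U -> \bar R}).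
Variables (g : T -> R) (Y : T -> U).
Hypothesis mg : measurable_fun setT g.
Hypothesis mY : measurable_fun setT Y.
Hypothesis g0 : forall x, 0 <= g x.
Hypothesis mE : forall A, measurable A -> m A = (\int[mu]_x (\1_A (Y x) * g x)%:E)%E.

Import HBNNSimple.

(** The hypothesis [mE] is the case of indicators; simple functions follow by linearity, and
    nonnegative ones by monotone convergence on both sides. *)
Lemma ge0_integral_law (f : U -> \bar R) :
  measurable_fun setT f -> (forall x, 0 <= f x)%E ->
  (\int[m]_x f x = \int[mu]_x (f (Y x) * (g x)%:E))%E.
Proof.
move=> mf f0.
pose f_ := nnsfun_approx measurableT mf.
transitivity (limn (fun n => (\int[m]_x (f_ n x)%:E)%E)).
  rewrite -monotone_convergence//.
  - by apply: eq_integral => x _; apply/esym/cvg_lim => //; exact: cvg_nnsfun_approx.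
  - by move=> n; exact/measurable_EFinP/measurable_funP.
  - by move=> n y _; rewrite lee_fin.
  - by move=> y _ a b ab; rewrite lee_fin; exact/lefP/nd_nnsfun_approx.
have mfY n : measurable_fun setT (fun x => f_ n (Y x)).
  by apply: measurableT_comp => //; exact: measurable_funP.
transitivity (limn (fun n => (\int[mu]_x ((f_ n (Y x))%:E * (g x)%:E))%E)); last first.
  rewrite -monotone_convergence//.
  - apply: eq_integral => x _; apply/cvg_lim => //.
    by apply: cvgeZr => //; exact: cvg_nnsfun_approx.
  - by move=> n; apply: emeasurable_funM; apply/measurable_EFinP.
  - by move=> n y _; rewrite mule_ge0 ?lee_fin.
  - move=> y _ a b ab; apply: lee_wpmul2r; first by rewrite lee_fin.
    by rewrite lee_fin; exact/lefP/nd_nnsfun_approx.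
congr (limn _); apply/funext => n.
under eq_integral do rewrite fimfunE -fsumEFin//.
rewrite ge0_integral_fsum//; last 2 first.
  - by move=> y; apply/measurable_EFinP; exact: measurable_funM.
  - by move=> y x _; rewrite nnfun_muleindic_ge0.
have mindY r : measurable_fun setT (fun x => \1_(f_ n @^-1` [set r]) (Y x) : R).
  by apply: measurableT_comp => //; exact: measurable_indic.
under [RHS]eq_integral => x _.
  rewrite fimfunE -fsumEFin//.
  rewrite ge0_mule_fsuml; last by move=> y; rewrite nnfun_muleindic_ge0.
  over.
rewrite [RHS]ge0_integral_fsum//; last 2 first.
  - move=> y; apply: emeasurable_funM; apply/measurable_EFinP => //.
    exact: measurable_funM.
  - by move=> y x _; rewrite mule_ge0 ?nnfun_muleindic_ge0 ?lee_fin.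
apply: eq_fsbigr => r rf.
rewrite integralZl_indic_nnsfun// integral_indic// setIT mE//.
have r0 : 0 <= r by move: rf; rewrite inE => -[x _ <-].
transitivity (\int[mu]_x (r%:E * (\1_(f_ n @^-1` [set r]) (Y x) * g x)%:E))%E.
  rewrite ge0_integralZl//; last by move=> x _; rewrite lee_fin mulr_ge0.
  by apply/measurable_EFinP; exact: measurable_funM.
by apply: eq_integral => x _; rewrite -!EFinM mulrA.
Qed.

End density.

(** * Moments of the centred Gaussian up to order four *)

Section gauss_moments.
Context {R : realType}.
Variables (s : R) (s0 : 0 < s).
Local Notation p := (normal_pdf (0:R) s).
Local Notation mu := (@lebesgue_measure R).

Lemma is_derive_normal_pdf (z : R) : is_derive z 1 p (- (z / s ^+ 2) * p z).
Proof.
rewrite normal_pdfE ?gt_eqF// /normal_fun.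
apply: is_derive_eq.
rewrite /GRing.scale/=.
have : s != 0 by rewrite gt_eqF.
by move=> ?; field.
Qed.


Lemma normal_pdf_even z : p (- z) = p z.
Proof. by rewrite normal_pdfE ?gt_eqF// /normal_fun !subr0 sqrrN. Qed.

Lemma continuous_normal : continuous p.
Proof. by apply: continuous_normal_pdf; rewrite gt_eqF. Qed.

(** Uses exp(-u) <= 1/u at u = n^2 / (2 s^2). This is what kills the boundary terms in the
    integrations by parts. *)
Lemma normal_pdf_tail (n : nat) : (0 < n)%N ->
  n%:R * p n%:R <= normal_peak s * (s ^+ 2 *+ 2) * n%:R^-1.
Proof.
move=> n0; rewrite normal_pdfE ?gt_eqF// /normal_fun subr0.
have n0' : (0:R) < n%:R by rewrite ltr0n.
have u0 : 0 < (n%:R ^+ 2 / (s ^+ 2 *+ 2) : R).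
  by rewrite divr_gt0 ?exprn_gt0// pmulrn_lgt0// exprn_gt0.
have : expR (- (n%:R ^+ 2 / (s ^+ 2 *+ 2))) <= (n%:R ^+ 2 / (s ^+ 2 *+ 2))^-1.
  rewrite expRN lef_pV2 ?posrE ?expR_gt0//.
  by rewrite (le_trans _ (expR_ge1Dx _))// lerDr.
rewrite mulNr => h.
rewrite (mulrCA n%:R) -mulrA ler_wpM2l ?normal_peak_ge0//.
rewrite (le_trans (ler_wpM2l (ltW n0') h))// invfM invrK.
have : n%:R != 0 :> R by rewrite gt_eqF.
by move=> ?; rewrite le_eqVlt; apply/orP; left; apply/eqP; field.
Qed.

Lemma ftc_Rintegral (f F : R -> R) (a b : R) : a < b ->
  (forall z : R, is_derive z (1 : R) F (f z)) -> continuous f ->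
  \int[mu]_(z in `[a, b]) f z = F b - F a.
Proof.
move=> ab dF cf; rewrite /Rintegral (@continuous_FTC2 _ f F)//.
- by apply: continuous_subspaceT.
- split.
  + by move=> x _; have := dF x => -[].
  + apply: cvg_at_right_filter; apply: differentiable_continuous.
    by apply/derivable1_diffP; have := dF a => -[].
  + apply: cvg_at_left_filter; apply: differentiable_continuous.
    by apply/derivable1_diffP; have := dF b => -[].
- by move=> x _; rewrite derive1E; have := dF x => -[].
Qed.

Lemma continuous_Rintegrable (f : R -> R) (a b : R) : continuous f ->
  mu.-integrable `[a, b] (EFin \o f).
Proof.
move=> cf; apply: continuous_compact_integrable; first exact: segment_compact.
exact: continuous_subspaceT.
Qed.

Let J (k n : nat) : R := \int[mu]_(z in `[- n%:R, n%:R]) (z ^+ k * p z).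

Let cont_zp k : continuous (fun z : R => z ^+ k * p z).
Proof.
move=> z; apply: cvgM; first exact: exprn_continuous.
exact: continuous_normal.
Qed.

(** Integration by parts: since p' = - (z / s^2) p, the derivative of - s^2 z^(k+1) p is z^(k+2) p -
    s^2 (k+1) z^k p. *)
Lemma J_rec k n : (0 < n)%N ->
  J k.+2 n = s ^+ 2 * k.+1%:R * J k n
    - s ^+ 2 * (n%:R ^+ k.+1 * p n%:R - (- n%:R) ^+ k.+1 * p (- n%:R)).
Proof.
move=> n0; have n1 : - n%:R < n%:R :> R by rewrite -subr_gt0 opprK -natrD ltr0n addn_gt0 n0.
have := @ftc_Rintegral (fun z => (- s ^+ 2 * k.+1%:R) * (z ^+ k * p z) + z ^+ k.+2 * p z)
   (fun z => - s ^+ 2 * (z ^+ k.+1 * p z)) _ _ n1.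
have -> : \int[mu]_(z in `[- n%:R, n%:R]) (- s ^+ 2 * k.+1%:R * (z ^+ k * p z) + z ^+ k.+2 * p z)
    = (- s ^+ 2 * k.+1%:R) * J k n + J k.+2 n.
  rewrite RintegralD//; last 2 first.
  - apply: continuous_Rintegrable => z.
    by apply: cvgM; [exact: cvg_cst|exact: cont_zp].
  - exact/continuous_Rintegrable/cont_zp.
  by rewrite RintegralZl//; exact/continuous_Rintegrable/cont_zp.
move=> H; apply/eqP; rewrite -subr_eq0; apply/eqP.
have {}H := H _ _.
rewrite (_ : _ - _ = (- s ^+ 2 * k.+1%:R) * J k n + J k.+2 n - (- s ^+ 2 * (n%:R ^+ k.+1 * p n%:R) - - s ^+ 2 * ((- n%:R) ^+ k.+1 * p (- n%:R)))); last by ring.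
apply/eqP; rewrite subr_eq0; apply/eqP; apply: H.
- move=> z; have := is_derive_normal_pdf z => dp.
  have dX : is_derive z 1 (fun z : R => z ^+ k.+1) (k.+1%:R * z ^+ k).
    have := @is_deriveX _ _ id k.+1 z 1 1 (is_derive_id z 1).
    rewrite (_ : id ^+ k.+1 = (fun z : R => z ^+ k.+1)); last first.
      by apply/funext => y; rewrite exprfctE.
    by rewrite /GRing.scale/= mulr1.
  have dM := @is_deriveM _ _ _ _ _ _ _ _ dX dp.
  have dZ := @is_deriveZ _ _ _ _ (- s ^+ 2) _ _ _ dM.
  apply: is_derive_eq dZ _; rewrite /GRing.scale/=.
  have : s != 0 by rewrite gt_eqF.
  by move=> ?; rewrite !exprS; field.
- move=> z; apply: cvgD; last exact: cont_zp.
  by apply: cvgM; [exact: cvg_cst|exact: cont_zp].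
Qed.


Lemma bigcup_centered_itv : \bigcup_n `[- n%:R, n%:R]%classic = [set: R].
Proof.
rewrite -subTset => x _; exists (Num.bound `|x|) => //=.
rewrite in_itv/= -ler_norml ltW//.
exact: archi_boundP.
Qed.

Lemma cvg_integral_itv (q : R -> R) : continuous q -> (forall z, 0 <= q z) ->
  (\int[mu]_(z in `[- n%:R, n%:R]) q z)%:E @[n --> \oo] --> (\int[mu]_z (q z)%:E)%E.
Proof.
move=> cq q0; rewrite -bigcup_centered_itv.
have mq : measurable_fun [set: R] q by exact: continuous_measurable_fun.
rewrite (_ : (fun n => (\int[mu]_(z in `[- n%:R, n%:R]) q z)%:E)
    = (fun n => \int[mu]_(z in `[(- n%:R)%R, n%:R%R]) (q z)%:E)%E).
  apply: ge0_nondecreasing_set_cvg_integral => //.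
  - apply/nondecreasing_seqP => n; apply/subsetPset => z /=.
    by rewrite !in_itv/= -natr1; lra.
  - move=> n; apply/measurable_EFinP; exact: measurable_funTS.
  - by move=> n z _; rewrite lee_fin.
apply/funext => n; rewrite fineK//; apply: integrable_fin_num => //.
exact: continuous_Rintegrable.
Qed.

Lemma J_cvg k : ~~ odd k ->
  (J k n)%:E @[n --> \oo] --> (\int[mu]_z (z ^+ k * p z)%:E)%E.
Proof.
move=> ek; apply: cvg_integral_itv; first exact: cont_zp.
by move=> z; rewrite mulr_ge0 ?exprn_even_ge0 ?normal_pdf_ge0.
Qed.

Lemma J0_cvg : J 0 n @[n --> \oo] --> (1:R).
Proof.
have := @J_cvg 0 isT.
rewrite (_ : (\int[mu]_z _)%E = 1%E).
  by move/fine_cvgP => [].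
rewrite -(@integral_normal_pdf R 0 s); apply: eq_integral => z _.
by rewrite expr0 mul1r.
Qed.

Lemma J2_cvg : J 2 n @[n --> \oo] --> s ^+ 2.
Proof.
have K : (normal_peak s * (s ^+ 2 *+ 2) * n.+1%:R^-1) @[n --> \oo] --> (0 : R).
  rewrite -[X in _ --> X](mulr0 (normal_peak s * (s ^+ 2 *+ 2))).
  by apply: cvgM; [exact: cvg_cst|exact: cvg_harmonic].
have L : (n.+1%:R * p n.+1%:R) @[n --> \oo] --> (0 : R).
  apply: (@squeeze_cvgr _ _ _ _ (fun=> 0) (fun n => normal_peak s * (s ^+ 2 *+ 2) * n.+1%:R^-1)) => //.
    by near=> n; rewrite mulr_ge0 ?normal_pdf_ge0//= normal_pdf_tail.
  exact: cvg_cst.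
rewrite -(cvg_shiftS (J 2)).
have -> : [sequence J 2 n.+1]_n = (fun n => s ^+ 2 * J 0 n.+1 - s ^+ 2 * 2 * (n.+1%:R * p n.+1%:R)).
  apply/funext => n /=; rewrite J_rec// normal_pdf_even; ring.
suff : (s ^+ 2 * J 0 n.+1 - s ^+ 2 * 2 * (n.+1%:R * p n.+1%:R)) @[n --> \oo]
    --> s ^+ 2 * 1 - s ^+ 2 * 2 * 0 by rewrite mulr1 mulr0 subr0.
apply: cvgB; apply: cvgM; try exact: cvg_cst; last exact: L.
by have := J0_cvg; rewrite -(cvg_shiftS (J 0)).
Unshelve. all: by end_near. Qed.

Lemma integral_normal_pdf_sqr : (\int[mu]_z (z ^+ 2 * p z)%:E = (s ^+ 2)%:E)%E.
Proof.
have h : (J 2 n)%:E @[n --> \oo] --> (s ^+ 2)%:E.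
  by apply: cvg_EFin; [exact: nearW|exact: J2_cvg].
by apply: cvg_unique (@J_cvg 2 isT) h.
Qed.

(** An upper bound suffices later, and it comes from [J_rec] because the boundary term has a
    favourable sign. *)
Lemma integral_normal_pdf_4 : (\int[mu]_z (z ^+ 4 * p z)%:E <= (3 * s ^+ 4)%:E)%E.
Proof.
have J2le n : J 2 n <= s ^+ 2.
  rewrite -lee_fin -integral_normal_pdf_sqr /J fineK; last first.
    by apply: integrable_fin_num => //; exact/continuous_Rintegrable/cont_zp.
  apply: ge0_subset_integral => //.
    by apply/measurable_EFinP; apply: continuous_measurable_fun; exact: cont_zp.
  by move=> z _; rewrite lee_fin mulr_ge0 ?normal_pdf_ge0// exprn_even_ge0.
apply: (cvge_to_le (@J_cvg 4 isT)); near=> n; rewrite lee_fin.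
have n0 : (0 < n)%N by near: n; exact: nbhs_infty_gt.
rewrite J_rec// normal_pdf_even.
apply: (@le_trans _ _ (s ^+ 2 * 3%:R * J 2 n)).
  rewrite gerDl oppr_le0 mulr_ge0 ?sqr_ge0//.
  rewrite subr_ge0 exprNn -signr_odd/= expr1 mulN1r mulNr.
  by rewrite (@le_trans _ _ 0)// ?oppr_le0 mulr_ge0 ?normal_pdf_ge0// exprn_ge0.
rewrite (_ : 3 * s ^+ 4 = s ^+ 2 * 3%:R * s ^+ 2); last by ring.
by rewrite ler_wpM2l// mulr_ge0// sqr_ge0.
Unshelve. all: by end_near. Qed.

Local Notation Q := (normal_prob (0:R) s).

Lemma ge0_integral_normal (f : R -> R) : measurable_fun setT f -> (forall x, 0 <= f x) ->
  (\int[Q]_z (f z)%:E = \int[mu]_z (f z * p z)%:E)%E.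
Proof.
move=> mf f0.
rewrite (@ge0_integral_law _ _ _ _ _ mu Q p id)//.
- exact: measurable_normal_pdf.
- by move=> z; exact: normal_pdf_ge0.
- move=> A mA; rewrite /normal_prob [LHS]integral_mkcond; congr (integral _ _ _).
  by apply/funext => z; rewrite patchE indicE; case: ifPn; rewrite ?mul1r ?mul0r.
- exact/measurable_EFinP.
Qed.

Lemma normal_sqr : (\int[Q]_z (z ^+ 2)%:E = (s ^+ 2)%:E)%E.
Proof.
rewrite ge0_integral_normal ?integral_normal_pdf_sqr//.
by move=> z; exact: sqr_ge0.
Qed.

Lemma normal_4 : (\int[Q]_z (z ^+ 4)%:E <= (3 * s ^+ 4)%:E)%E.
Proof.
rewrite ge0_integral_normal ?integral_normal_pdf_4//.
by move=> z; rewrite exprn_even_ge0.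
Qed.

(** Domination by 1 + z^4. *)
Lemma integrable_normal_pow k : (k <= 4)%N -> Q.-integrable setT (fun z : R => (z ^+ k)%:E).
Proof.
move=> k4.
have m k' : measurable_fun setT (fun z : R => z ^+ k') by exact: exprn_measurable.
have i4 : Q.-integrable setT (fun z : R => (z ^+ 4)%:E).
  apply/integrableP; split; first exact/measurable_EFinP.
  rewrite (le_lt_trans _ (ltry (3 * s ^+ 4)))//.
  rewrite (le_trans _ normal_4)//; apply: ge0_le_integral => //.
  - by apply/measurable_EFinP; exact: measurableT_comp.
  - exact/measurable_EFinP.
  - by move=> z _ /=; rewrite lee_fin ger0_norm// exprn_even_ge0.
have i04 : Q.-integrable setT (fun z : R => (1 + z ^+ 4)%:E).
  rewrite (_ : (fun _ => _) = ((EFin \o cst (1 : R)%R) \+ (fun z : R => ((z ^+ 4)%R)%:E))%E).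
    by apply: integrableD => //; exact: finite_measure_integrable_cst.
  by apply/funext => z /=; rewrite EFinD.
apply: le_integrable i04 => //; first exact/measurable_EFinP.
move=> z _ /=; rewrite lee_fin normrX [leRHS]ger0_norm ?addr_ge0 ?exprn_even_ge0//.
rewrite -(@ger0_norm _ (z ^+ 4)) ?exprn_even_ge0// normrX.
have [z1|z1] := leP `|z| 1.
  by rewrite (@le_trans _ _ 1)// ?exprn_ile1// lerDl exprn_ge0.
by rewrite (le_trans (ler_weXn2l (ltW z1) k4))// lerDr.
Qed.

(** The integrand is signed while the limits over growing intervals are monotone ones. The square (z
    + 1)^2 is integrated instead: its truncated cross term vanishes by parity, so its mean is s^2 +
    1, and expanding the square gives the claim. *)
Lemma normal_1 : \int[Q]_z z = 0.
Proof.
pose q (z : R) := (z ^+ 2 * p z + 2 * (z ^+ 1 * p z)) + z ^+ 0 * p z.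
have cJ k : continuous (fun z : R => z ^+ k * p z) by exact: cont_zp.
have c1 : continuous (fun z : R => 2 * (z ^+ 1 * p z)).
  by move=> z; apply: cvgM; [exact: cvg_cst|exact: cJ].
have c2 : continuous (fun z : R => z ^+ 2 * p z + 2 * (z ^+ 1 * p z)).
  by move=> z; apply: cvgD; [exact: cJ|exact: c1].
have cq : continuous q by move=> z; apply: cvgD; [exact: c2|exact: cJ].
have qE z : q z = (z + 1) ^+ 2 * p z by rewrite /q expr0 expr1; ring.
have q0 z : 0 <= q z by rewrite qE mulr_ge0 ?sqr_ge0 ?normal_pdf_ge0.
have J1 n : (0 < n)%N -> J 1 n = 0.
  move=> n0; have n1 : - n%:R < n%:R :> R.
    by rewrite -subr_gt0 opprK -natrD ltr0n addn_gt0 n0.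
  have dF (z : R) : is_derive z (1 : R) (fun z => - s ^+ 2 * p z) (z ^+ 1 * p z).
    have dp := is_derive_normal_pdf z.
    apply: is_derive_eq (@is_deriveZ _ _ _ _ (- s ^+ 2) _ _ _ dp) _.
    have s1 : s != 0 by rewrite gt_eqF.
    by rewrite /GRing.scale/= expr1; field.
  by rewrite /J (ftc_Rintegral n1 dF (@cJ 1)) normal_pdf_even subrr.
have qJ n : (0 < n)%N -> \int[mu]_(z in `[- n%:R, n%:R]) q z = J 2 n + J 0 n.
  move=> n0; rewrite /q !RintegralD//; try exact: continuous_Rintegrable.
  rewrite RintegralZl//; last exact: continuous_Rintegrable.
  by rewrite -/(J 2 n) -/(J 1 n) -/(J 0 n) J1// mulr0 addr0.
have qint : (\int[mu]_z (q z)%:E)%E = (s ^+ 2 + 1)%:E.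
  have h : (J 2 n + J 0 n)%:E @[n --> \oo] --> (s ^+ 2 + 1)%:E.
    apply: cvg_EFin; first exact: nearW.
    by apply: cvgD; [exact: J2_cvg|exact: J0_cvg].
  have h' := @cvg_integral_itv q cq q0.
  apply: (cvg_unique _ h') => //; apply: cvg_trans h; apply: near_eq_cvg.
  by near=> n; rewrite qJ//; near: n; exact: nbhs_infty_gt.
have : \int[Q]_z ((z + 1) ^+ 2) = s ^+ 2 + 1.
  rewrite /Rintegral ge0_integral_normal//; last by move=> z; exact: sqr_ge0.
    by under eq_integral do rewrite -qE; rewrite qint.
  by apply: measurable_funX; exact: measurable_funD.
have i1 := @integrable_normal_pow 1 isT.
have i2 := @integrable_normal_pow 2 isT.
have i0 := @integrable_normal_pow 0 isT.
have -> : \int[Q]_z ((z + 1) ^+ 2) = \int[Q]_z ((z ^+ 2 + 2 * z ^+ 1) + z ^+ 0).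
  by apply: eq_Rintegral => z _; ring.
have iZ : Q.-integrable setT (EFin \o (fun z : R => 2 * z ^+ 1)).
  rewrite (_ : _ \o _ = (fun z : R => ((2:R)%:E * (z ^+ 1)%:E)%E)).
    exact: integrableZl.
  by apply/funext => z /=; rewrite EFinM.
rewrite RintegralD//; last first.
  rewrite (_ : _ \o _ = ((fun z : R => ((z ^+ 2)%R)%:E) \+ (EFin \o (fun z : R => (2 * z ^+ 1)%R)))%E).
    exact: integrableD.
  by apply/funext => z /=; rewrite EFinD.
rewrite RintegralD// RintegralZl//.
under [X in _ + X]eq_Rintegral do rewrite expr0.
rewrite expect_cst {1}/Rintegral normal_sqr/=.
under eq_Rintegral do rewrite expr1.
by move=> ?; lra.
Unshelve. all: by end_near. Qed.

(** Under the Gaussian the linear term has mean 0, the quadratic one has mean s^2 and the quartic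
    one at most 3 s^4. This turns a pointwise Taylor bound into a bound on one step of the walk. *)
Lemma normal_taylor (h : R -> R) (a b c e C : R) : bdmeas h ->
  (forall z, `|h z - (a + b * z + c * z ^+ 2)| <= e * z ^+ 2 + C * z ^+ 4) ->
  0 <= C ->
  `|\int[Q]_z h z - (a + c * s ^+ 2)| <= e * s ^+ 2 + 3 * C * s ^+ 4.
Proof.
move=> bh hT C0.
have ih := bdmeas_integrable Q bh.
have iZ (r : R) k : (k <= 4)%N -> Q.-integrable setT (EFin \o (fun z : R => r * z ^+ k)).
  move=> k4; rewrite (_ : _ \o _ = (fun z : R => (r%:E * (z ^+ k)%:E)%E)).
    by apply: integrableZl => //; exact: integrable_normal_pow.
  by apply/funext => z /=; rewrite EFinM.
have iD (f g : R -> R) : Q.-integrable setT (EFin \o f) -> Q.-integrable setT (EFin \o g) ->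
    Q.-integrable setT (EFin \o (fun z => f z + g z)).
  move=> i_f i_g; rewrite (_ : _ \o _ = ((EFin \o f) \+ (EFin \o g))%E).
    exact: integrableD.
  by apply/funext => z /=; rewrite EFinD.
have iB (f g : R -> R) : Q.-integrable setT (EFin \o f) -> Q.-integrable setT (EFin \o g) ->
    Q.-integrable setT (EFin \o (fun z => f z - g z)).
  move=> i_f i_g; rewrite (_ : _ \o _ = ((EFin \o f) \- (EFin \o g))%E).
    exact: integrableB.
  by apply/funext => z /=; rewrite EFinB.
pose P2 (z : R) := (a * z ^+ 0 + b * z ^+ 1) + c * z ^+ 2.
have iP : Q.-integrable setT (EFin \o P2).
  by apply: (iD); [apply: (iD); exact: iZ|exact: iZ].
have EP : \int[Q]_z P2 z = a + c * s ^+ 2.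
  rewrite /P2 RintegralD//; [|by apply: (iD); exact: iZ|exact: iZ].
  rewrite RintegralD//; try exact: iZ.
  rewrite !RintegralZl//; try exact: integrable_normal_pow.
  have -> : \int[Q]_z z ^+ 0 = 1.
    by rewrite -[RHS](expect_cst Q); apply: eq_Rintegral => z _; rewrite expr0.
  have -> : \int[Q]_z z ^+ 1 = 0.
    by rewrite -[RHS]normal_1; apply: eq_Rintegral => z _; rewrite expr1.
  by rewrite {1}/Rintegral normal_sqr/= mulr0 addr0 mulr1.
rewrite -EP -RintegralB//.
apply: (le_trans (le_normr_Rintegral _ (iB _ _ ih iP))) => //.
apply: (@le_trans _ _ (\int[Q]_z (e * z ^+ 2 + C * z ^+ 4))).
  apply: le_Rintegral => //.
  - have := iB _ _ ih iP => /integrable_abse.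
    by apply: eq_integrable.
  - by apply: (iD); exact: iZ.
  - by move=> z _; rewrite (le_trans _ (hT z))// /P2 expr0 mulr1 expr1.
rewrite RintegralD//; try exact: iZ.
rewrite !RintegralZl//; try exact: integrable_normal_pow.
rewrite {1}/Rintegral normal_sqr/= lerD2l -mulrA mulrCA ler_wpM2l//.
rewrite -lee_fin /Rintegral fineK ?normal_4//.
by apply: integrable_fin_num => //; exact: integrable_normal_pow.
Qed.

(** Markov's inequality at order four, read off from [normal_taylor] with zero Taylor part. With s^2
    the time step, the order s^4 is negligible against it. *)
Lemma normal_tail (eta : R) : 0 < eta ->
  \int[Q]_z \1_[set z | eta <= `|z|] z <= 3 * s ^+ 4 / eta ^+ 4.
Proof.
move=> eta0.
have mA : measurable [set z : R | eta <= `|z|].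
  rewrite -[X in measurable X]setTI.
  have -> : [set z : R | eta <= `|z|] = (@Num.norm R R) @^-1` `[eta, +oo[.
    by apply/seteqP; split => z /=; rewrite in_itv/= andbT.
  exact: normr_measurable.
have bA := bdmeas_indic (R := R) mA.
have := @normal_taylor _ 0 0 0 0 (eta ^- 4) bA _ _.
have e4 : 0 <= eta ^- 4 by rewrite invr_ge0 exprn_ge0// ltW.
move=> /(_ _ e4); rewrite !mul0r !add0r subr0 mulrAC => h.
apply: le_trans (ler_norm _) (h _) => z.
rewrite !mul0r !addr0 subr0 add0r ger0_norm ?indicE//.
have [zA|zA] := leP eta `|z|; last first.
  rewrite memNset/=; last by rewrite /= leNgt zA.
   by rewrite mulr_ge0// exprn_even_ge0.
rewrite mem_set//= mulrC ler_pdivlMr ?exprn_gt0// mul1r -(@ger0_norm _ (z ^+ 4)) ?exprn_even_ge0//.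
by rewrite normrX lerXn2r ?nnegrE// ltW.
Qed.

End gauss_moments.

(** * Uniform continuity, mean values and Taylor expansion of truncated functions *)

Section uniform_continuity.
Context {R : realType}.

(** Only [x] is confined to the interval; [z] may lie outside, since continuity is assumed on the
    whole line at each point of the interval. Compactness enters as a near-covering property. *)
Lemma heine (f : R -> R) (a b : R) :
  (forall x, x \in `[a, b] -> {for x, continuous f}) ->
  forall e : R, 0 < e -> exists2 eta : R, 0 < eta &
    forall x z, x \in `[a, b] -> `|z - x| <= eta -> `|f z - f x| <= e.
Proof.
move=> cf e e0.
have /compact_near_coveringP := @segment_compact R a b.
move=> /(_ _ (at_right (0:R))
  (fun eta x => forall z, `|z - x| <= eta -> `|f z - f x| <= e)) [].
  move=> x /= xab.
  have /cvgrPdist_lt /(_ (e / 2)) := cf x xab.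
  rewrite divr_gt0// => /(_ isT)/nbhs_ballP[r /= r0 rP].
  near=> y eta.
  move=> z zy.
  have yr : `|x - y| < r / 2.
    by near: y; apply: nbhsx_ballx; rewrite divr_gt0.
  have er : eta < r / 2 by near: eta; apply: nbhs_right_lt; rewrite divr_gt0.
  have h1 : `|f x - f y| < e / 2.
    by apply: rP; rewrite /ball/= (lt_le_trans yr)// ler_pdivrMr// ler_peMr ?ler1n// ltW.
  have h2 : `|f x - f z| < e / 2.
    apply: rP; rewrite /ball/= (le_lt_trans (ler_distD y _ _))//.
    rewrite (distrC y) (splitr r) ltrD//; exact: le_lt_trans er.
  rewrite (le_trans (ler_distD (f x) _ _))//.
  by rewrite (distrC (f z)) (splitr e) lerD// ltW.
move=> eta' /= eta'0 H; exists (eta' / 2); first by rewrite divr_gt0.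
move=> x z xab; apply: (H (eta' / 2)) => //=; last by rewrite divr_gt0.
rewrite sub0r normrN gtr0_norm ?divr_gt0//.
by rewrite ltr_pdivrMr// ltr_pMr ?ltr1n.
Unshelve. all: by end_near. Qed.

End uniform_continuity.

Section mean_value.
Context {R : realType}.

(** The endpoints are left unordered, so that increments of either sign are treated alike. *)
Lemma mean_value (g g1 : R -> R) (a b : R) :
  (forall x, x \in `[Num.min a b, Num.max a b] -> is_derive x (1 : R) g (g1 x)) ->
  exists2 c, c \in `[Num.min a b, Num.max a b] & g b - g a = g1 c * (b - a).
Proof.
move=> dg.
have H (u v : R) : u <= v -> (forall x, x \in `[u, v] -> is_derive x (1 : R) g (g1 x)) ->
    exists2 c, c \in `[u, v] & g v - g u = g1 c * (v - u).
  move=> uv du; have K := @MVT_segment R g g1 u v uv.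
  have K1 : forall x, x \in `]u, v[ -> is_derive x 1 g (g1 x).
    by move=> x xuv; apply: (du x); exact: subset_itv_oo_cc xuv.
  have K2 : {within `[u, v], continuous g}.
    by apply: derivable_within_continuous => x xuv; have := du x xuv => -[dx _]; exact: dx.
  exact: (K K1 K2).
have [ab|ab] := leP a b.
  by move: dg; rewrite (min_idPl ab) (max_idPr ab) => dg; exact: (H a b ab dg).
move: dg; rewrite (min_idPr (ltW ab)) (max_idPl (ltW ab)) => dg.
have [c cab E] := H b a (ltW ab) dg.
by exists c => //; rewrite -opprB E -mulrN opprB.
Qed.

Lemma is_derive_continuous (g : R -> R) (x y : R) : is_derive x (1:R) g y ->
  {for x, continuous g}.
Proof.
by move=> [dg _]; apply: differentiable_continuous; exact/derivable1_diffP.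
Qed.

Lemma itv_bounded (g : R -> R) (a b : R) :
  (forall x, x \in `[a, b] -> {for x, continuous g}) ->
  exists2 M : R, 0 <= M & forall x, x \in `[a, b] -> `|g x| <= M.
Proof.
move=> cg; have [ab|ab] := leP a b; last first.
  by exists 0 => // x; rewrite in_itv/= => /andP[/le_trans h /h]; rewrite leNgt ab.
have cg' : {within `[a, b], continuous g}.
  by apply: continuous_in_subspaceT => x; rewrite inE; exact: cg.
have [c _ hc] := EVT_max ab cg'.
have [e _ he] := EVT_min ab cg'.
exists (`|g c| + `|g e|); first by rewrite addr_ge0.
move=> x xab; have := hc x xab; have := he x xab.
have := ler_norm (g c); have := ler_norm (- g e); rewrite normrN.
have := normr_ge0 (g c); have := normr_ge0 (g e).
by move=> ? ? ? ? ? ?; rewrite ler_norml; apply/andP; split; lra.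
Qed.

(** Regularity is asked beyond [-1, 1] because a Gaussian step can jump over the boundary; the open
    interval leaves room around [-2, 2], where functions are truncated. *)
Definition C2_near (psi psi1 psi2 : R -> R) : Prop :=
  forall x : R, x \in `]-3, 3[ ->
    [/\ is_derive x (1 : R) psi (psi1 x), is_derive x (1 : R) psi1 (psi2 x)
      & {for x, continuous psi2}].

Definition cut2 (psi : R -> R) (x : R) : R := psi x * \1_(`[-2, 2]%classic : set R) x.

Lemma taylor_cut2 psi psi1 psi2 : C2_near psi psi1 psi2 ->
  forall e : R, 0 < e -> exists2 C : R, 0 <= C & forall x z, x \in `[-1, 1] ->
    `|cut2 psi (x + z) - (psi x + psi1 x * z + psi2 x / 2 * z ^+ 2)|
      <= e * z ^+ 2 + C * z ^+ 4.
Proof.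
move=> hC e e0.
have sub (x : R) : x \in `[-2, 2] -> x \in `]-3, 3[.
  by rewrite !in_itv/= => /andP[? ?]; lra.
have [|eta' eta'0 Heta] := @heine _ psi2 (-2) 2 _ e e0.
  by move=> x /sub/hC [].
have [|M0 M00 HM0] := @itv_bounded psi (-2) 2.
  by move=> x /sub/hC [h _ _]; exact: is_derive_continuous h.
have [|M1 M10 HM1] := @itv_bounded psi1 (-2) 2.
  by move=> x /sub/hC [_ h _]; exact: is_derive_continuous h.
have [|M2 M20 HM2] := @itv_bounded psi2 (-2) 2.
  by move=> x /sub/hC [].
(* The cap at 1 keeps x + z inside [-2, 2], where the truncation is invisible. *)
pose eta := Num.min eta' 1.
have eta0 : 0 < eta by rewrite lt_min eta'0 ltr01.
have eta1 : eta <= 1 by rewrite ge_min lexx orbT.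
have etae : eta <= eta' by rewrite ge_min lexx.
exists ((2 * M0 + M1 + M2) * eta ^- 4).
  by rewrite mulr_ge0 ?invr_ge0 ?exprn_ge0 ?addr_ge0 ?mulr_ge0// ltW.
move=> x z x1.
have x2 : x \in `[-2, 2] by move: x1; rewrite !in_itv/= => /andP[? ?]; lra.
have [zeta|zeta] := leP `|z| eta.
  have xz2 : x + z \in `[-2, 2].
    move: x1 zeta; rewrite !in_itv/= ler_norml => /andP[? ?] /andP[? ?]; lra.
  rewrite /cut2 indicE mem_set ?mulr1//.
  rewrite (le_trans (y := e * z ^+ 2))//; last first.
    rewrite lerDl mulr_ge0 ?exprn_even_ge0// mulr_ge0 ?invr_ge0 ?exprn_ge0 ?addr_ge0 ?mulr_ge0//.
    exact: ltW.
  (* first-order remainder *)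
  have itv_sub c : c \in `[Num.min x (x + z), Num.max x (x + z)] ->
      c \in `[-2, 2] /\ `|c - x| <= `|z|.
    move: x2 xz2; rewrite !in_itv/= => /andP[? ?] /andP[? ?].
    have [z0|z0] := leP 0 z.
      rewrite minEle maxEle lerDl z0 => /andP[? ?]; split; first by lra.
      by rewrite ler_norml ger0_norm//; lra.
    rewrite minEle maxEle lerDl (lt_geF z0) => /andP[? ?]; split; first by lra.
    by rewrite ler_norml ltr0_norm//; lra.
  have step1 y : y \in `[Num.min x (x + z), Num.max x (x + z)] ->
      `|psi1 y - psi1 x - psi2 x * (y - x)| <= e * `|z|.
    move=> yxz; have [y2 yx] := itv_sub y yxz.
    have sub' c : c \in `[Num.min x y, Num.max x y] -> c \in `[-2, 2] /\ `|c - x| <= `|y - x|.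
      move: x2 y2; rewrite !in_itv/= => /andP[? ?] /andP[? ?].
      have [xy|xy] := leP x y => /andP[? ?]; split; try by lra.
        by rewrite !ger0_norm ?subr_ge0//; lra.
      by rewrite !ler0_norm ?subr_le0 ?(ltW xy)//; lra.
    have [c cxy ->] := @mean_value psi1 psi2 x y (fun c hc => let: And3 _ h _ := hC c (sub _ (sub' c hc).1) in h).
    rewrite -mulrBl normrM ler_pM//.
    by apply: Heta => //; apply: (le_trans (sub' c cxy).2); apply: (le_trans yx); apply: le_trans zeta etae.
  (* The derivative of [G] is the first-order remainder of psi', bounded in [step1]; a second mean
     value step gives the factor z^2. *)
  pose G y := psi y - psi1 x * (y - x) - psi2 x / 2 * (y - x) ^+ 2.
  have dG y : y \in `[Num.min x (x + z), Num.max x (x + z)] ->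
     is_derive y (1:R) G (psi1 y - psi1 x - psi2 x * (y - x)).
    move=> /itv_sub[/sub/hC [h1 _ _] _].
    rewrite /G; apply: is_derive_eq; rewrite /GRing.scale/=; lra.
  have [c cxz E] := @mean_value G _ x (x + z) dG.
  rewrite (_ : _ - _ = G (x + z) - G x); last by rewrite /G; field.
  rewrite E (addrC x z) addrK normrM -(@ger0_norm _ (z ^+ 2)) ?sqr_ge0// normrX expr2 mulrA.
  by rewrite ler_wpM2r// step1.
rewrite (le_trans (y := (2 * M0 + M1 + M2) * eta ^- 4 * z ^+ 4))//; last first.
  by rewrite lerDr mulr_ge0 ?sqr_ge0// ltW.
have u1 : 1 <= `|z| / eta by rewrite ler_pdivlMr// mul1r ltW.
have E4 : eta ^- 4 * z ^+ 4 = (`|z| / eta) ^+ 4.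
  by rewrite expr_div_n -normrX ger0_norm ?exprn_even_ge0// mulrC.
have u4 : 1 <= (`|z| / eta) ^+ 4 by rewrite exprn_ege1.
have uz : `|z| <= (`|z| / eta) ^+ 4.
  rewrite (le_trans (y := `|z| / eta))// ?ler_eXnr//.
  by rewrite ler_pdivlMr// ler_piMr.
have uz2 : `|z| ^+ 2 <= (`|z| / eta) ^+ 4.
  rewrite (le_trans (y := (`|z| / eta) ^+ 2))// ?ler_weXn2l//.
  rewrite lerXn2r ?nnegrE ?mulr_ge0 ?invr_ge0 ?(ltW eta0)//.
  by rewrite ler_pdivlMr// ler_piMr.
rewrite -(mulrA _ (eta ^- 4)) E4; set u := _ ^+ 4 in u4 uz uz2 *.
have c0 : `|cut2 psi (x + z)| <= M0.
  rewrite /cut2 indicE; case: (boolP (_ \in _)); rewrite ?mulr1 ?mulr0 ?normr0//.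
  by rewrite inE => h; exact: HM0.
have c1 := HM0 x x2; have c2 := HM1 x x2; have c3 := HM2 x x2.
rewrite (le_trans (ler_normB _ _))// (le_trans (lerD c0 (ler_normD _ _)))//.
rewrite (le_trans (lerD (lexx _) (lerD (ler_normD _ _) (lexx _))))//.
have -> : `|psi1 x * z| = `|psi1 x| * `|z| by rewrite normrM.
have -> : `|psi2 x / 2 * z ^+ 2| = `|psi2 x| / 2 * `|z| ^+ 2.
  by rewrite [LHS]normrM normrX normrM normfV (@ger0_norm _ 2).
have h1 : `|psi1 x| * `|z| <= M1 * u by rewrite ler_pM.
have h2 : `|psi2 x| / 2 * `|z| ^+ 2 <= M2 * u.
  rewrite ler_pM ?divr_ge0 ?sqr_ge0//; lra.
have h3 : 2 * M0 <= 2 * M0 * u by rewrite ler_peMr ?mulr_ge0.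
rewrite !mulrDl; lra.
Qed.

End mean_value.

(** * The Dirichlet ground state on (-1, 1) and the resolvent equation *)

Section ground_state.
Context {R : realType}.
Local Notation w := (pi / 2 : R).
Local Notation mu := (@lebesgue_measure R).

(** The positive Dirichlet eigenfunction: phi''/2 = - lambda phi with lambda = pi^2 / 8. *)
Definition phi (x : R) : R := cos (pi / 2 * x).

Let w0 : 0 < w. Proof. by rewrite divr_gt0// pi_gt0. Qed.

Lemma lambda_BmE : lambda_Bm = (pi / 2) ^+ 2 / 2 :> R.
Proof. by rewrite /lambda_Bm; field. Qed.

Lemma lambda_Bm_gt0 : 0 < lambda_Bm :> R.
Proof. by rewrite lambda_BmE divr_gt0// exprn_gt0. Qed.

Lemma phiN x : phi (- x) = phi x.
Proof. by rewrite /phi mulrN cosN. Qed.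

Lemma phi_abs x : phi `|x| = phi x.
Proof. by case: (ger0P x) => // _; exact: phiN. Qed.

Lemma phi1 : phi 1 = 0.
Proof. by rewrite /phi mulr1 cos_pihalf. Qed.

Lemma phi_le1 x : `|phi x| <= 1.
Proof. by rewrite /phi ler_norml cos_geN1 cos_le1. Qed.

Lemma phi_gt0 x : `|x| < 1 -> 0 < phi x.
Proof.
rewrite ltr_norml => /andP[x1 x2]; apply: cos_gt0_pihalf.
apply/andP; split; first by rewrite -mulrN1 ltr_pM2l.
by rewrite -[ltRHS]mulr1 ltr_pM2l.
Qed.

Lemma phi_le x y : `|x| <= `|y| -> `|y| <= 2 -> phi y <= phi x.
Proof.
move=> xy y2; rewrite -phi_abs -(phi_abs x).
have h u : `|u| <= 2 -> w * `|u| \in `[0, pi].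
  by move=> u2; rewrite in_itv/= mulr_ge0 ?(ltW w0)//= -mulrA ler_piMr ?pi_ge0// ler_pdivrMl// mulr1.
by rewrite /phi leNgt ltr_cos ?h ?(le_trans xy)// -leNgt ler_pM2l.
Qed.

Lemma phi_ge0 x : `|x| <= 1 -> 0 <= phi x.
Proof. by move=> x1; rewrite -phi1 phi_le ?normr1 ?ler1n. Qed.

Lemma phi_le0 x : 1 <= `|x| <= 2 -> phi x <= 0.
Proof. by move=> /andP[x1 x2]; rewrite -phi1 phi_le ?normr1. Qed.

Lemma is_derive_phi x : is_derive x (1 : R) phi (- w * sin (w * x)).
Proof. by rewrite /phi; apply: is_derive_eq; rewrite /GRing.scale/=; ring. Qed.

Lemma continuous_phi : continuous phi.
Proof. by move=> x; exact: is_derive_continuous (is_derive_phi x). Qed.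

Lemma phi_C2 : C2_near phi (fun x => - w * sin (w * x)) (fun x => - w ^+ 2 * phi x).
Proof.
move=> x _; split; first exact: is_derive_phi.
  by rewrite /phi; apply: is_derive_eq; rewrite /GRing.scale/=; ring.
by apply: cvgM; [exact: cvg_cst|exact: continuous_phi].
Qed.

(** For |x| <= 1/2, phi is at least its value at 1/2; beyond that, the mean value theorem from the
    endpoint 1 applies, with slope at least w sin(w / 2) in absolute value, where w = pi / 2. *)
Lemma phi_lower : exists2 c, 0 < c & forall x, `|x| <= 1 -> c * (1 - `|x|) <= phi x.
Proof.
pose c := Num.min (w * sin (w / 2)) (phi 2^-1).
have s0 : 0 < sin (w / 2).
  rewrite sin_gt0_pi// divr_gt0//= ltr_pdivrMr// ltr_pdivrMr//.
  by rewrite -mulrA ltr_pMr ?pi_gt0//; lra.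
have c0 : 0 < c.
  by rewrite lt_min mulr_gt0//= phi_gt0// gtr0_norm// invf_lt1// ltr1n.
exists c => // x x1; rewrite -(phi_abs x); move: x1 (normr_ge0 x).
move: `|x| => {}x x1 x0.
have [x2|x2] := leP x 2^-1.
  rewrite (@le_trans _ _ (phi 2^-1))//; last first.
    by rewrite phi_le// !ger0_norm ?ler1n//; lra.
  rewrite (@le_trans _ _ c)// ?ge_min ?lexx ?orbT// ler_piMr ?(ltW c0)//; lra.
have d u : u \in `[Num.min x 1, Num.max x 1] -> is_derive u (1:R) phi (- w * sin (w * u)).
  by move=> _; exact: is_derive_phi.
have [u] := mean_value d; rewrite (min_idPl x1) (max_idPr x1) in_itv/= => /andP[xu u1].
rewrite phi1 sub0r => /eqP; rewrite eqr_oppLR => /eqP ->.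
rewrite mulNr mulNr opprK ler_wpM2r ?subr_ge0// (@le_trans _ _ (w * sin (w / 2)))//.
  by rewrite ge_min lexx.
rewrite ler_pM2l// leNgt ltr_sin -?leNgt//.
- by rewrite ler_pM2l// (le_trans (ltW x2)).
- rewrite in_itv/=; apply/andP; split.
    by rewrite (@le_trans _ _ 0)// ?oppr_le0 ?(ltW w0)// mulr_ge0// ?(ltW w0)//; lra.
  by rewrite ler_piMr ?(ltW w0).
- rewrite in_itv/=; apply/andP; split.
    by rewrite (@le_trans _ _ 0)// ?oppr_le0 ?(ltW w0)// divr_ge0// ltW.
  by rewrite ler_piMr ?(ltW w0)//; lra.
Qed.

(** At the boundary [psi] vanishes at least linearly and [phi] at most linearly ([phi_lower]), so
    their ratio is bounded. This lets [phi] absorb perturbations by small multiples of [psi]. *)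
Lemma C2_vanish_le_phi psi psi1 psi2 : C2_near psi psi1 psi2 ->
  psi (-1) = 0 -> psi 1 = 0 ->
  exists2 A, 0 <= A & forall x, `|x| <= 1 -> `|psi x| <= A * phi x.
Proof.
move=> hC pN p1; have [c c0 hc] := phi_lower.
have sub (x : R) : x \in `[-1, 1] -> x \in `]-3, 3[.
  by rewrite !in_itv/= => /andP[? ?]; lra.
have [|M M0 hM] := @itv_bounded R psi1 (-1) 1.
  by move=> x /sub/hC [_ h _]; exact: is_derive_continuous h.
exists (M / c); first by rewrite divr_ge0// ltW.
move=> x x1; rewrite -mulrA.
have h : `|psi x| <= M * (1 - `|x|).
  move: (x1); rewrite ler_norml => /andP[x2 x3].
  have [x0|x0] := leP 0 x.
    have d u : u \in `[Num.min 1 x, Num.max 1 x] -> is_derive u (1:R) psi (psi1 u).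
      rewrite (min_idPr x3) (max_idPl x3) in_itv/= => /andP[? ?].
      have u3 : u \in `]-3, 3[ by rewrite in_itv/=; lra.
      by have [] := hC u u3.
    have [u] := mean_value d; rewrite (min_idPr x3) (max_idPl x3) in_itv/= => /andP[? ?].
    rewrite p1 subr0 => ->; rewrite normrM ler_pM ?hM ?in_itv/=//; first by lra.
    by rewrite (ger0_norm x0) ler0_norm; lra.
  have d u : u \in `[Num.min (-1) x, Num.max (-1) x] -> is_derive u (1:R) psi (psi1 u).
    rewrite (min_idPl x2) (max_idPr x2) in_itv/= => /andP[? ?].
    have u3 : u \in `]-3, 3[ by rewrite in_itv/=; lra.
      by have [] := hC u u3.
  have [u] := mean_value d; rewrite (min_idPl x2) (max_idPr x2) in_itv/= => /andP[? ?].
  rewrite pN subr0 => ->; rewrite normrM ler_pM ?hM ?in_itv/=//; first by lra.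
  by rewrite (ltr0_norm x0) ger0_norm; lra.
rewrite (le_trans h)// ler_wpM2l// ler_pdivlMl//.
exact: hc.
Qed.

(** Fredholm alternative for psi''/2 + lambda psi = f. Variation of constants gives psi(x) = (2/w)
    int_{-1}^x sin(w (x - y)) f(y) dy, with w = pi / 2, which vanishes at -1; its value at 1 is a
    multiple of the integral of phi f, so orthogonality is the second boundary condition. *)
Lemma ode (f : R -> R) : continuous f -> \int[mu]_(y in `[-1, 1]) (phi y * f y) = 0 ->
  exists psi psi1, [/\ C2_near psi psi1 (fun x => 2 * f x - w ^+ 2 * psi x),
    psi (-1) = 0 & psi 1 = 0].
Proof.
move=> cf f0.
pose gc y := phi y * f y; pose gs y := sin (w * y) * f y.
have cgc : continuous gc by move=> y; apply: cvgM; [exact: continuous_phi|exact: cf].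
have csin : continuous (fun y => sin (w * y)).
  move=> y; apply: continuous_comp; last exact: continuous_sin.
  by apply: cvgM; [exact: cvg_cst|exact: cvg_id].
have cgs : continuous gs by move=> y; apply: cvgM; [exact: csin|exact: cf].
have int (g : R -> R) a b : continuous g -> mu.-integrable `[a, b] (EFin \o g).
  move=> cg; apply: continuous_compact_integrable; first exact: segment_compact.
  exact: continuous_subspaceT.
(* The primitives start at -3 so that they are differentiable on both sides of -1; their differences
   supply the integrals from -1. *)
pose Ic (x : R) := \int[mu]_(t in `[-3, x]) gc t.
pose Is (x : R) := \int[mu]_(t in `[-3, x]) gs t.
have dI (g : R -> R) (x : R) : continuous g -> x \in `]-3, 3[ ->
    is_derive x (1 : R) (fun x => \int[mu]_(t in `[-3, x]) g t) (g x).
  move=> cg; rewrite in_itv/= => /andP[x3 x3'].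
  have [h1 h2] := @continuous_FTC1_closed R g (-3) x 3 x3' (int g _ _ cg) x3 (cg x).
  by split => //; rewrite -derive1E.
exists (fun x => 2 / w * (sin (w * x) * (Ic x - Ic (-1)) - phi x * (Is x - Is (-1)))).
exists (fun x => 2 * (phi x * (Ic x - Ic (-1)) + sin (w * x) * (Is x - Is (-1)))).
have wn0 : w != 0 by rewrite gt_eqF.
split; last 2 first.
- by rewrite !subrr !mulr0 subr0 mulr0.
- rewrite phi1 mul0r subr0 /Ic Rintegral_itvB; last 3 first.
  + exact: int.
  + by rewrite bnd_simp; lra.
  + by rewrite bnd_simp; lra.
  rewrite Rintegral_itv_obnd_cbnd; last first.
    by apply: integrableS (int gc (-1) 1 cgc) => //; apply: subset_itvr; rewrite bnd_simp.
  by rewrite f0 !mulr0.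
move=> x x3; have dc := dI gc x cgc x3; have ds := dI gs x cgs x3.
rewrite -/Ic in dc; rewrite -/Is in ds.
have dp := is_derive_phi x.
have cs : phi x * phi x + sin (w * x) * sin (w * x) = 1.
  by rewrite /phi -!expr2 cos2Dsin2.
have d1 : is_derive x (1 : R)
    (fun x => 2 / w * (sin (w * x) * (Ic x - Ic (-1)) - phi x * (Is x - Is (-1))))
    (2 * (phi x * (Ic x - Ic (-1)) + sin (w * x) * (Is x - Is (-1)))).
  apply: is_derive_eq; rewrite /GRing.scale/= /gc /gs -/(phi x).
  by move: wn0; move: (pi / 2 : R) => W wn0; field.
split => //.
- apply: is_derive_eq; rewrite /GRing.scale/= /gc /gs -/(phi x).
  have fE : 2 * f x = 2 * ((phi x * phi x + sin (w * x) * sin (w * x)) * f x) by rewrite cs mul1r.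
  rewrite fE; move: wn0; move: (sin (w * x)) (phi x) => S P.
  by move: (pi / 2 : R) => W wn0; field.
- apply: cvgB; first by apply: cvgM; [exact: cvg_cst|exact: cf].
  by apply: cvgM; [exact: cvg_cst|exact: is_derive_continuous d1].
Qed.
End ground_state.

(** * Riemann sums of bounded arrays *)

Section riemann_sums.
Context {R : realType}.
Local Notation mu := (@lebesgue_measure R).

(** The sum is the integral of a step function on half-open cells, where u lies in the cell whose
    index is the displayed truncation. Bounded convergence then applies with only pointwise
    convergence, no continuity of [q]; measurability of [q] is a by-product. *)
Lemma riemann_cvg (a b M : R) (v : nat -> nat -> R) (q : R -> R) : a < b ->
  (forall n i, `|v n i| <= M) ->
  (forall u, a <= u < b ->
    v n (Num.trunc ((u - a) / ((b - a) / n.+1%:R))) @[n --> \oo] --> q u) ->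
  measurable_fun `[a, b[ q /\
  ((b - a) / n.+1%:R * \sum_(i < n.+1) v n i) @[n --> \oo]
    --> \int[mu]_(u in `[a, b]) q u.
Proof.
move=> ab vM vq.
pose dl n : R := (b - a) / n.+1%:R.
have dl0 n : 0 < dl n by rewrite divr_gt0 ?subr_gt0.
pose cell n (i : nat) : set R := `[a + i%:R * dl n, a + i.+1%:R * dl n[%classic.
pose h n u := \sum_(i < n.+1) v n i * \1_(cell n i) u.
have hE n u : a <= u < b -> h n u = v n (Num.trunc ((u - a) / dl n)).
  move=> /andP[au ub].
  have t0 : 0 <= (u - a) / dl n by rewrite divr_ge0 ?subr_ge0// ltW.
  have /andP[t1 t2] := truncn_itv t0.
  set k := Num.trunc _ in t1 t2 *.
  have kn : (k < n.+1)%N.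
    rewrite -(ltr_nat R) (le_lt_trans t1)// ltr_pdivrMr// /dl mulrCA divff ?mulr1 ?ltrD2r//.
  rewrite /h (bigD1 (Ordinal kn))//= big1 ?addr0; last first.
    move=> i ik; rewrite indicE memNset ?mulr0//.
    rewrite /cell/= in_itv/= => /andP[h1 h2].
    move: ik; rewrite -val_eqE/= => /negP; apply; apply/eqP.
    apply/esym/eqP; rewrite /k truncn_eq// ler_pdivlMr// ltr_pdivrMr//.
    by rewrite lerBrDl h1 ltrBlDl h2.
  rewrite indicE mem_set ?mulr1// /cell/= in_itv/=.
  by rewrite -lerBrDl -ltrBlDl -ler_pdivlMr// -ltr_pdivrMr// t1 t2.
have mcell n i : measurable (cell n i) by exact: measurable_itv.
have mh n : measurable_fun setT (h n).
  by apply: (@bdmeas_sum _ _ _ n.+1 (fun i u => v n i * \1_(cell n i) u) _).1 => i _; apply: bdmeasZ; exact: bdmeas_indic.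
have mq : measurable_fun `[a, b[ q.
  apply: (measurable_fun_cvg (h := fun n => h n)).
    by move=> n; exact: measurable_funTS.
  move=> u; rewrite /= in_itv/= => uab; apply: cvg_trans (vq u uab).
  by apply: near_eq_cvg; near=> n; rewrite hE.
split => //.
have fin : (mu `[a, b[%classic < +oo)%E.
  by rewrite lebesgue_measure_itv/= lte_fin ab -EFinB ltry.
have [] := @dominated_convergence _ _ _ mu `[a, b[%classic (measurable_itv _)
  (fun n u => (h n u)%:E) (fun u => (q u)%:E) (fun=> M%:E) _ _ _ _ _.
- by move=> n; apply/measurable_EFinP; apply: measurable_funTS; exact: mh.
- exact/measurable_EFinP.
- apply: aeW => u; rewrite /= in_itv/= => uab; apply: cvg_EFin; first exact: nearW.
  apply: cvg_trans (vq u uab).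
  by apply: near_eq_cvg; near=> n; rewrite /= hE.
- apply: (@measurable_bounded_integrable _ _ _ mu (cst M)) => //.
  exact: bounded_cst.
- by apply: aeW => u n; rewrite /= in_itv/= => uab; rewrite /= lee_fin (hE n u uab).
move=> iq _ Hq.
have bh n : bdmeas (h n).
  by apply: (@bdmeas_sum _ _ _ n.+1 (fun i u => v n i * \1_(cell n i) u) _) => i _; apply: bdmeasZ; exact: bdmeas_indic.
have hint n : mu.-integrable `[a, b[ (EFin \o h n).
  apply: measurable_bounded_integrable => //.
    by apply: measurable_funTS; exact: mh.
  have [_ [K hK]] := bh n.
  by exists K; split; rewrite ?num_real // => x Kx y _; exact: le_trans (hK y) (ltW Kx).
have hint' n i : mu.-integrable `[a, b[ (EFin \o (fun u => v n i * \1_(cell n i) u)).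
  apply: measurable_bounded_integrable => //.
    by apply: measurable_funTS; apply: (bdmeasZ _ (bdmeas_indic (mcell n i))).1.
  have [_ [K hK]] := bdmeasZ (v n i) (bdmeas_indic (mcell n i) (R := R)).
  by exists K; split; rewrite ?num_real // => x Kx y _; exact: le_trans (hK y) (ltW Kx).
have intE n : \int[mu]_(u in `[a, b[) h n u = dl n * \sum_(i < n.+1) v n i.
  rewrite /Rintegral.
  under eq_integral do rewrite /h -sumEFin.
  rewrite integral_sum//; last by move=> i; exact: hint'.
  rewrite mulr_sumr -[RHS]/(fine (\sum_(i < n.+1) dl n * v n i)%:E) -sumEFin; congr fine.
  apply: eq_bigr => i _.
  under eq_integral do rewrite EFinM.
  rewrite integralZl//; last first.
    apply: measurable_bounded_integrable => //.
      by apply: measurable_funTS; exact: (bdmeas_indic (mcell n i)).1.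
    have [_ [K hK]] := bdmeas_indic (mcell n i) (R := R).
    by exists K; split; rewrite ?num_real // => x Kx y _; exact: le_trans (hK y) (ltW Kx).
  rewrite integral_indic//; last exact: mcell.
  rewrite setIidl; last first.
    move=> u; rewrite /cell/= !in_itv/= => /andP[h1 h2]; apply/andP; split.
      by rewrite (le_trans _ h1)// lerDl mulr_ge0// ltW.
    rewrite (lt_le_trans h2)// -lerBrDl.
    rewrite (@le_trans _ _ (n.+1%:R * dl n))//.
      by rewrite ler_pM2r// ler_nat.
    by rewrite /dl mulrCA divff ?mulr1.
  have mcE : mu (cell n i) = (dl n)%:E.
    rewrite [LHS]lebesgue_measure_itv/= lte_fin ltrD2l ltr_pM2r// ltr_nat ltnSn.
    by rewrite -EFinB; congr EFin; rewrite -natr1; ring.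
  rewrite [X in (_ * X)%E](_ : _ = (dl n)%:E); last exact: mcE.
  by rewrite -EFinM mulrC.
have qE : \int[mu]_(u in `[a, b[) q u = \int[mu]_(u in `[a, b]) q u.
  exact: Rintegral_itv_bndo_bndc.
rewrite -qE.
have : EFin \o (fun n => dl n * \sum_(i < n.+1) v n i) @ \oo --> (\int[mu]_(u in `[a, b[) q u)%:E.
  rewrite fineK; last exact: integrable_fin_num.
  apply: cvg_trans Hq; apply: near_eq_cvg; near=> n => /=.
  by rewrite -intE fineK//; apply: integrable_fin_num => //; exact: (hint n).
by move/fine_cvgP => [].
Unshelve. all: by end_near. Qed.

Lemma Rintegral_itv_cvg (a b M : R) (q : nat -> R -> R) (q' : R -> R) : a < b ->
  (forall k, measurable_fun `[a, b[ (q k)) ->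
  (forall k u, a <= u < b -> `|q k u| <= M) ->
  (forall u, a <= u < b -> q k u @[k --> \oo] --> q' u) ->
  (\int[mu]_(u in `[a, b]) q k u) @[k --> \oo] --> \int[mu]_(u in `[a, b]) q' u.
Proof.
move=> ab mq qM qq'.
have mq' : measurable_fun `[a, b[ q'.
  apply: (measurable_fun_cvg (h := q)) => // u; rewrite /= in_itv/=; exact: qq'.
have fin : (mu `[a, b[%classic < +oo)%E.
  by rewrite lebesgue_measure_itv/= lte_fin ab -EFinB ltry.
have [] := @dominated_convergence _ _ _ mu `[a, b[%classic (measurable_itv _)
  (fun n u => (q n u)%:E) (fun u => (q' u)%:E) (fun=> M%:E) _ _ _ _ _.
- by move=> n; apply/measurable_EFinP; exact: mq.
- exact/measurable_EFinP.
- by apply: aeW => u; rewrite /= in_itv/= => uab; apply: cvg_EFin; [exact: nearW|exact: qq'].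
- apply: (@measurable_bounded_integrable _ _ _ mu (cst M)) => //.
  exact: bounded_cst.
- by apply: aeW => u n; rewrite /= in_itv/= => uab; rewrite /= lee_fin; exact: qM.
move=> iq _ Hq.
have iqk k : mu.-integrable `[a, b[ (EFin \o q k).
  apply: measurable_bounded_integrable => //; first exact: mq.
  by exists M; split; rewrite ?num_real // => x Mx y; rewrite /= in_itv/= => yab; exact: le_trans (qM k y yab) (ltW Mx).
rewrite -(Rintegral_itv_bndo_bndc (f := q'))//.
have : EFin \o (fun k => \int[mu]_(u in `[a, b[) q k u) @ \oo --> (\int[mu]_(u in `[a, b[) q' u)%:E.
  rewrite fineK; last exact: integrable_fin_num.
  apply: cvg_trans Hq; apply: near_eq_cvg; near=> k => /=.
  by rewrite fineK//; apply: integrable_fin_num => //; exact: (iqk k).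
move/fine_cvgP => [_]; apply: cvg_trans; apply: near_eq_cvg; near=> k => /=.
by rewrite (Rintegral_itv_bndo_bndc (f := q k)).
Unshelve. all: by end_near. Qed.

End riemann_sums.

(** * Path events as limits of grid events *)

Section grid_events.
Context {R : realType} {d : measure_display} {T : measurableType d}.
Variables (t : R) (t0 : 0 < t) (Z : R -> T -> R).
Hypothesis mZ : forall r, measurable_fun setT (Z r).
Hypothesis cZ : forall x, continuous (Z ^~ x).

Definition mesh (n : nat) : R := t / n.+1%:R.

Definition grid_ge0 (n i : nat) : set T :=
  [set x | forall j, (j <= i)%N -> 0 <= Z (j%:R * mesh n) x].

Definition path_ge0 (r : R) : set T :=
  [set x | forall r', 0 <= r' <= r -> 0 <= Z r' x].

Lemma mesh_gt0 n : 0 < mesh n.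
Proof. by rewrite divr_gt0. Qed.

Lemma mesh_cvg0 : mesh @ \oo --> (0 : R).
Proof.
have -> : mesh = (fun n => t * n.+1%:R^-1) by [].
suff : t * n.+1%:R^-1 @[n --> \oo] --> t * 0 by rewrite mulr0.
by apply: cvgM; [exact: cvg_cst|exact: cvg_harmonic].
Qed.

Lemma trunc_mesh n r : 0 <= r ->
  (Num.trunc (r / mesh n))%:R * mesh n <= r < (Num.trunc (r / mesh n))%:R * mesh n + mesh n.
Proof.
move=> r0; have m0 := mesh_gt0 n.
have /truncn_itv/andP[h1 h2] : 0 <= r / mesh n by rewrite divr_ge0// ltW.
rewrite -ler_pdivlMr// h1/=.
rewrite [ltRHS](_ : _ = (Num.trunc (r / mesh n)).+1%:R * mesh n).
  by rewrite -ltr_pdivrMr.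
by rewrite -natr1 mulrDl mul1r.
Qed.

Lemma trunc_mesh_cvg r : 0 <= r ->
  ((Num.trunc (r / mesh n))%:R * mesh n) @[n --> \oo] --> r.
Proof.
move=> r0; apply/cvgrPdist_lt => e e0.
have /cvgrPdist_lt/(_ e e0) := mesh_cvg0.
apply: filterS => n; rewrite sub0r normrN => me.
have /andP[h1 h2] := trunc_mesh n r0.
rewrite ger0_norm ?subr_ge0//.
by rewrite (le_lt_trans _ (le_lt_trans (ler_norm _) me))// lerBlDl ltW.
Qed.

Lemma measurable_grid_ge0 n i : measurable (grid_ge0 n i).
Proof.
have -> : grid_ge0 n i = \bigcap_(j in `I_i.+1) ((Z (j%:R * mesh n)) @^-1` `[0, +oo[).
  apply/seteqP; split => x /= h.
    by move=> j /=; rewrite ltnS => ji; rewrite in_itv/= h.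
  by move=> j ji; have := h j; rewrite /= in_itv/= andbT ltnS => /(_ ji).
apply: bigcap_measurable => [|j _]; first by exists 0%N.
 rewrite -[X in measurable X]setTI.
exact: mZ.
Qed.

Lemma grid_ge0_cvg r x : 0 <= r ->
  \1_(grid_ge0 n (Num.trunc (r / mesh n))) x @[n --> \oo] --> (\1_(path_ge0 r) x : R).
Proof.
move=> r0; have [xr|xr] := pselect (path_ge0 r x).
  rewrite [X in _ --> X]indicE mem_set//; apply: cvg_near_cst; near=> n.
  rewrite indicE mem_set// => j jn; apply: xr.
  rewrite mulr_ge0 ?(ltW (mesh_gt0 n))//=.
  have /andP[h1 _] := trunc_mesh n r0.
  by rewrite (le_trans _ h1)// ler_pM2r ?mesh_gt0// ler_nat.
rewrite [X in _ --> X]indicE memNset//.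
have [r' r'r Zr'] : exists2 r', 0 <= r' <= r & Z r' x < 0.
  apply: contrapT => h; apply: xr => r' r'r; rewrite leNgt; apply/negP => Zr'.
  by apply: h; exists r'.
have /andP[r'0 r'r2] := r'r.
have Zc : Z ((Num.trunc (r' / mesh n))%:R * mesh n) x @[n --> \oo] --> Z r' x.
  exact: continuous_cvg (@cZ x r') (trunc_mesh_cvg r'0).
apply: cvg_near_cst; near=> n.
rewrite indicE memNset// => h.
have : Z ((Num.trunc (r' / mesh n))%:R * mesh n) x < 0.
  by near: n; exact: cvgr_lt Zc _ Zr'.
rewrite ltNge h//.
by apply: le_truncn; rewrite ler_pM2r ?invr_gt0 ?mesh_gt0.
Unshelve. all: by end_near. Qed.

Lemma measurable_path_ge0 r : 0 <= r -> measurable (path_ge0 r).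
Proof.
move=> r0.
have [m _] : bdmeas (\1_(path_ge0 r) : T -> R).
  apply: (@bdmeas_lim _ _ _ (fun n => \1_(grid_ge0 n (Num.trunc (r / mesh n)))) _ 1).
  - by move=> n; exact/measurable_indic/measurable_grid_ge0.
  - by move=> n x; rewrite indicE; case: (_ \in _); rewrite ?normr1 ?normr0.
  - by move=> x; exact: grid_ge0_cvg.
have -> : path_ge0 r = setT `&` (\1_(path_ge0 r) : T -> R) @^-1` [set 1].
  apply/seteqP; split => x /=.
    by move=> xr; rewrite indicE mem_set.
  rewrite indicE => -[_]; case: (boolP (x \in _)); first by rewrite inE.
  by move=> _ /eqP; rewrite eq_sym oner_eq0.
by apply: m => //.
Qed.

End grid_events.

(** * Weighted image laws and independence *)

Section weighted_law.
Context {R : realType} {d d' : measure_display}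
  {T : measurableType d} {U : measurableType d'}.
Variables (Q : probability T R) (G : T -> R) (Y : T -> U).
Variables (bG : bdmeas G) (G0 : forall x, 0 <= G x) (mY : measurable_fun setT Y).

(** The law of [Y] under the measure with density [G]. The proofs are arguments so that the finite
    measure structure can be attached to the term. *)
Definition wlaw of bdmeas G & (forall x, 0 <= G x) & measurable_fun setT Y :=
  fun A : set U => (\int[Q]_(x in Y @^-1` A) (G x)%:E)%E.

Local Notation m := (wlaw bG G0 mY).

Let mpre A : measurable A -> measurable (Y @^-1` A).
Proof. by move=> mA; rewrite -[X in measurable X]setTI; exact: mY. Qed.

Let wlaw0 : m set0 = 0%E.
Proof. by rewrite /wlaw preimage_set0 integral_set0. Qed.

Let wlaw_ge0 A : (0 <= m A)%E.
Proof. by apply: integral_ge0 => x _; rewrite lee_fin. Qed.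

Let wlaw_sigma_additive : semi_sigma_additive m.
Proof.
move=> F mF tF mUF; rewrite /wlaw preimage_bigcup ge0_integral_bigcup//.
- apply: is_cvg_ereal_nneg_natsum_cond => n _ _.
  by apply: integral_ge0 => x _; rewrite lee_fin.
- by move=> i; exact: mpre.
- by apply/measurable_EFinP/measurable_funTS; case: bG.
- by move=> x _; rewrite lee_fin.
- move/trivIsetP : tF => tF; apply/trivIsetP => i j _ _ ij.
  by rewrite -preimage_setI tF// preimage_set0.
Qed.

HB.instance Definition _ := isMeasure.Build _ _ _ m wlaw0 wlaw_ge0 wlaw_sigma_additive.

Let wlaw_finite : fin_num_fun m.
Proof.
move=> A mA; apply: integrable_fin_num; first exact: mpre.
apply: integrableS (bdmeas_integrable Q bG) => //; exact: mpre.
Qed.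

HB.instance Definition _ := @Measure_isFinite.Build _ _ _ m wlaw_finite.

Lemma wlawE A : measurable A -> m A = (\int[Q]_x (\1_A (Y x) * G x)%:E)%E.
Proof.
move=> mA; rewrite /wlaw integral_mkcond; apply: eq_integral => x _.
rewrite patchE indicE; case: ifPn => h.
  by rewrite mem_set ?mul1r//; move: h; rewrite inE.
by rewrite memNset ?mul0r//; move: h; rewrite notin_setE.
Qed.

Lemma expect_wlaw (f : U -> R) : bdmeas f -> (forall u, 0 <= f u) ->
  (\int[m]_u (f u)%:E = (\int[Q]_x (f (Y x) * G x))%:E)%E.
Proof.
move=> bf f0; rewrite (@ge0_integral_law _ _ _ _ _ Q m G Y)//.
- by rewrite -expectE//; apply: bdmeasM => //; exact: bdmeas_comp bf mY.
- by case: bG.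
- exact: wlawE.
- by apply/measurable_EFinP; case: bf.
Qed.

End weighted_law.

Lemma indic_pair {R : realType} {U V : Type} (A : set U) (B : set V) u v :
  \1_(A `*` B) (u, v) = \1_A u * \1_B v :> R.
Proof.
rewrite !indicE -natrM mulnb; congr (nat_of_bool _)%:R.
by apply/idP/andP; rewrite !inE.
Qed.

Section independence.
Context {R : realType} {d d1 d2 : measure_display} {T : measurableType d}
  {U : measurableType d1} {V : measurableType d2}.
Variables (Q : probability T R) (N : probability V R).
Variables (G : T -> R) (Y : T -> U) (xi : T -> V).
Hypotheses (bG : bdmeas G) (G0 : forall x, 0 <= G x).
Hypotheses (mY : measurable_fun setT Y) (mxi : measurable_fun setT xi).
Hypothesis indep : forall A B, measurable A -> measurable B ->
  \int[Q]_x (\1_A (Y x) * \1_B (xi x) * G x) =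
  \int[Q]_x (\1_A (Y x) * G x) * fine (N B).

Let mYxi : measurable_fun setT (fun x => (Y x, xi x)).
Proof. exact: measurable_fun_pair. Qed.

Let ge0_expect_indep (H : U * V -> R) : bdmeas H -> (forall z, 0 <= H z) ->
  \int[Q]_x (H (Y x, xi x) * G x) = \int[Q]_x ((\int[N]_z H (Y x, z)) * G x).
Proof.
move=> bH H0.
pose m1 := wlaw Q bG G0 mY.
pose m2 := wlaw Q bG G0 mYxi.
have mE A : measurable A -> (m1 \x N)%E A = m2 A.
  move=> mA; apply: product_measure_unique => // {mA}A B mA mB.
  have mYA : bdmeas (fun x => \1_A (Y x) * G x).
    by apply: bdmeasM => //; exact: bdmeas_comp (bdmeas_indic mA) mY.
  rewrite /= [LHS]wlawE; last exact: measurableX.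
  rewrite [X in (X * _)%E]wlawE//.
  have -> : N B = (fine (N B))%:E by rewrite fineK// fin_num_measure.
  rewrite !expectE// -?EFinM -?indep//.
    by congr EFin; apply: eq_Rintegral => x _; rewrite indic_pair.
  apply: bdmeasM => //.
  apply: (bdmeas_comp (bdmeas_indic (R := R) (measurableX mA mB)) mYxi).
apply: EFin_inj; rewrite -expect_wlaw// -/m2.
have bF := bdmeas_fubini N bH.
rewrite -(expect_wlaw Q bG G0 mY bF); last first.
  by move=> y; apply: Rintegral_ge0.
rewrite -/m1.
rewrite (eq_measure_integral (m1 \x N)%E); last by move=> A mA _; exact/esym/mE.
rewrite fubini_tonelli1; last 2 first.
- by apply/measurable_EFinP; case: bH.
- by move=> z; rewrite lee_fin.
apply: eq_integral => y _; rewrite /fubini_F expectE//.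
apply: bdmeas_comp bH _; exact: pair1_measurable.
Qed.

(** The G-weighted joint law of ([Y], [xi]) agrees on rectangles with the product of the weighted
    law of [Y] and [N], hence everywhere; Tonelli integrates [xi] out. The signed case follows by
    adding a constant. *)
Lemma expect_indep (H : U * V -> R) : bdmeas H ->
  \int[Q]_x (H (Y x, xi x) * G x) = \int[Q]_x ((\int[N]_z H (Y x, z)) * G x).
Proof.
move=> bH; have [_ [M hM]] := bH.
pose H' z := H z + M.
have bH' : bdmeas H' by apply: bdmeasD => //; exact: bdmeas_cst.
have H'0 z : 0 <= H' z.
  by rewrite /H'; have := hM z; rewrite ler_norml => /andP[? _]; lra.
have := ge0_expect_indep bH' H'0.
have bHY : bdmeas (fun x => H (Y x, xi x) * G x).
  by apply: bdmeasM => //; exact: bdmeas_comp bH mYxi.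
have bN y : bdmeas (fun z => H (y, z)).
  by apply: bdmeas_comp bH _; exact: pair1_measurable.
have bKY : bdmeas (fun x => (\int[N]_z H (Y x, z)) * G x).
  by apply: bdmeasM => //; exact: bdmeas_comp (bdmeas_fubini N bH) mY.
have -> : \int[Q]_x (H' (Y x, xi x) * G x) = \int[Q]_x (H (Y x, xi x) * G x) + M * \int[Q]_x G x.
  rewrite -expectZ// -expectD//; last exact: bdmeasZ.
  by apply: eq_Rintegral => x _; rewrite /H' mulrDl.
have -> : \int[Q]_x ((\int[N]_z H' (Y x, z)) * G x) =
    \int[Q]_x ((\int[N]_z H (Y x, z)) * G x) + M * \int[Q]_x G x.
  rewrite -expectZ// -expectD//; last exact: bdmeasZ.
  apply: eq_Rintegral => x _; rewrite /H' expectD//; last exact: bdmeas_cst.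
  by rewrite expect_cst mulrDl.
exact: addIr.
Qed.

End independence.

(** * Gaussian random walks and their extraction from Brownian motion *)

Section gaussian_step.
Context {R : realType}.

Definition gstep (s : R) (h : R -> R) (y : R) : R := \int[normal_prob 0 s]_z h (y + z).

Lemma bdmeas_add (h : R -> R) : bdmeas h -> bdmeas (fun z : R * measurableTypeR R => h (z.1 + z.2)).
Proof.
move=> bh; apply: bdmeas_comp bh _.
by apply: measurable_funD; [exact: measurable_fst|exact: measurable_snd].
Qed.

Lemma bdmeas_shift (h : R -> R) y : bdmeas h -> bdmeas (fun z : R => h (y + z)).
Proof.
move=> bh; apply: bdmeas_comp bh _.
by apply: measurable_funD; [exact: measurable_cst|exact: measurable_id].
Qed.

Lemma bdmeas_gstep s h : bdmeas h -> bdmeas (gstep s h).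
Proof.
move=> /bdmeas_add bh.
exact: (bdmeas_fubini (normal_prob 0 s) bh).
Qed.

End gaussian_step.

Section chain.
Context {R : realType} {d : measure_display} {T : measurableType d}.

(** The Markov property of a Gaussian walk of step deviation [s], in exactly the form used: tested
    against product functionals of the past, with nonnegative factors so that they can serve as
    weights. *)
Definition chain (Q : probability T R) (Y : nat -> T -> R) (s : R) : Prop :=
  (forall i, measurable_fun setT (Y i)) /\
  forall i (F : nat -> R -> R) (h : R -> R),
    (forall j, bdmeas (F j)) -> (forall j y, 0 <= F j y) -> bdmeas h ->
    \int[Q]_x ((\prod_(j < i.+1) F j (Y j x)) * h (Y i.+1 x)) =
    \int[Q]_x ((\prod_(j < i.+1) F j (Y j x)) * gstep s h (Y i x)).

End chain.

Section brownian_chain.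
Context {R : realType} {d : measure_display} {Omega : measurableType d}.
Variables (P : probability Omega R) (W : R -> Omega -> R).
Hypothesis hW : is_std_BM P W.
Variables (nu : probability R R) (c dt : R) (dt0 : 0 < dt).

Local Notation T := (R * Omega)%type.
Local Notation Q := (prodp nu P).
Local Notation N := (normal_prob (0:R) (Num.sqrt dt)).

Let Y (i : nat) (z : T) : R := c * z.1 + W (i%:R * dt) z.2.
Let xi (i : nat) (z : T) : R := W (i.+1%:R * dt) z.2 - W (i%:R * dt) z.2.

Let mW r : measurable_fun setT (fun z : T => W r z.2).
Proof. by apply: measurableT_comp; [exact: hW.1|exact: measurable_snd]. Qed.

Let mY i : measurable_fun setT (Y i).
Proof.
by apply: measurable_funD => //; apply: measurable_funM => //; exact: measurable_fst.
Qed.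

Let mxi i : measurable_fun setT (xi i).
Proof. by apply: measurable_funB. Qed.

Let Y0E z : Y 0 z = c * z.1.
Proof. by rewrite /Y mul0r hW.2.1 addr0. Qed.

Let YS i z : Y i.+1 z = Y i z + xi i z.
Proof. by rewrite /Y /xi; ring. Qed.

Let bind i B : measurable B -> bdmeas (fun z => \1_B (xi i z) : R).
Proof. by move=> mB; exact: bdmeas_comp (bdmeas_indic mB) (mxi i). Qed.

Let bindp i m (B : nat -> set R) : (forall l, measurable (B l)) ->
  bdmeas (fun z => \prod_(l < m) \1_(B l) (xi (i + l) z) : R).
Proof.
move=> mB; apply: (@bdmeas_prod _ _ _ m (fun l z => \1_(B l) (xi (i + l) z))) => l _.
exact: bind.
Qed.

Let bprod i (F : nat -> R -> R) : (forall j, bdmeas (F j)) ->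
  bdmeas (fun z => \prod_(j < i) F j (Y j z)).
Proof.
move=> bF; apply: (@bdmeas_prod _ _ _ i (fun j z => F j (Y j z))) => j _.
exact: bdmeas_comp (bF j) (mY j).
Qed.

Let incr_indep m (B : nat -> set R) : (forall l, measurable (B l)) ->
  \int[P]_w (\prod_(l < m) \1_(B l) (W (l.+1%:R * dt) w - W (l%:R * dt) w)) =
  \prod_(l < m) fine (N (B l)).
Proof.
move=> mB; have [_ [_ [_ /(_ m (fun i => i%:R * dt))]]] := hW.
move=> /(_ (mul0r _)) /(_ _)/(_ B mB).
have lt i : (i < m)%N -> i%:R * dt < i.+1%:R * dt by rewrite ltr_pM2r// ltr_nat.
move=> /(_ lt).
under [X in _ = X -> _]eq_bigr => i _.
  have -> : i.+1%:R * dt - i%:R * dt = dt by rewrite -natr1; ring.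
  over.
move=> E.
have mD l : measurable [set w | B l (W (l.+1%:R * dt) w - W (l%:R * dt) w)].
  rewrite -[X in measurable X]setTI.
  have mWl : measurable_fun setT (fun w => W (l.+1%:R * dt) w - W (l%:R * dt) w).
    by apply: measurable_funB; exact: hW.1.
  exact: mWl.
transitivity (fine (P (\bigcap_(l < m) [set w | B l (W (l.+1%:R * dt) w - W (l%:R * dt) w)]))).
  rewrite -expect_indic; last first.
    rewrite bigcap_mkord; apply: bigsetI_measurable => l _; exact: mD.
  apply: eq_Rintegral => w _; rewrite indicE.
  have [h|h] := pselect ((\bigcap_(l < m) [set w | B l (W (l.+1%:R * dt) w - W (l%:R * dt) w)]) w).
    by rewrite mem_set// big1// => l _; rewrite indicE mem_set//; apply: h => /=.
  rewrite memNset//.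
  have [l lm Bl] : exists2 l, (l < m)%N & ~ B l (W (l.+1%:R * dt) w - W (l%:R * dt) w).
    apply: contrapT => h'; apply: h => l /= lm; apply: contrapT => h2; apply: h'.
    by exists l.
  by rewrite (bigD1 (Ordinal lm))//= indicE memNset// mul0r.
rewrite E.
have -> : (\prod_(i < m) N (B i))%E = (\prod_(i < m) fine (N (B i)))%:E.
  elim: m {E lt} => [|m IH]; first by rewrite !big_ord0.
  by rewrite !big_ord_recr/= IH EFinM fineK//; apply: fin_num_measure; exact: mB.
by [].
Qed.

(** Induction invariant: the positions up to index i are independent of all later increments.
    Carrying the later increments along is what allows the induction to proceed. *)
Let C i := forall (F : nat -> R -> R) m (B : nat -> set R),
  (forall j, bdmeas (F j)) -> (forall j y, 0 <= F j y) -> (forall l, measurable (B l)) ->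
  \int[Q]_z ((\prod_(j < i.+1) F j (Y j z)) * \prod_(l < m) \1_(B l) (xi (i + l) z)) =
  \int[Q]_z (\prod_(j < i.+1) F j (Y j z)) * \prod_(l < m) fine (N (B l)).

(** The increment [xi i] is integrated out by [expect_indep], with the past product and the later
    increments together as the weight. *)
Let Cstep i : C i -> forall (F : nat -> R -> R) m (B : nat -> set R) (h : R -> R),
  (forall j, bdmeas (F j)) -> (forall j y, 0 <= F j y) -> (forall l, measurable (B l)) ->
  bdmeas h ->
  \int[Q]_z (h (Y i.+1 z) *
    ((\prod_(j < i.+1) F j (Y j z)) * \prod_(l < m) \1_(B l) (xi (i.+1 + l) z))) =
  \int[Q]_z (gstep (Num.sqrt dt) h (Y i z) *
    ((\prod_(j < i.+1) F j (Y j z)) * \prod_(l < m) \1_(B l) (xi (i.+1 + l) z))).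
Proof.
move=> Ci F m B h bF F0 mB bh.
pose G z := (\prod_(j < i.+1) F j (Y j z)) * \prod_(l < m) \1_(B l) (xi (i.+1 + l) z).
have bG : bdmeas G by apply: bdmeasM; [exact: bprod|exact: bindp].
have G0 z : 0 <= G z.
  by rewrite mulr_ge0// prodr_ge0// => l _; rewrite indicE ler0n.
have := @expect_indep _ _ _ _ _ _ _ Q N G (Y i) (xi i) bG G0 (mY i) (mxi i) _ _ (bdmeas_add bh).
rewrite /= => <-.
  by apply: eq_Rintegral => z _; rewrite YS.
move=> A D mA mD.
(* The event on [Y i] is absorbed into the last factor of the past and the one on [xi i] becomes the
   first of the future increments, so that [C i] evaluates rectangles. *)
pose F' j := if j == i then (fun y => F j y * \1_A y) else F j.
have bF' j : bdmeas (F' j).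
  by rewrite /F'; case: eqP => // _; apply: bdmeasM => //; exact: bdmeas_indic.
have F'0 j y : 0 <= F' j y.
  by rewrite /F'; case: eqP => // _; rewrite mulr_ge0// indicE ler0n.
have F'E z : \prod_(j < i.+1) F' j (Y j z) = \1_A (Y i z) * \prod_(j < i.+1) F j (Y j z).
  rewrite !big_ord_recr/=.
  have -> : F' i (Y i z) = F i (Y i z) * \1_A (Y i z) by rewrite /F' eqxx.
  have -> : \prod_(j < i) F' j (Y j z) = \prod_(j < i) F j (Y j z).
    by apply: eq_bigr => j _; rewrite /F' ltn_eqF.
  ring.
pose B' (D : set R) l := if l is l'.+1 then B l' else D.
have mB' D' : measurable D' -> forall l, measurable (B' D' l).
  by move=> ? [|l] /=.
have B'E D' z : \prod_(l < m.+1) \1_(B' D' l) (xi (i + l) z) =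
    \1_D' (xi i z) * \prod_(l < m) \1_(B l) (xi (i.+1 + l) z) :> R.
  rewrite big_ord_recl/= addn0; congr (_ * _); apply: eq_bigr => l _.
  by rewrite /= /bump/= add1n addnS addSn.
have E D' : measurable D' -> \int[Q]_z (\1_A (Y i z) * \1_D' (xi i z) * G z) =
    \int[Q]_z (\prod_(j < i.+1) F' j (Y j z)) * (fine (N D') * \prod_(l < m) fine (N (B l))).
  move=> mD'; have := Ci F' m.+1 (B' D') bF' F'0 (mB' _ mD').
  rewrite [in RHS]big_ord_recl/= => <-.
  apply: eq_Rintegral => z _; rewrite B'E F'E /G; ring.
rewrite E//.
have -> : \int[Q]_z (\1_A (Y i z) * G z) = \int[Q]_z (\1_A (Y i z) * \1_setT (xi i z) * G z).
  by apply: eq_Rintegral => z _; rewrite indicT/= mulr1.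
rewrite E//.
have -> : fine (N setT) = 1.
  by rewrite -[RHS]/(fine 1%E); congr fine; exact: probability_setT.
ring.
Qed.

Let Call i : C i.
Proof.
elim: i => [F m B bF F0 mB|i IH F m B bF F0 mB].
  have bG : bdmeas (fun z => (\prod_(j < 1) F j (Y j z)) * \prod_(l < m) \1_(B l) (xi (0 + l) z)).
    by apply: bdmeasM; [exact: (bprod 1)|exact: bindp].
  rewrite expect_prod// expect_prod; last exact: (bprod 1).
  rewrite mulrC -expectZ; last exact: bdmeas_fubini (bprod 1 bF).
  apply: eq_Rintegral => x _.
  have EY w : \prod_(j < 1) F j (Y j (x, w)) = F 0%N (c * x).
    by rewrite big_ord_recl big_ord0 mulr1 Y0E.
  under eq_Rintegral do rewrite EY.
  under [in RHS]eq_Rintegral do rewrite EY.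
  rewrite expect_cst expectZ ?incr_indep ?(mulrC (F _ _))//.
  apply: (bdmeas_comp (bindp 0 m mB) (Y := fun w => (x, w))).
  exact: pair1_measurable.
(* By [Cstep] the newest factor may be replaced by its Gaussian average at the previous position,
   which reduces the product to length i + 1 and to the induction hypothesis. *)
pose F' j := if j == i then (fun y => F j y * gstep (Num.sqrt dt) (F i.+1) y) else F j.
have bF' j : bdmeas (F' j).
  by rewrite /F'; case: eqP => // _; apply: bdmeasM => //; exact: bdmeas_gstep.
have F'0 j y : 0 <= F' j y.
  by rewrite /F'; case: eqP => // _; rewrite mulr_ge0//; apply: Rintegral_ge0.
have F'E z : \prod_(j < i.+1) F' j (Y j z) =
    gstep (Num.sqrt dt) (F i.+1) (Y i z) * \prod_(j < i.+1) F j (Y j z).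
  rewrite !big_ord_recr/=.
  have -> : F' i (Y i z) = F i (Y i z) * gstep (Num.sqrt dt) (F i.+1) (Y i z) by rewrite /F' eqxx.
  have -> : \prod_(j < i) F' j (Y j z) = \prod_(j < i) F j (Y j z).
    by apply: eq_bigr => j _; rewrite /F' ltn_eqF.
  ring.
have E m' (B' : nat -> set R) : (forall l, measurable (B' l)) ->
    \int[Q]_z (\prod_(j < i.+2) F j (Y j z) * \prod_(l < m') \1_(B' l) (xi (i.+1 + l) z)) =
    \int[Q]_z (\prod_(j < i.+1) F' j (Y j z)) * \prod_(l < m') fine (N (B' l)).
  move=> mB'.
  pose B'' l := if l is l'.+1 then B' l' else setT.
  have mB'' l : measurable (B'' l) by case: l => [|l] /=.
  have := IH F' m'.+1 B'' bF' F'0 mB''.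
  rewrite [in RHS]big_ord_recl/=.
  have -> : fine (N setT) = 1.
    by rewrite -[RHS]/(fine 1%E); congr fine; exact: probability_setT.
  rewrite mul1r => <-.
  transitivity (\int[Q]_z (F i.+1 (Y i.+1 z) *
    ((\prod_(j < i.+1) F j (Y j z)) * \prod_(l < m') \1_(B' l) (xi (i.+1 + l) z)))).
    by apply: eq_Rintegral => z _; rewrite big_ord_recr/=; ring.
  rewrite Cstep//; apply: eq_Rintegral => z _.
  rewrite F'E mulrA; congr (_ * _).
  rewrite big_ord_recl/= indicT/= mul1r; apply: eq_bigr => l _.
  by rewrite /= /bump/= add1n addnS addSn.
rewrite E//; congr (_ * _).
have := E 0%N B mB; rewrite big_ord0 mulr1 => <-.
by apply: eq_Rintegral => z _; rewrite big_ord0 mulr1.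
Qed.

Lemma chain_BM : chain Q (fun i z => c * z.1 + W (i%:R * dt) z.2) (Num.sqrt dt).
Proof.
split; first exact: mY.
move=> i F h bF F0 bh.
have := @Cstep i (@Call i) F 0 (fun=> setT) h bF F0 (fun=> measurableT) bh.
under eq_Rintegral do rewrite big_ord0 mulr1 mulrC.
by under [X in _ = X -> _]eq_Rintegral do rewrite big_ord0 mulr1 mulrC.
Qed.

End brownian_chain.

(** * One Gaussian step as an approximate heat flow *)

Section gaussian_generator.
Context {R : realType}.

Lemma C2_cut2 (psi psi1 psi2 : R -> R) : C2_near psi psi1 psi2 -> bdmeas (cut2 psi).
Proof.
move=> hC.
have sub (x : R) : x \in `[-2, 2] -> x \in `]-3, 3[.
  by rewrite !in_itv/= => /andP[? ?]; lra.
have cp (x : R) : x \in `[-2, 2] -> {for x, continuous psi}.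
  by move=> /sub/hC [h _ _]; exact: is_derive_continuous h.
split.
  have -> : cut2 psi = psi \_ `[-2, 2].
    apply/funext => x; rewrite /cut2 patchE indicE; case: ifPn => _; rewrite ?mulr1 ?mulr0//.
  apply/(measurable_restrictT psi); first exact: measurable_itv.
  apply: subspace_continuous_measurable_fun; first exact: measurable_itv.
  by apply: continuous_in_subspaceT => x; rewrite inE; exact: cp.
have [M M0 hM] := itv_bounded cp.
exists M => x; rewrite /cut2 indicE; case: (boolP (x \in _)); rewrite ?mulr1 ?mulr0 ?normr0//.
by rewrite inE => h; exact: hM.
Qed.

Lemma bdmeas_div (h : R -> R) (L : R) : bdmeas h -> bdmeas (fun y : R => h (y / L)).
Proof.
move=> bh; apply: bdmeas_comp bh _.
by apply: measurable_funM; [exact: measurable_id|exact: measurable_cst].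
Qed.

(** The discrete Ito formula: Taylor's bound averaged by [normal_taylor]. By scaling it depends on s
    and L only through s / L, hence the uniformity over all radii. *)
Lemma gstep_C2 (psi psi1 psi2 : R -> R) : C2_near psi psi1 psi2 ->
  forall e : R, 0 < e -> exists2 s0 : R, 0 < s0 & forall s L y, 0 < s -> 0 < L ->
    s / L <= s0 -> `|y| <= L ->
    `|gstep s (fun y : R => cut2 psi (y / L)) y
       - (psi (y / L) + (s / L) ^+ 2 * (psi2 (y / L) / 2))| <= e * (s / L) ^+ 2.
Proof.
move=> hC e e0; have e20 : 0 < e / 2 by rewrite divr_gt0.
have [C C0 hT] := taylor_cut2 hC e20.
(* For u = s / L <= s0 the quartic term 3 C u^4 is at most (e / 2) u^2. *)
pose s0 := Num.min 1 (e / (2 * (3 * C + 1))).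
have d0 : 0 < 2 * (3 * C + 1) by rewrite mulr_gt0// ltr_wpDl// mulr_ge0.
exists s0; first by rewrite lt_min ltr01 divr_gt0.
move=> s L y sp Lp sL yL; set x := y / L.
have x1 : x \in `[-1, 1].
  by rewrite in_itv/= -ler_norml normrM normfV (gtr0_norm Lp) ler_pdivrMr// mul1r.
have u0 : 0 < s / L by rewrite divr_gt0.
have bh : bdmeas (fun z : R => cut2 psi ((y + z) / L)).
  exact: bdmeas_shift (bdmeas_div L (C2_cut2 hC)).
have Ln0 : L != 0 by rewrite gt_eqF.
have hz (z : R) : `|cut2 psi ((y + z) / L) -
    (psi x + psi1 x / L * z + psi2 x / 2 / L ^+ 2 * z ^+ 2)|
    <= e / 2 / L ^+ 2 * z ^+ 2 + C / L ^+ 4 * z ^+ 4.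
  have := hT x (z / L) x1.
  rewrite (_ : x + z / L = (y + z) / L); last by rewrite /x -mulrDl.
  rewrite (_ : psi x + psi1 x * (z / L) + psi2 x / 2 * (z / L) ^+ 2 =
    psi x + psi1 x / L * z + psi2 x / 2 / L ^+ 2 * z ^+ 2); last by field.
  by rewrite (_ : e / 2 * (z / L) ^+ 2 + C * (z / L) ^+ 4 =
    e / 2 / L ^+ 2 * z ^+ 2 + C / L ^+ 4 * z ^+ 4)//; field.
have C4 : 0 <= C / L ^+ 4 by rewrite divr_ge0// exprn_ge0// ltW.
have K := normal_taylor sp bh hz C4.
rewrite /gstep (_ : (s / L) ^+ 2 * (psi2 x / 2) = psi2 x / 2 / L ^+ 2 * s ^+ 2); last by field.
apply: (le_trans K).
rewrite (_ : e / 2 / L ^+ 2 * s ^+ 2 + 3 * (C / L ^+ 4) * s ^+ 4 =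
   (e / 2 + 3 * C * (s / L) ^+ 2) * (s / L) ^+ 2); last by field.
rewrite ler_wpM2r ?sqr_ge0//.
suff : 3 * C * (s / L) ^+ 2 <= e / 2 by lra.
have u1 : s / L <= 1 by rewrite (le_trans sL)// ge_min lexx.
have u2 : s / L <= e / (2 * (3 * C + 1)) by rewrite (le_trans sL)// ge_min lexx orbT.
have u3 : (s / L) ^+ 2 <= s / L by rewrite expr2 ler_piMr// ltW.
have : (s / L) * (2 * (3 * C + 1)) <= e by rewrite -ler_pdivlMr.
have : 3 * C * (s / L) ^+ 2 <= 3 * C * (s / L) by rewrite ler_wpM2l// mulr_ge0.
move: u0; set u := s / L; move=> u0 h1 h2; lra.
Qed.

(** To reach norm r the step itself must have size at least eta, so [normal_tail] applies. *)
Lemma gstep_tail (s r eta y : R) : 0 < s -> 0 < eta -> `|y| + eta <= r ->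
  gstep s (\1_[set z | r <= `|z|]) y <= 3 * s ^+ 4 / eta ^+ 4.
Proof.
move=> sp eta0 yr; apply: le_trans (normal_tail sp eta0).
have mA (a : R) : measurable [set z : R | a <= `|z|].
  rewrite -[X in measurable X]setTI.
  have -> : [set z : R | a <= `|z|] = (@Num.norm R R) @^-1` `[a, +oo[.
    by apply/seteqP; split => z /=; rewrite in_itv/= andbT.
  exact: normr_measurable.
apply: le_expect.
- exact: (bdmeas_shift y (bdmeas_indic (mA r))).
- exact: (bdmeas_indic (mA eta)).
move=> z; rewrite !indicE ler_nat.
case: (boolP (_ \in _)) => // h.
rewrite mem_set//=; move: h; rewrite inE/= => h.
have := ler_normD y z; lra.
Qed.

End gaussian_generator.

(** * Lower bound for the probability of staying in growing balls *)

Section gstep_algebra.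
Context {R : realType}.
Implicit Types (h k : R -> R) (s y : R).

Lemma le_gstep s h k y : bdmeas h -> bdmeas k -> (forall z, h z <= k z) ->
  gstep s h y <= gstep s k y.
Proof.
move=> bh bk hk; apply: le_expect => [||z]; last exact: hk.
- exact: bdmeas_shift.
- exact: bdmeas_shift.
Qed.

Lemma gstepD s h k y : bdmeas h -> bdmeas k ->
  gstep s (fun z => h z + k z) y = gstep s h y + gstep s k y.
Proof. by move=> bh bk; apply: expectD; exact: bdmeas_shift. Qed.

Lemma gstepZ s h c y : bdmeas h -> gstep s (fun z => c * h z) y = c * gstep s h y.
Proof. by move=> bh; apply: expectZ; exact: bdmeas_shift. Qed.

Definition cball (r : R) : set R := [set y | `|y| <= r].

Lemma measurable_cball r : measurable (cball r).
Proof.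
rewrite -[X in measurable X]setTI.
have -> : cball r = (@Num.norm R R) @^-1` `]-oo, r].
  by apply/seteqP; split => z /=; rewrite in_itv/=.
exact: normr_measurable.
Qed.

Lemma bdmeas_cball r : bdmeas (\1_(cball r) : R -> R).
Proof. by apply: bdmeas_indic; exact: measurable_cball. Qed.

Lemma cballE r y : \1_(cball r) y = (`|y| <= r)%R%:R :> R.
Proof.
rewrite indicE; have [yr|yr] := boolP (`|y| <= r); first by rewrite mem_set.
by rewrite memNset//; exact/negP.
Qed.

Lemma cball01 r y : 0 <= (\1_(cball r) y : R) <= 1.
Proof. by rewrite cballE; case: (`|y| <= r)%R; rewrite ?lexx ?ler01. Qed.

End gstep_algebra.

Section chain_estimates.
Context {R : realType}.
Local Notation lam := (@lambda_Bm R).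

(** Converts a product of factors 1 - x into an exponential, at the price of 1 + e in the exponent:
    (1 - x)(1 + (1 + e) x) >= 1 in this range. *)
Lemma expRN_le (e x : R) : 0 < e -> 0 <= x -> (1 + e) * x <= e ->
  expR (- ((1 + e) * x)) <= 1 - x.
Proof.
move=> e0 x0 xe; have x1 : 0 <= (1 + e) * x by rewrite mulr_ge0// addr_ge0// ltW.
rewrite expRN -[leLHS]mul1r ler_pdivrMr ?expR_gt0//.
have h : 1 + (1 + e) * x <= expR ((1 + e) * x) by exact: expR_ge1Dx.
have x2 : 0 <= 1 - x.
  have : x <= (1 + e) * x by rewrite ler_peMl// lerDl ltW.
  have : x + x * e <= e by move: xe; rewrite mulrDl mul1r (mulrC e).
  move=> h1 h2; rewrite subr_ge0 leNgt; apply/negP => x1'.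
  have : e < x * e by rewrite ltr_pMl.
  by lra.
apply: (le_trans _ (ler_wpM2l x2 h)).
have : x * ((1 + e) * x) <= x * e by rewrite ler_wpM2l.
lra.
Qed.

Lemma bdmeas_phi_cball (L : R) : bdmeas (fun y : R => phi (y / L) * \1_(cball L) y).
Proof.
apply: bdmeasM; last exact: bdmeas_cball.
apply: bdmeas_div; split; last by exists 1 => x; exact: phi_le1.
by apply: continuous_measurable_fun; exact: continuous_phi.
Qed.

(** [phi] cut off at the larger ball is a subsolution. It dominates the uncut truncated [phi] of the
    smaller ball, which is nonpositive between radii L and 2 L and increases with the radius inside;
    [gstep_C2] applies to the latter. *)
Lemma gstep_phi_ge (e : R) : 0 < e -> exists2 s0 : R, 0 < s0 &
  forall s L L' y, 0 < s -> 0 < L -> L <= L' -> s / L <= s0 -> `|y| <= L ->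
  (1 - lam * (s / L) ^+ 2) * phi (y / L) - e * (s / L) ^+ 2 <=
  gstep s (fun y => phi (y / L') * \1_(cball L') y) y.
Proof.
move=> e0; have [s0 s00 hs] := gstep_C2 (@phi_C2 R) e0.
exists s0 => // s L L' y sp Lp LL' sL yL.
have L'p : 0 < L' by exact: lt_le_trans LL'.
have := hs s L y sp Lp sL yL; rewrite ler_norml => /andP[h _].
apply: (@le_trans _ _ (gstep s (fun y => cut2 phi (y / L)) y)).
  move: h; rewrite -lerBlDr opprK.
  rewrite (_ : phi (y / L) + (s / L) ^+ 2 * (- (pi / 2) ^+ 2 * phi (y / L) / 2) =
    (1 - lam * (s / L) ^+ 2) * phi (y / L)); last first.
    by rewrite lambda_BmE; move: ((s / L) ^+ 2) (phi _) => u v; field.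
  by rewrite addrC.
apply: le_gstep.
- by apply: bdmeas_div; exact: (C2_cut2 (@phi_C2 R)).
- exact: bdmeas_phi_cball.
move=> z; rewrite cballE /cut2 indicE.
have phiL' : 0 <= phi (z / L') * (`|z| <= L')%R%:R.
  have [zL'|_] := leP `|z| L'; last by rewrite mulr0.
  by rewrite mulr1 phi_ge0// normrM normfV (gtr0_norm L'p) ler_pdivrMr// mul1r.
case: (boolP (_ \in _)); last by rewrite mulr0.
rewrite inE/= in_itv/= -ler_norml => z2; rewrite mulr1.
have [zL|zL] := leP `|z| L.
  rewrite (le_trans zL LL') mulr1 phi_le//.
  rewrite !normrM !normfV (gtr0_norm Lp) (gtr0_norm L'p) ler_wpM2l//.
  by rewrite lef_pV2.
rewrite (le_trans _ phiL')// phi_le0// z2 andbT.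
by rewrite normrM normfV (gtr0_norm Lp) ler_pdivlMr// mul1r ltW.
Qed.

(** With m_i the mass of [phi] on paths that stayed inside, each step gives m_{i+1} >= (1 - lambda
    u_i) m_i - e u_i, and the indicator dominates [phi]. The additive error is kept apart and
    disappears when e tends to 0 after the mesh. *)
Lemma chain_lower (e : R) : 0 < e -> exists2 s0 : R, 0 < s0 &
  forall (d : measure_display) (T : measurableType d) (Q : probability T R)
    (Y : nat -> T -> R) (s : R) (L : nat -> R),
  chain Q Y s -> 0 < s -> 0 < L 0%N -> (forall i, L i <= L i.+1) -> s / L 0%N <= s0 ->
  forall n,
  expR (- (lam * (1 + e) * \sum_(i < n) (s / L i) ^+ 2)) *
    \int[Q]_x (phi (Y 0%N x / L 0%N) * \1_(cball (L 0%N)) (Y 0%N x))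
    - e * \sum_(i < n) (s / L i) ^+ 2 <=
  \int[Q]_x (\prod_(j < n.+1) \1_(cball (L j)) (Y j x)).
Proof.
move=> e0; have [s1 s10 hs] := gstep_phi_ge e0.
have l0 := @lambda_Bm_gt0 R.
have den0 : 0 < (1 + e) * lam by rewrite mulr_gt0// addr_gt0.
(* The last two bounds ensure (1 + e) lambda u_i <= e, the smallness required by [expRN_le]. *)
exists (Num.min s1 (Num.min 1 (e / ((1 + e) * lam)))).
  by rewrite !lt_min s10 ltr01 divr_gt0.
move=> d T Q Y s L [mY cY] sp L0 Lmono; rewrite !le_min => /and3P[sL1 sL2 sL3].
have Lge i : L 0%N <= L i by elim: i => [|i IH] //; exact: le_trans IH (Lmono i).
have Lp i : 0 < L i by exact: lt_le_trans (Lge i).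
have sLi i : s / L i <= s / L 0%N by rewrite ler_pM2l// lef_pV2 ?posrE.
pose P i x := \prod_(j < i) \1_(cball (L j)) (Y j x) : R.
have P01 i x : 0 <= P i x <= 1.
  rewrite /P prodr_ge0/=; last by move=> j _; have /andP[] := cball01 (L j) (Y j x).
  by apply: prodr_ile1 => j _; exact: cball01.
have bP i : bdmeas (P i).
  apply: (@bdmeas_prod _ _ _ i (fun j x => \1_(cball (L j)) (Y j x))) => j _.
  exact: bdmeas_comp (bdmeas_cball (L j)) (mY j).
pose chi i (y : R) := phi (y / L i) * \1_(cball (L i)) y.
have bchi i : bdmeas (chi i) by exact: bdmeas_phi_cball.
have bchiY i : bdmeas (fun x => chi i (Y i x)) by exact: bdmeas_comp (bchi i) (mY i).
have chi1 i y : chi i y <= \1_(cball (L i)) y.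
  have /andP[c0 _] := cball01 (L i) y.
  by rewrite /chi -[leRHS]mul1r ler_wpM2r// (le_trans (ler_norm _))// phi_le1.
pose m i := \int[Q]_x (P i x * chi i (Y i x)).
pose u i := (s / L i) ^+ 2.
have u0 i : 0 <= u i by exact: sqr_ge0.
have ule i : (1 + e) * (lam * u i) <= e.
  have h1 : u i <= s / L i.
    by rewrite /u expr2 ler_piMl ?(le_trans (sLi i))// divr_ge0// ltW.
  rewrite mulrA mulrC -ler_pdivlMr//.
  by rewrite (le_trans h1)// (le_trans (sLi i)).
have step i : (1 - lam * u i) * m i - e * u i <= m i.+1.
  have -> : m i.+1 = \int[Q]_x (P i.+1 x * gstep s (chi i.+1) (Y i x)).
    apply: (cY i (fun j => \1_(cball (L j))) _ _ _ (bchi i.+1)).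
    - by move=> j; exact: bdmeas_cball.
    - by move=> j y; have /andP[] := cball01 (L j) y.
  have bPc : bdmeas (fun x => P i x * chi i (Y i x)) by exact: bdmeasM.
  rewrite -expectZ// -[X in _ - X](expect_cst Q) -expectB; last 2 first.
  - exact: bdmeasZ.
  - exact: bdmeas_cst.
  apply: le_expect.
  - by apply: bdmeasB; [exact: bdmeasZ|exact: bdmeas_cst].
  - by apply: bdmeasM => //; exact: bdmeas_comp (bdmeas_gstep s (bchi i.+1)) (mY i).
  move=> x; have -> : P i.+1 x = P i x * \1_(cball (L i)) (Y i x) by rewrite /P big_ord_recr.
  have /andP[p0 p1] := P01 i x.
  rewrite /chi cballE; have [yL|yL] := leP `|Y i x| (L i); last first.
    by rewrite !mulr0 mul0r sub0r oppr_le0 mulr_ge0// ltW.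
  rewrite !mulr1.
  have := hs s (L i) (L i.+1) (Y i x) sp (Lp i) (Lmono i) (le_trans (sLi i) sL1) yL.
  rewrite -/(u i); set g := gstep _ _ _; set ph := phi _ => h.
  have : P i x * ((1 - lam * u i) * ph - e * u i) <= P i x * g by rewrite ler_wpM2l.
  have : P i x * (e * u i) <= e * u i by rewrite ler_piMl// mulr_ge0// ltW.
  by rewrite mulrBr mulrCA; lra.
move=> n.
apply: (@le_trans _ _ (m n)); last first.
  apply: le_expect.
  - exact: bdmeasM.
  - exact: bP.
  move=> x; rewrite [leRHS]/(P n.+1 x) /P big_ord_recr/= ler_wpM2l//.
  by have /andP[] := P01 n x.
have m0 : 0 <= m 0%N.
  apply: Rintegral_ge0 => x _; rewrite /P big_ord0 mul1r /chi cballE.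
  have [yL|_] := leP `|Y 0%N x| (L 0%N); last by rewrite mulr0.
  by rewrite mulr1 phi_ge0// normrM normfV (gtr0_norm L0) ler_pdivrMr// mul1r.
have -> : \int[Q]_x (phi (Y 0%N x / L 0%N) * \1_(cball (L 0%N)) (Y 0%N x)) = m 0%N.
  by apply: eq_Rintegral => x _; rewrite /P big_ord0 mul1r.
elim: n => [|n IH].
  by rewrite !big_ord0 !mulr0 oppr0 expR0 mul1r addr0.
apply: le_trans (step n).
rewrite !big_ord_recr/= -/(u n); set S := \sum_(i < n) _ in IH *.
have S0 : 0 <= S by apply: sumr_ge0 => i _; exact: sqr_ge0.
have f1 : expR (- ((1 + e) * (lam * u n))) <= 1 - lam * u n.
  by apply: expRN_le => //; rewrite mulr_ge0// ltW.
have f0 : 0 <= 1 - lam * u n by rewrite (le_trans _ f1)// expR_ge0.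
have f2 : 1 - lam * u n <= 1 by rewrite gerBl mulr_ge0// ltW.
have := ler_wpM2l f0 IH.
set A := expR _ * _.
have -> : expR (- (lam * (1 + e) * (S + u n))) * m 0%N =
    expR (- ((1 + e) * (lam * u n))) * A.
  rewrite /A mulrA -expRD; congr (expR _ * _); ring.
have A0 : 0 <= A by rewrite /A mulr_ge0// expR_ge0.
have : expR (- ((1 + e) * (lam * u n))) * A <= (1 - lam * u n) * A by rewrite ler_wpM2r.
have : (1 - lam * u n) * (e * S) <= e * S by rewrite ler_piMl// mulr_ge0// ltW.
rewrite mulrBr mulrDr; lra.
Qed.

End chain_estimates.

Lemma C2_lipschitz {R : realType} (h h1 h2 : R -> R) : C2_near h h1 h2 ->
  exists2 M, 0 <= M & forall a b, `|a| <= 2 -> `|b| <= 2 -> `|h a - h b| <= M * `|a - b|.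
Proof.
move=> hC.
have sub (x : R) : x \in `[-2, 2] -> x \in `]-3, 3[.
  by rewrite !in_itv/= => /andP[? ?]; lra.
have [|M M0 hM] := @itv_bounded R h1 (-2) 2.
  by move=> x /sub/hC [_ h' _]; exact: is_derive_continuous h'.
exists M => // a b a2 b2.
have sub2 (x : R) : x \in `[Num.min b a, Num.max b a] -> x \in `[-2, 2].
  move: a2 b2; rewrite !ler_norml !in_itv/= ge_min le_max.
  by move=> /andP[? ?] /andP[? ?] /andP[/orP[] ? /orP[] ?]; lra.
have d (x : R) : x \in `[Num.min b a, Num.max b a] -> is_derive x (1 : R) h (h1 x).
  by move=> /sub2/sub/hC [].
have [x xab ->] := mean_value d.
by rewrite normrM ler_wpM2r// hM// sub2.
Qed.

Lemma bernoulli_le {R : realType} (x : R) n : 0 <= x -> 1 + n%:R * x <= (1 + x) ^+ n.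
Proof.
move=> x0; elim: n => [|n IH]; first by rewrite mul0r addr0 expr0.
have h : (1 + x) * (1 + n%:R * x) <= (1 + x) ^+ n.+1.
  by rewrite exprS ler_wpM2l// addr_ge0.
apply: le_trans h; rewrite -natr1.
have : 0 <= n%:R * x * x by rewrite !mulr_ge0.
by rewrite !mulrDl !mulrDr !mulr1 !mul1r; lra.
Qed.

(** * Upper bound for exponential moments of the surviving walk *)

Section chain_upper.
Context {R : realType}.
Local Notation lam := (@lambda_Bm R).
Variables (f psi psi1 : R -> R) (be B A ep theta om : R).
Hypothesis bf : bdmeas f.
Hypothesis hpsi : C2_near psi psi1
  (fun x => 2 * ((be - f x) * phi x) - (pi / 2) ^+ 2 * psi x).
Hypothesis A0 : 0 <= A.
Hypothesis hA : forall x, `|x| <= 1 -> `|psi x| <= A * phi x.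
Hypothesis hB : forall x, `|x| <= 1 -> `|be - f x| <= B.
Hypothesis hom : forall x, `|x| <= 1 -> `|f x - f (x / (1 + ep))| <= om.
Hypothesis ep0 : 0 < ep.
Hypothesis ep1 : ep < 1.
Hypothesis thA : `|theta| * A <= 2^-1.

(** First-order perturbation of the ground state when the potential th f is added. *)
Definition tilted (th x : R) : R := cut2 phi x + th * cut2 psi x.

(** Error on the perturbed eigenvalue: the second order in theta, the slack spent on discretisation,
    and the oscillation of f caused by evaluating it at radius g instead of (1 + ep) g. *)
Definition tilt_err : R := 2 * A * B * theta ^+ 2 + ep + `|theta| * om.

Let rho : R := (1 + ep)^-1.
Let c : R := phi rho.

Let ep1p : 0 < 1 + ep. Proof. by rewrite addr_gt0. Qed.

Let c0 : 0 < c.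
Proof.
by apply: phi_gt0; rewrite gtr0_norm ?invr_gt0// invf_lt1// ltrDl.
Qed.

Let bphi : bdmeas (cut2 (@phi R)). Proof. exact: C2_cut2 (@phi_C2 R). Qed.
Let bpsi : bdmeas (cut2 psi). Proof. exact: C2_cut2 hpsi. Qed.

Lemma bdmeas_tilted th : bdmeas (tilted th).
Proof. by apply: bdmeasD => //; exact: bdmeasZ. Qed.

Lemma cut2E (h : R -> R) x : `|x| <= 2 -> cut2 h x = h x.
Proof.
by move=> x2; rewrite /cut2 indicE mem_set ?mulr1//= in_itv/= -ler_norml.
Qed.

Lemma tiltedE th x : `|x| <= 1 -> tilted th x = phi x + th * psi x.
Proof. by move=> x1; rewrite /tilted !cut2E// (le_trans x1)// ler1n. Qed.

Let thpsi th x : `|th| <= `|theta| -> `|x| <= 1 -> `|th * psi x| <= phi x / 2.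
Proof.
move=> th1 x1; rewrite normrM.
rewrite (@le_trans _ _ (`|theta| * (A * phi x)))//; first by rewrite ler_pM// hA.
by rewrite mulrA (mulrC (phi x)) ler_wpM2r// phi_ge0.
Qed.

Lemma tilted_lb th x : `|th| <= `|theta| -> `|x| <= 1 -> phi x / 2 <= tilted th x.
Proof.
move=> th1 x1; rewrite tiltedE//.
by have := thpsi th1 x1; rewrite ler_norml => /andP[h _]; lra.
Qed.

Lemma tilted_ub th x : `|th| <= `|theta| -> `|x| <= 1 -> tilted th x <= 2.
Proof.
move=> th1 x1; rewrite tiltedE//.
have := thpsi th1 x1; rewrite ler_norml => /andP[_ h].
by have := phi_le1 x; rewrite ler_norml => /andP[_ h2]; lra.
Qed.

Lemma tilted_ge0 th x : `|th| <= `|theta| -> `|x| <= 1 -> 0 <= tilted th x.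
Proof.
by move=> th1 x1; rewrite (le_trans _ (tilted_lb th1 x1))// divr_ge0// phi_ge0.
Qed.

(** Half the Laplacian sends the tilted function T to - lambda T + th (be - f) phi, and th (be - f)
    phi = th (be - f) T - th^2 (be - f) psi, whose last term is at most 2 A B th^2 T. Placing T on
    the ball of radius (1 + ep) g keeps it bounded below on the ball of radius g, so additive errors
    become relative ones. *)
Lemma tilted_step : exists2 s0 : R, 0 < s0 & forall s g g' th y,
  0 < s -> 0 < g -> g' <= (1 + ep / 2) * g -> `|th| <= `|theta| ->
  s / ((1 + ep) * g) <= s0 -> `|y| <= g ->
  gstep s (fun z => tilted th (z / ((1 + ep) * g)) * \1_(cball g') z) y <=
  tilted th (y / ((1 + ep) * g)) *
    expR ((s / ((1 + ep) * g)) ^+ 2 * (- lam + th * be - th * f (y / g) + tilt_err)).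
Proof.
(* Chosen so that the three additive errors sum to (c / 2) ep u, at most ep u times the tilted
   function, which is at least c / 2 on the inner ball. *)
pose e1 := ep * c / (2 * (2 + `|theta|)).
have d0 : 0 < 2 * (2 + `|theta|) by rewrite mulr_gt0// ltr_wpDr.
have e10 : 0 < e1 by rewrite divr_gt0// mulr_gt0.
have [s1 s10 h1] := gstep_C2 (@phi_C2 R) e10.
have [s2 s20 h2] := gstep_C2 hpsi e10.
have [_ [Mp hMp]] := bpsi.
have Mp0 : 0 <= Mp by rewrite (le_trans _ (hMp 0)).
(* [Cw] bounds the tilted function everywhere; [kk] below collects the cost of jumping from radius g
   beyond (1 + ep) g, a term of order u^2. *)
pose Cw := 1 + `|theta| * Mp.
have Cw0 : 0 < Cw by rewrite ltr_wpDr// mulr_ge0.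
pose kk := 3 * Cw * ((1 + ep) / ep) ^+ 4.
have kk0 : 0 < kk by rewrite /kk mulr_gt0 ?(mulr_gt0 _ Cw0)// exprn_gt0// divr_gt0.
exists (Num.min (Num.min s1 s2) (Num.min 1 (e1 / kk))).
  by rewrite !lt_min s10 s20 ltr01 divr_gt0.
move=> s g g' th y sp gp g'g th1; rewrite !le_min => /andP[/andP[sl1 sl2] /andP[sl3 sl4]] yg.
set L := (1 + ep) * g in sl1 sl2 sl3 sl4 *.
have Lp : 0 < L by rewrite mulr_gt0.
have gL : g <= L by rewrite /L ler_peMl ?(ltW gp)// lerDl ltW.
have g'L : g' < L.
  by rewrite (le_lt_trans g'g)// /L ltr_pM2r// ltrD2l ltr_pdivrMr// ltr_pMr// ltr1n.
have yL : `|y| <= L by exact: le_trans gL.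
set x := y / L.
have xE : x = y / g / (1 + ep) by rewrite /x /L; field; rewrite !gt_eqF.
have xrho : `|x| <= rho.
  rewrite xE normrM normfV (gtr0_norm ep1p) ler_piMl ?invr_ge0 ?(ltW ep1p)//.
  by rewrite normrM normfV (gtr0_norm gp) ler_pdivrMr// mul1r.
have rho1 : rho <= 1 by rewrite invf_le1// lerDl ltW.
have x1 : `|x| <= 1 by exact: le_trans rho1.
have cx : c <= phi x.
  apply: phi_le; rewrite (@gtr0_norm _ rho) ?invr_gt0//.
  by rewrite (le_trans rho1)// ler1n.
set u := (s / L) ^+ 2.
have u0 : 0 <= u by exact: sqr_ge0.
have bL (h : R -> R) : bdmeas h -> bdmeas (fun z : R => h (z / L)) by exact: bdmeas_div.
have mfar : measurable [set z : R | L <= `|z|].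
  rewrite (_ : [set z : R | L <= `|z|] = (@Num.norm R R) @^-1` `[L, +oo[).
    by rewrite -[X in measurable X]setTI; exact: normr_measurable.
  by apply/seteqP; split => z /=; rewrite in_itv/= andbT.
have bfar : bdmeas (\1_[set z : R | L <= `|z|] : R -> R) by exact: bdmeas_indic.
have b1 : bdmeas (fun z : R => cut2 phi (z / L)) by exact: bL.
have b2 : bdmeas (fun z : R => th * cut2 psi (z / L)) by apply: bdmeasZ; exact: bL.
have b12 : bdmeas (fun z : R => cut2 phi (z / L) + th * cut2 psi (z / L)) by exact: bdmeasD.
have b3 : bdmeas (fun z : R => Cw * (\1_[set z : R | L <= `|z|] : R -> R) z) by exact: bdmeasZ.
(* The killing is dropped where the tilted function is nonnegative; elsewhere the jump is a far one
   and is paid for by [Cw]. *)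
apply: (@le_trans _ _ (gstep s (fun z => (cut2 phi (z / L) + th * cut2 psi (z / L))
    + Cw * (\1_[set z : R | L <= `|z|] : R -> R) z) y)).
  apply: le_gstep.
  - by apply: bdmeasM; [apply: (bL); exact: bdmeas_tilted|exact: bdmeas_cball].
  - exact: bdmeasD.
  move=> z; rewrite -/(tilted th (z / L)) cballE indicE.
  have [zL|zL] := ltP `|z| L.
    rewrite memNset ?mulr0 ?addr0; last by rewrite /= leNgt zL.
    have z1 : `|z / L| <= 1 by rewrite normrM normfV (gtr0_norm Lp) ler_pdivrMr// mul1r ltW.
    by rewrite ler_piMr ?tilted_ge0//; case: (`|z| <= g')%R.
  rewrite mem_set// mulr1 (lt_geF (lt_le_trans g'L zL)) mulr0.
  have hz : `|tilted th (z / L)| <= Cw.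
    rewrite /tilted (le_trans (ler_normD _ _))// lerD//.
      rewrite /cut2 normrM indicE; case: (_ \in _); rewrite ?normr1 ?mulr1 ?normr0 ?mulr0//.
      exact: phi_le1.
    by rewrite normrM ler_pM.
  by move: hz; rewrite ler_norml => /andP[hz _]; lra.
rewrite gstepD// gstepD// gstepZ; last exact: bL.
rewrite gstepZ; last exact: bfar.
have t1 := h1 s L y sp Lp sl1 yL.
have t2 := h2 s L y sp Lp sl2 yL.
have t3 : gstep s (\1_[set z : R | L <= `|z|]) y <= 3 * s ^+ 4 / (ep * g) ^+ 4.
  apply: gstep_tail => //; first by rewrite mulr_gt0.
  rewrite /L; have -> : (1 + ep) * g = g + ep * g by ring.
  by rewrite lerD2r.
have t3' : Cw * gstep s (\1_[set z : R | L <= `|z|]) y <= e1 * u.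
  apply: (le_trans (ler_wpM2l (ltW Cw0) t3)).
  have -> : Cw * (3 * s ^+ 4 / (ep * g) ^+ 4) = (kk * u) * u.
    by rewrite /kk /u /L; field; rewrite !gt_eqF.
  rewrite ler_wpM2r// mulrC -ler_pdivlMr// (le_trans _ sl4)//.
  by rewrite /u expr2 ler_piMr// divr_ge0// ltW.
move: t1 t2; rewrite -/x -/u.
set G1 := gstep _ _ _; set G2 := gstep _ _ _; set P := phi x; set S := psi x.
set fx := f x.
move=> t1 t2.
have t2' : th * G2 <= th * (S + u * ((2 * ((be - fx) * P) - (pi / 2) ^+ 2 * S) / 2)) + `|theta| * (e1 * u).
  rewrite -lerBlDl -mulrBr (le_trans (ler_norm _))// normrM.
  by rewrite ler_pM.
have t1' : G1 <= P + u * (- (pi / 2) ^+ 2 * P / 2) + e1 * u.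
  by rewrite -lerBlDl (le_trans (ler_norm _)).
set Wx := tilted th x.
have WxE : Wx = P + th * S by exact: tiltedE.
have PW : P / 2 <= Wx by exact: tilted_lb.
have P0 : 0 <= P by exact: phi_ge0.
have Wx0 : 0 <= Wx by lra.
have sum1 : G1 + th * G2 + Cw * gstep s (\1_[set z : R | L <= `|z|]) y <=
   Wx * (1 - lam * u) + th * (be - fx) * P * u + (2 + `|theta|) * e1 * u.
  apply: (le_trans (lerD (lerD t1' t2') t3')).
  rewrite WxE lambda_BmE le_eqVlt; apply/orP; left; apply/eqP.
  by move: (P) (S) (fx) (`|theta|) => p q r t; field.
have err : (2 + `|theta|) * e1 * u <= Wx * (ep * u).
  have -> : (2 + `|theta|) * e1 = c / 2 * ep.
    by rewrite /e1; field; rewrite gt_eqF// ltr_wpDr.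
  have epu : 0 <= ep * u := mulr_ge0 (ltW ep0) u0.
  rewrite -(mulrA (c / 2)) ler_wpM2r//.
  by rewrite (le_trans _ PW)// ler_pM2r.
have fom : - (th * fx) <= - (th * f (y / g)) + `|theta| * om.
  rewrite -lerBlDl opprK addrC -mulrBr (le_trans (ler_norm _))// normrM ler_pM//.
  rewrite /fx xE; apply: hom.
  by rewrite normrM normfV (gtr0_norm gp) ler_pdivrMr// mul1r.
have lin : th * (be - fx) * P <= Wx * (th * be - th * f (y / g) + 2 * A * B * theta ^+ 2 + `|theta| * om).
  have -> : th * (be - fx) * P = Wx * (th * be - th * fx) - th ^+ 2 * ((be - fx) * S).
    by rewrite WxE; ring.
  have q1 : - (th ^+ 2 * ((be - fx) * S)) <= Wx * (2 * A * B * theta ^+ 2).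
    rewrite (le_trans (ler_norm _))// normrN (normrM (th ^+ 2)) normrX (normrM (be - fx)).
    have th2 : `|th| ^+ 2 <= theta ^+ 2.
      by rewrite -(real_normK (num_real theta)) lerXn2r ?nnegrE.
    have bs : `|be - fx| * `|S| <= B * (A * (2 * Wx)).
      have PS : P <= 2 * Wx by lra.
      apply: ler_pM => //; first exact: hB.
      by apply: (le_trans (hA x1)); exact: ler_wpM2l.
    have b0 : 0 <= B * (A * (2 * Wx)) by rewrite (le_trans _ bs)// mulr_ge0.
    rewrite (le_trans (ler_pM _ _ th2 bs)) ?mulr_ge0 ?sqr_ge0//.
    rewrite le_eqVlt; apply/orP; left; apply/eqP; ring.
  have q2 : Wx * (th * be - th * fx) <= Wx * (th * be - th * f (y / g) + `|theta| * om).
    by rewrite ler_wpM2l//; lra.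
  by rewrite !mulrDr in q2 *; lra.
apply: (le_trans sum1).
apply: (@le_trans _ _ (Wx * (1 + u * (- lam + th * be - th * f (y / g) + tilt_err)))); last first.
  by rewrite ler_wpM2l// expR_ge1Dx.
have linu := ler_wpM2r u0 lin.
rewrite /tilt_err.
rewrite [leRHS](_ : _ = Wx * (1 - lam * u) +
  Wx * (th * be - th * f (y / g) + 2 * A * B * theta ^+ 2 + `|theta| * om) * u +
  Wx * (ep * u)); last by ring.
by rewrite lerD// lerD2l.
Qed.

(** The tilted function is Lipschitz in position and in tilt, and bounded below on the balls
    concerned, so a relative change of radius by x changes it by a factor at most 1 + C x <= (1 +
    x)^C. Such powers telescope along the walk and cost only a power of the final radius. *)
Lemma tilted_ratio : exists C : nat, forall g g' th th' z,
  0 < g -> g <= g' -> g' <= (1 + ep / 2) * g ->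
  `|th| <= `|theta| -> `|th'| <= `|theta| -> `|th' - th| <= 2 * `|theta| * (g' / g - 1) ->
  `|z| <= g' ->
  tilted th' (z / ((1 + ep) * g')) <= (g' / g) ^+ C * tilted th (z / ((1 + ep) * g)).
Proof.
pose rho2 := (1 + ep / 2) / (1 + ep).
have rho20 : 0 < rho2 by rewrite divr_gt0// addr_gt0// divr_gt0.
have rho21 : rho2 < 1.
  by rewrite ltr_pdivrMr// mul1r ltrD2l ltr_pdivrMr// ltr_pMr// ltr1n.
pose c2 := phi rho2 / 2.
have c20 : 0 < c2 by rewrite divr_gt0// phi_gt0// gtr0_norm.
have [M M0 hM] := C2_lipschitz (@phi_C2 R).
have [M' M'0 hM'] := C2_lipschitz hpsi.
pose C1 := M + `|theta| * M' + 2 * `|theta| * A.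
have C10 : 0 <= C1 by rewrite !addr_ge0// ?mulr_ge0.
exists (Num.bound (C1 / c2)) => g g' th th' z gp gg' g'g th1 th'1 dth zg'.
have g'p : 0 < g' by exact: lt_le_trans gg'.
set a := z / _; set b := z / _.
have zE (L : R) : 0 < L -> `|z / ((1 + ep) * L)| = `|z| / L / (1 + ep).
  move=> Lp; rewrite normrM normfV (@gtr0_norm _ ((1 + ep) * L)) ?mulr_gt0//.
  by field; rewrite !gt_eqF.
have a1 : `|a| <= 1.
  rewrite /a zE// ler_pdivrMr// mul1r (@le_trans _ _ 1)//.
    by rewrite ler_pdivrMr// mul1r.
  by rewrite lerDl ltW.
have b2 : `|b| <= rho2.
  rewrite /b zE// ler_pM2r ?invr_gt0// ler_pdivrMr//.
  exact: le_trans g'g.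
have b1 : `|b| <= 1 by rewrite (le_trans b2)// ltW.
have le2 (t : R) : `|t| <= 1 -> `|t| <= 2 by move=> t1; rewrite (le_trans t1)// ler1n.
have cb : c2 <= tilted th b.
  rewrite (le_trans _ (tilted_lb th1 b1))// ler_pM2r// phi_le// ?(gtr0_norm rho20)//.
  by rewrite (le_trans (ltW rho21))// ler1n.
set x := g' / g - 1 in dth.
have x0 : 0 <= x by rewrite subr_ge0 ler_pdivlMr// mul1r.
have gg'x : 1 - g / g' <= x.
  rewrite /x -subr_ge0.
  have -> : g' / g - 1 - (1 - g / g') = (g' - g) ^+ 2 / (g * g').
    by field; rewrite !gt_eqF.
  by rewrite divr_ge0 ?sqr_ge0// ltW// mulr_gt0.
have ab : `|a - b| <= x.
  have -> : a - b = b * - (1 - g / g') by rewrite /a /b; field; rewrite !gt_eqF.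
  rewrite normrM normrN (@ger0_norm _ (1 - _)); last first.
    by rewrite subr_ge0 ler_pdivrMr// mul1r.
  rewrite -[leRHS]mul1r ler_pM// subr_ge0 ler_pdivrMr// mul1r//.
have d1 : phi a - phi b <= M * x.
  rewrite (le_trans (ler_norm _))// (le_trans (hM a b (le2 _ a1) (le2 _ b1)))//.
  exact: ler_wpM2l.
have d2 : th' * (psi a - psi b) <= `|theta| * (M' * x).
  rewrite (le_trans (ler_norm _))// normrM ler_pM//.
  rewrite (le_trans (hM' a b (le2 _ a1) (le2 _ b1)))//.
  exact: ler_wpM2l.
have d3 : (th' - th) * psi b <= (2 * `|theta| * x) * A.
  rewrite (le_trans (ler_norm _))// normrM ler_pM//.
  rewrite (le_trans (hA b1))// ler_piMr//.
  by rewrite (le_trans (ler_norm _))// phi_le1.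
have key : tilted th' a <= tilted th b + C1 * x.
  rewrite !tiltedE//.
  have -> : phi a + th' * psi a = (phi b + th * psi b) + ((phi a - phi b) +
    th' * (psi a - psi b) + (th' - th) * psi b) by ring.
  rewrite lerD2l (le_trans (lerD (lerD d1 d2) d3))// /C1.
  by rewrite le_eqVlt; apply/orP; left; apply/eqP; ring.
have tb0 : 0 < tilted th b by exact: lt_le_trans cb.
apply: (le_trans key).
have C1b : C1 <= (Num.bound (C1 / c2))%:R * tilted th b.
  apply: (@le_trans _ _ ((Num.bound (C1 / c2))%:R * c2)); last by rewrite ler_wpM2l.
  by rewrite -ler_pdivrMr//; apply/ltW/archi_boundP; rewrite divr_ge0// ltW.
have -> : g' / g = 1 + x by rewrite /x addrC subrK.
rewrite (@le_trans _ _ ((1 + (Num.bound (C1 / c2))%:R * x) * tilted th b))//.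
  rewrite [leRHS](_ : _ = tilted th b + (Num.bound (C1 / c2))%:R * tilted th b * x); last by ring.
  by rewrite lerD2l ler_wpM2r.
by rewrite ler_wpM2r ?(ltW tb0)// bernoulli_le.
Qed.

(** [tilted_step] and [tilted_ratio] make the weighted mass of the tilted function grow by a
    controlled factor at each step. The tilt theta (g_i / gt)^2 makes the product v_i th_i
    independent of i: f is weighted uniformly in real time although the intrinsic clock slows
    down. *)
Lemma chain_upper : exists s0 : R, exists C : nat, exists2 D : R, 0 < s0 /\ 0 <= D &
  forall (d : measure_display) (T : measurableType d) (Q : probability T R)
    (Y : nat -> T -> R) (s gt : R) (g : nat -> R) (N : nat),
  chain Q Y s -> 0 < s -> 0 < g 0%N -> (forall i, g i <= g i.+1) ->
  (forall i, g i.+1 <= (1 + ep / 2) * g i) -> s / ((1 + ep) * g 0%N) <= s0 ->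
  g N <= gt ->
  let th i := theta * (g i / gt) ^+ 2 in
  let v i := (s / ((1 + ep) * g i)) ^+ 2 in
  \int[Q]_x ((\prod_(j < N.+1) \1_(cball (g j)) (Y j x)) *
     expR (\sum_(j < N) v j * th j * f (Y j x / g j))) <=
  D * (g N / g 0%N) ^+ C * expR (\sum_(j < N) v j * (- lam + th j * be + tilt_err)).
Proof.
have [s0 s00 hs] := tilted_step.
have [C hC] := tilted_ratio.
(* The factor 2 bounds the tilted function at the start; 2 / c undoes its lower bound c / 2 at the
   end. *)
exists s0, C, (2 * (2 / c)).
  by split => //; rewrite mulr_ge0// divr_ge0// ltW.
move=> d T Q Y s gt g N [mY cY] sp g0 gmono gup sg gN /=.
set th := fun i : nat => theta * (g i / gt) ^+ 2.
set v := fun i : nat => (s / ((1 + ep) * g i)) ^+ 2.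
have gge i j : (i <= j)%N -> g i <= g j.
  by move=> ij; rewrite -(subnKC ij); elim: (j - i)%N => [|k IH]; rewrite ?addn0// addnS (le_trans IH).
have gp i : 0 < g i by rewrite (lt_le_trans g0)// gge.
have gtp : 0 < gt by rewrite (lt_le_trans (gp N)).
have thle i : (i <= N)%N -> `|th i| <= `|theta|.
  move=> iN; rewrite /th normrM ler_piMr// normrX exprn_ile1//.
  rewrite ger0_norm ?divr_ge0 ?(ltW (gp i)) ?(ltW gtp)//.
  by rewrite ler_pdivrMr// mul1r (le_trans (gge _ _ iN)).
have dth i : (i < N)%N -> `|th i.+1 - th i| <= 2 * `|theta| * (g i.+1 / g i - 1).
  move=> iN; rewrite /th -mulrBr normrM (mulrC 2) -mulrA ler_wpM2l//.
  have q0 : 0 <= g i / gt by rewrite divr_ge0// ltW.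
  have q1 : g i / gt <= g i.+1 / gt by rewrite ler_pM2r ?invr_gt0.
  have q2 : g i.+1 / gt <= 1 by rewrite ler_pdivrMr// mul1r (le_trans (gge _ _ iN)).
  have gn0 : g i != 0 by rewrite gt_eqF.
  have gtn0 : gt != 0 by rewrite gt_eqF.
  rewrite ger0_norm; last by rewrite subr_ge0 lerXn2r ?nnegrE// (le_trans q0).
  have q3 : g i.+1 / gt - g i / gt <= g i.+1 / g i - 1.
    have -> : g i.+1 / gt - g i / gt = (g i / gt) * (g i.+1 / g i - 1) by field; rewrite gn0 gtn0.
    rewrite ler_piMl// ?(le_trans q1)//.
    by rewrite subr_ge0 ler_pdivlMr// mul1r.
  rewrite subr_sqr mulrC ler_pM ?subr_ge0 ?addr_ge0//.
  - exact: le_trans q1.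
  - by lra.
pose F j (y : R) := \1_(cball (g j)) y * expR (v j * th j * f (y / g j)).
have bF j : bdmeas (F j).
  apply: bdmeasM; first exact: bdmeas_cball.
  by apply: bdmeas_expR; apply: bdmeasZ; exact: bdmeas_div.
have F0 j y : 0 <= F j y.
  by rewrite mulr_ge0 ?expR_ge0//; have /andP[] := cball01 (g j) y.
pose V i (y : R) := tilted (th i) (y / ((1 + ep) * g i)) * \1_(cball (g i)) y.
have bV i : bdmeas (V i).
  by apply: bdmeasM; [apply: bdmeas_div; exact: bdmeas_tilted|exact: bdmeas_cball].
have bVY i : bdmeas (fun x => V i (Y i x)) by exact: bdmeas_comp (bV i) (mY i).
have x1 i y : `|y| <= g i -> `|y / ((1 + ep) * g i)| <= rho.
  move=> yg; rewrite normrM normfV (@gtr0_norm _ ((1 + ep) * g i)) ?mulr_gt0//.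
  by rewrite ler_pdivrMr ?mulr_gt0// /rho mulrA mulVf ?gt_eqF// mul1r.
have rho1 : rho <= 1 by rewrite invf_le1// lerDl ltW.
pose PF i x := \prod_(j < i) F j (Y j x).
have bPF i : bdmeas (PF i).
  apply: (@bdmeas_prod _ _ _ i (fun j x => F j (Y j x))) => j _.
  exact: bdmeas_comp (bF j) (mY j).
have PF0 i x : 0 <= PF i x by apply: prodr_ge0.
pose U i := \int[Q]_x (PF i x * V i (Y i x)).
have step i : (i < N)%N ->
    U i.+1 <= (g i.+1 / g i) ^+ C * expR (v i * (- lam + th i * be + tilt_err)) * U i.
  move=> iN; have iN' := ltnW iN.
  have -> : U i.+1 = \int[Q]_x (PF i.+1 x * gstep s (V i.+1) (Y i x)).
    exact: (cY i F _ bF F0 (bV i.+1)).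
  rewrite -expectZ; last exact: bdmeasM.
  apply: le_expect.
  - by apply: bdmeasM => //; exact: bdmeas_comp (bdmeas_gstep s (bV i.+1)) (mY i).
  - by apply: bdmeasZ; exact: bdmeasM.
  move=> x; have -> : PF i.+1 x = PF i x * F i (Y i x) by rewrite /PF big_ord_recr.
  rewrite /F /V cballE; have [yg|yg] := leP `|Y i x| (g i); last by rewrite mul0r !mulr0 mul0r.
  rewrite mul1r mulr1.
  set y := Y i x in yg *; set r := (g i.+1 / g i) ^+ C.
  have r0 : 0 <= r by rewrite exprn_ge0// divr_ge0// ltW.
  have bW : bdmeas (fun z : R => tilted (th i) (z / ((1 + ep) * g i)) * \1_(cball (g i.+1)) z).
    by apply: bdmeasM; [apply: bdmeas_div; exact: bdmeas_tilted|exact: bdmeas_cball].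
  have h1 : gstep s (fun z => tilted (th i.+1) (z / ((1 + ep) * g i.+1)) * \1_(cball (g i.+1)) z) y
     <= r * gstep s (fun z => tilted (th i) (z / ((1 + ep) * g i)) * \1_(cball (g i.+1)) z) y.
    rewrite -gstepZ//; apply: le_gstep; [exact: (bV i.+1)|exact: bdmeasZ|].
    move=> z; rewrite mulrA cballE; have [zg|zg] := leP `|z| (g i.+1); last by rewrite !mulr0.
    by rewrite !mulr1; apply: hC => //; [exact: thle|exact: thle|exact: dth].
  have sgi : s / ((1 + ep) * g i) <= s0.
    rewrite (le_trans _ sg)// ler_pM2l// lef_pV2 ?posrE ?mulr_gt0// ler_pM2l//.
    exact: gge.
  have h2 := hs s (g i) (g i.+1) (th i) y sp (gp i) (gup i) (thle _ iN') sgi yg.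
  set a := v i * th i * f (y / g i).
  rewrite -/(v i) in h2.
  have E : expR (v i * (- lam + th i * be - th i * f (y / g i) + tilt_err)) =
      expR (- a) * expR (v i * (- lam + th i * be + tilt_err)).
    by rewrite -expRD /a; congr expR; ring.
  rewrite E in h2.
  set Wx := tilted _ _ in h2 *; set K := expR (v i * _) in h2 *.
  have h3 : PF i x * expR a * gstep s (fun z => tilted (th i.+1) (z / ((1 + ep) * g i.+1)) * \1_(cball (g i.+1)) z) y
     <= PF i x * expR a * (r * (Wx * (expR (- a) * K))).
    apply: ler_wpM2l; first by rewrite mulr_ge0 ?expR_ge0.
    by rewrite (le_trans h1)// ler_wpM2l.
  apply: (le_trans h3); rewrite le_eqVlt; apply/orP; left; apply/eqP.
  have aa : expR a * expR (- a) = 1 by rewrite -expRD subrr expR0.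
  have gen (q1 q2 q3 q4 q5 q6 : R) : q2 * q3 = 1 ->
      q1 * q2 * (q6 * (q5 * (q3 * q4))) = q6 * q4 * (q1 * q5).
    move=> q23; transitivity (q1 * q4 * q5 * q6 * (q2 * q3)); first by ring.
    by rewrite q23; ring.
  exact: gen.
have Ub i : (i <= N)%N -> U i <= 2 * (g i / g 0%N) ^+ C *
    expR (\sum_(j < i) v j * (- lam + th j * be + tilt_err)).
  elim: i => [|i IH] iN.
    rewrite big_ord0 expR0 mulr1 divff ?gt_eqF// expr1n mulr1.
    rewrite -[leRHS](expect_cst Q); apply: le_expect.
    - exact: bdmeasM.
    - exact: bdmeas_cst.
    move=> x; rewrite /PF big_ord0 mul1r /V cballE.
    have [yg|yg] := leP `|Y 0%N x| (g 0%N); last by rewrite mulr0.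
    by rewrite mulr1 tilted_ub ?thle// (le_trans (x1 _ _ yg)).
  apply: (le_trans (step i iN)).
  rewrite big_ord_recr/= expRD.
  have := IH (ltnW iN); set S := expR (\sum_(j < i) _); set K := expR (v i * _) => h.
  have r0 : 0 <= (g i.+1 / g i) ^+ C * K.
    by rewrite mulr_ge0 ?expR_ge0// exprn_ge0// divr_ge0// ltW.
  apply: (le_trans (ler_wpM2l r0 h)).
  rewrite le_eqVlt; apply/orP; left; apply/eqP.
  have -> : (g i.+1 / g 0%N) ^+ C = (g i.+1 / g i) ^+ C * (g i / g 0%N) ^+ C.
    by rewrite -exprMn; congr (_ ^+ _); field; rewrite !gt_eqF.
  ring.
rewrite [leRHS](_ : _ = (2 / c) * (2 * (g N / g 0%N) ^+ C *
  expR (\sum_(j < N) v j * (- lam + th j * be + tilt_err)))); last by ring.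
apply: (@le_trans _ _ (2 / c * U N)); last first.
  by rewrite ler_wpM2l ?Ub// divr_ge0// ltW.
rewrite -expectZ; last exact: bdmeasM.
apply: le_expect.
- apply: bdmeasM.
    apply: (@bdmeas_prod _ _ _ N.+1 (fun j x => \1_(cball (g j)) (Y j x))) => j _.
    exact: bdmeas_comp (bdmeas_cball (g j)) (mY j).
  apply: bdmeas_expR.
  apply: (@bdmeas_sum _ _ _ N (fun j x => v j * th j * f (Y j x / g j))) => j _.
  by apply: bdmeasZ; exact: bdmeas_comp (bdmeas_div (g j) bf) (mY j).
- by apply: bdmeasZ; exact: bdmeasM.
move=> x; rewrite big_ord_recr/= expR_sum.
have -> : PF N x = \prod_(j < N) \1_(cball (g j)) (Y j x) *
    \prod_(i < N) expR (v i * th i * f (Y i x / g i)).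
  by rewrite /PF -big_split.
rewrite /V cballE; have [yg|yg] := leP `|Y N x| (g N); last first.
  by rewrite !(mulr0, mul0r).
rewrite !mulr1; set p1 := \prod_(j < N) _; set p2 := \prod_(j < N) _.
have p10 : 0 <= p1 by apply: prodr_ge0 => j _; have /andP[] := cball01 (g j) (Y j x).
have p20 : 0 <= p2 by apply: prodr_ge0 => j _; exact: expR_ge0.
set Wx := tilted _ _.
have cW : 1 <= 2 / c * Wx.
  have xr := x1 _ _ yg; have h := tilted_lb (thle N (leqnn N)) (le_trans xr rho1).
  have h' : c / 2 <= Wx.
    rewrite (le_trans _ h)// ler_pM2r//; apply: phi_le; rewrite (@gtr0_norm _ rho) ?invr_gt0//.
    by rewrite (le_trans rho1)// ler1n.
  have d0 : 0 <= 2 / c by rewrite divr_ge0// ltW.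
  rewrite (le_trans _ (ler_wpM2l d0 h'))// le_eqVlt; apply/orP; left; apply/eqP.
  by field; rewrite gt_eqF.
rewrite [leRHS](_ : _ = (p1 * p2) * (2 / c * Wx)); last by ring.
by rewrite ler_peMr// mulr_ge0.
Qed.

End chain_upper.

(** * Dynkin's formula on a grid, in a fixed ball *)

Section dynkin.
Context {R : realType}.
Local Notation lam := (@lambda_Bm R).
Variables (f psi psi1 : R -> R).
Hypothesis bf : bdmeas f.
Hypothesis hpsi : C2_near psi psi1 (fun x => 2 * f x - (pi / 2) ^+ 2 * psi x).
Hypothesis psiN1 : psi (-1) = 0.
Hypothesis psi_1 : psi 1 = 0.

Let bpsi : bdmeas (cut2 psi). Proof. exact: C2_cut2 hpsi. Qed.

Let measurable_far (a : R) : measurable [set z : R | a <= `|z|].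
Proof.
rewrite (_ : [set z : R | a <= `|z|] = (@Num.norm R R) @^-1` `[a, +oo[).
  by rewrite -[X in measurable X]setTI; exact: normr_measurable.
by apply/seteqP; split => z /=; rewrite in_itv/= andbT.
Qed.

(** Just after leaving the ball of radius rho, psi is small since it vanishes at the endpoints and
    is Lipschitz; only jumps beyond 1 + eta escape this bound. *)
Let outside : exists M M' : R, [/\ 0 <= M, 0 <= M' & forall (rho eta y : R), 0 < rho -> rho <= 1 -> 0 < eta ->
  rho < `|y| -> `|cut2 psi y| <= M * (1 - rho + eta) + M' * \1_[set z | 1 + eta <= `|z|] y].
Proof.
have [M M0 hM] := C2_lipschitz hpsi.
have [_ [M' hM']] := bpsi.
have M'0 : 0 <= M' by rewrite (le_trans _ (hM' 0)).
exists M, M'; split => // rho eta y rho0 rho1 eta0 ry; rewrite indicE.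
have b0 : 0 <= 1 - rho + eta by rewrite addr_ge0 ?subr_ge0// ltW.
have [y1|y1] := leP (1 + eta) `|y|.
  by rewrite mem_set// mulr1 ler_wpDl// mulr_ge0.
rewrite memNset/= ?mulr0 ?addr0; last by rewrite leNgt y1.
have [y2|y2] := leP `|y| 2; last first.
  rewrite /cut2 indicE memNset ?mulr0 ?normr0 ?mulr_ge0//= in_itv/= -ler_norml.
  by rewrite leNgt y2.
rewrite cut2E//.
have ny : `| `|y| - 1| <= 1 - rho + eta by rewrite ler_norml; apply/andP; split; lra.
have [yp|yp] := leP 0 y.
  rewrite -[psi y]subr0 -psi_1 (le_trans (hM _ _ _ _))// ?normr1 ?ler1n//.
  by rewrite ler_wpM2l//; move: ny; rewrite (ger0_norm yp).
rewrite -[psi y]subr0 -psiN1 (le_trans (hM _ _ _ _))// ?normrN ?normr1 ?ler1n//.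
by rewrite ler_wpM2l//; move: ny; rewrite (ltr0_norm yp) -opprD normrN opprK.
Qed.

(** psi''/2 + lambda psi = f makes exp(lambda t) psi a martingale up to the f-term. Each step errs
    by a Taylor term of order e1 dl and by the value of psi at exit, charged to the exit probability
    p_i - p_{i+1}. These probabilities sum to at most 1, so the total exit error is of order 1 -
    rho, uniformly in the grid. *)
Lemma dynkin_grid : exists2 M : R, 0 <= M & forall e : R, 0 < e ->
  exists2 s0 : R, 0 < s0 &
  forall (d : measure_display) (T : measurableType d) (Q : probability T R)
    (Y : nat -> T -> R) (s rho : R) (N : nat),
  chain Q Y s -> 0 < s -> s <= s0 -> 0 < rho -> rho <= 1 ->
  let P i x : R := \prod_(j < i.+1) \1_(cball rho) (Y j x) in
  `| expR (lam * (N%:R * s ^+ 2)) * \int[Q]_x (P N x * cut2 psi (Y N x))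
     - \int[Q]_x (P 0%N x * cut2 psi (Y 0%N x))
     - \sum_(i < N) s ^+ 2 * (expR (lam * (i.+1%:R * s ^+ 2)) * \int[Q]_x (P i x * f (Y i x))) |
  <= expR (lam * (N%:R * s ^+ 2)) * (M * (1 - rho) + e * (1 + N%:R * s ^+ 2)).
Proof.
have [M [M' [M0 M'0 hout]]] := outside.
exists M => // e e0.
(* Makes both 3 e1 and M e1 at most e in the final sum. *)
pose e1 := e / (4 + M).
have d0 : 0 < 4 + M by rewrite ltr_pwDl.
have e10 : 0 < e1 by rewrite divr_gt0.
have [s1 s10 hs] := gstep_C2 hpsi e10.
have l0 := @lambda_Bm_gt0 R.
have [_ [B hB]] := bpsi.
have B0 : 0 <= B by rewrite (le_trans _ (hB 0)).
pose k1 := 3 * M' / e1 ^+ 4 + 1.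
have k10 : 0 < k1.
  rewrite ltr_wpDl//; apply: divr_ge0; first by rewrite mulr_ge0.
  by rewrite exprn_ge0// ltW.
pose k2 := lam ^+ 2 * B + 1.
have k20 : 0 < k2.
  by rewrite ltr_wpDl//; apply: mulr_ge0 => //; exact: sqr_ge0.
exists (Num.min (Num.min s1 1) (Num.min (e1 / k1) (Num.min (e1 / k2) lam^-1))).
  by rewrite !lt_min s10 ltr01 invr_gt0 l0 !divr_gt0.
move=> d T Q Y s rho N [mY cY] sp.
rewrite !le_min => /andP[/andP[ss1 ss2] /and3P[ss3 ss4 ss5]] rho0 rho1.
cbv zeta.
pose P i x : R := \prod_(j < i.+1) \1_(cball rho) (Y j x).
set dl := s ^+ 2.
have dl0 : 0 < dl by rewrite exprn_gt0.
have dls : dl <= s by rewrite /dl expr2 ler_piMl// ltW.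
have bcb := bdmeas_cball rho.
have bP i : bdmeas (P i).
  apply: (@bdmeas_prod _ _ _ i.+1 (fun j x => \1_(cball rho) (Y j x))) => j _.
  exact: bdmeas_comp bcb (mY j).
have P01 i x : 0 <= P i x <= 1.
  rewrite /P prodr_ge0/=; last by move=> j _; have /andP[] := cball01 rho (Y j x).
  by apply: prodr_ile1 => j _; exact: cball01.
have PS i x : P i.+1 x = P i x * \1_(cball rho) (Y i.+1 x) by rewrite /P big_ord_recr.
have Pin i x : P i x = 0 \/ `|Y i x| <= rho.
  rewrite /P big_ord_recr/= cballE; have [yr|yr] := leP `|Y i x| rho; first by right.
  by left; rewrite mulr0.
pose a i := \int[Q]_x (P i x * cut2 psi (Y i x)).
pose b i := \int[Q]_x (P i x * f (Y i x)).
pose p i := \int[Q]_x P i x.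
have bpY i : bdmeas (fun x => cut2 psi (Y i x)) by exact: bdmeas_comp bpsi (mY i).
have bfY i : bdmeas (fun x => f (Y i x)) by exact: bdmeas_comp bf (mY i).
have bPp i j : bdmeas (fun x => P i x * cut2 psi (Y j x)) by exact: bdmeasM.
have bPf i : bdmeas (fun x => P i x * f (Y i x)) by exact: bdmeasM.
have cstep i h : bdmeas h -> \int[Q]_x (P i x * h (Y i.+1 x)) = \int[Q]_x (P i x * gstep s h (Y i x)).
  move=> bh; apply: (cY i (fun=> \1_(cball rho)) h) => //.
have step i : `|a i.+1 - (1 - lam * dl) * a i - dl * b i| <=
    2 * e1 * dl + M * (1 - rho + e1) * (p i - p i.+1).
  pose far : R -> R := \1_[set z | 1 + e1 <= `|z|].
  have bfar : bdmeas far by exact: bdmeas_indic.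
  have bfarY : bdmeas (fun x => far (Y i.+1 x)) by exact: bdmeas_comp bfar (mY _).
  (* main term *)
  have h1 : `|\int[Q]_x (P i x * cut2 psi (Y i.+1 x)) - ((1 - lam * dl) * a i + dl * b i)| <= e1 * dl.
    rewrite cstep// -!expectZ// -expectD; last 2 first.
    - exact: bdmeasZ.
    - exact: bdmeasZ.
    have bg : bdmeas (fun x => P i x * gstep s (cut2 psi) (Y i x)).
      by apply: bdmeasM => //; exact: bdmeas_comp (bdmeas_gstep s bpsi) (mY i).
    have bR : bdmeas (fun x => (1 - lam * dl) * (P i x * cut2 psi (Y i x)) + dl * (P i x * f (Y i x))).
      by apply: bdmeasD; exact: bdmeasZ.
    rewrite -expectB//; apply: expect_le_bound; first exact: bdmeasB.
    move=> x; have [->|yr] := Pin i x.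
      by rewrite !(mul0r, mulr0, addr0, subr0) normr0 mulr_ge0// ltW.
    have y1 : `|Y i x| <= 1 by exact: le_trans rho1.
    have := hs s 1 (Y i x) sp ltr01; rewrite divr1 => /(_ ss1 y1).
    rewrite divr1 -/dl => h.
    have gE : gstep s (fun y => cut2 psi (y / 1)) (Y i x) = gstep s (cut2 psi) (Y i x).
      by apply: eq_Rintegral => z _; rewrite divr1.
    rewrite gE in h.
    have -> : P i x * gstep s (cut2 psi) (Y i x) - ((1 - lam * dl) * (P i x * cut2 psi (Y i x)) + dl * (P i x * f (Y i x))) =
      P i x * (gstep s (cut2 psi) (Y i x) - (psi (Y i x) + dl * ((2 * f (Y i x) - (pi / 2) ^+ 2 * psi (Y i x)) / 2))).
      rewrite cut2E ?(le_trans y1) ?ler1n// lambda_BmE.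
      by move: (psi (Y i x)) (f (Y i x)) => u v; field.
    rewrite normrM; have /andP[q0 q1] := P01 i x.
    by rewrite (ger0_norm q0) (le_trans _ h)// ler_piMl.
  (* exit term *)
  have aS : a i.+1 = \int[Q]_x (P i x * cut2 psi (Y i.+1 x)) -
      \int[Q]_x (P i x * ((1 - \1_(cball rho) (Y i.+1 x)) * cut2 psi (Y i.+1 x))).
    rewrite -expectB//.
      by apply: eq_Rintegral => x _; rewrite PS; ring.
    apply: bdmeasM => //; apply: bdmeasM => //; apply: bdmeasB; first exact: bdmeas_cst.
    exact: bdmeas_comp bcb (mY _).
  have h2 : `|\int[Q]_x (P i x * ((1 - \1_(cball rho) (Y i.+1 x)) * cut2 psi (Y i.+1 x)))| <=
      M * (1 - rho + e1) * (p i - p i.+1) + M' * \int[Q]_x (P i x * far (Y i.+1 x)).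
    have bl : bdmeas (fun x => P i x * ((1 - \1_(cball rho) (Y i.+1 x)) * cut2 psi (Y i.+1 x))).
      apply: bdmeasM => //; apply: bdmeasM => //; apply: bdmeasB; first exact: bdmeas_cst.
      exact: bdmeas_comp bcb (mY _).
    have b3 : bdmeas (fun x => P i x * far (Y i.+1 x)) by exact: bdmeasM.
    rewrite /p -expectB// -!expectZ//; last exact: bdmeasB.
    rewrite -expectD; last 2 first.
    - by apply: bdmeasZ; exact: bdmeasB.
    - exact: bdmeasZ.
    apply: (le_trans (le_normr_Rintegral _ (bdmeas_integrable Q bl))) => //.
    apply: le_expect; first exact: bdmeas_norm.
      by apply: bdmeasD; apply: bdmeasZ => //; exact: bdmeasB.
    move=> x; have /andP[q0 q1] := P01 i x; rewrite PS cballE.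
    have [yr|yr] := leP `|Y i.+1 x| rho.
      have far0 : 0 <= far (Y i.+1 x) by rewrite /far indicE; case: (_ \in _).
      rewrite mulr1 !subrr mul0r !mulr0 normr0 add0r.
      by apply: mulr_ge0 => //; exact: mulr_ge0.
    rewrite mulr0 !subr0 mul1r normrM (ger0_norm q0).
    have := hout rho e1 (Y i.+1 x) rho0 rho1 e10 yr; rewrite -/(far (Y i.+1 x)) => h.
    apply: (le_trans (ler_wpM2l q0 h)).
    by rewrite le_eqVlt; apply/orP; left; apply/eqP; ring.
  have h3 : M' * \int[Q]_x (P i x * far (Y i.+1 x)) <= e1 * dl.
    rewrite cstep//.
    apply: (@le_trans _ _ (M' * (3 * s ^+ 4 / e1 ^+ 4))).
      rewrite ler_wpM2l// -[leRHS](expect_cst Q); apply: le_expect.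
      - by apply: bdmeasM => //; exact: bdmeas_comp (bdmeas_gstep s bfar) (mY i).
      - exact: bdmeas_cst.
      move=> x; have [->|yr] := Pin i x.
        rewrite mul0r; apply: divr_ge0; last by rewrite exprn_ge0// ltW.
        by apply: mulr_ge0 => //; rewrite exprn_ge0// ltW.
      have g0 : 0 <= gstep s far (Y i x).
        by apply: Rintegral_ge0 => z _; rewrite /far indicE; case: (_ \in _).
      have /andP[q0 q1] := P01 i x.
      rewrite (@le_trans _ _ (gstep s far (Y i x)))// ?ler_piMl//.
      by apply: gstep_tail => //; rewrite lerD2r (le_trans yr).
    rewrite (_ : M' * _ = (3 * M' / e1 ^+ 4 * dl) * dl); last by rewrite /dl; field; rewrite gt_eqF.
    rewrite ler_wpM2r ?(ltW dl0)//.
    rewrite (@le_trans _ _ (k1 * dl))//; first by rewrite ler_wpM2r ?(ltW dl0)// lerDl.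
    by rewrite mulrC -ler_pdivlMr// (le_trans dls).
  rewrite aS; set u := \int[Q]_x (P i x * cut2 psi _) in h1 *.
  set v := \int[Q]_x _ in h2 *.
  have -> : u - v - (1 - lam * dl) * a i - dl * b i =
    (u - ((1 - lam * dl) * a i + dl * b i)) - v by ring.
  rewrite (le_trans (ler_normB _ _))//; move: h1 h2 h3; lra.
pose E i := expR (lam * (i%:R * dl)).
have ES i : E i.+1 = expR (lam * dl) * E i.
  by rewrite /E -expRD; congr expR; rewrite -natr1; ring.
have E0 i : 0 < E i by exact: expR_gt0.
have EN i : (i <= N)%N -> E i <= E N.
  by move=> iN; rewrite ler_expR ler_wpM2l ?(ltW l0)// ler_wpM2r ?(ltW dl0)// ler_nat.
have ld1 : lam * dl <= 1 by rewrite -ler_pdivlMl// mulr1 (le_trans dls).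
(* The exponential weight compensates the decay 1 - lambda dl of one step up to second order. *)
have expq : `|expR (lam * dl) * (1 - lam * dl) - 1| <= (lam * dl) ^+ 2.
  have q0 : 0 <= lam * dl by rewrite mulr_ge0// ltW.
  have q1 : 1 - lam * dl <= expR (- (lam * dl)) by have := expR_ge1Dx (- (lam * dl)).
  have q2 : 1 + lam * dl <= expR (lam * dl) by exact: expR_ge1Dx.
  have q3 : 0 <= 1 - lam * dl by rewrite subr_ge0.
  have u1 : expR (lam * dl) * (1 - lam * dl) <= 1.
    rewrite (le_trans (ler_wpM2l (expR_ge0 _) q1))//.
    by rewrite -expRD subrr expR0.
  have u2 : 1 - (lam * dl) ^+ 2 <= expR (lam * dl) * (1 - lam * dl).
    rewrite (le_trans _ (ler_wpM2r q3 q2))// le_eqVlt; apply/orP; left; apply/eqP; ring.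
  rewrite ler_norml; apply/andP; split; first by lra.
  by rewrite (@le_trans _ _ 0) ?sqr_ge0// subr_le0.
have aB i : `|a i| <= B.
  apply: expect_le_bound => // x; rewrite normrM; have /andP[q0 q1] := P01 i x.
  by rewrite -[leRHS]mul1r ler_pM// ger0_norm.
have pge i : p i.+1 <= p i.
  apply: le_expect => // x; rewrite PS; have /andP[q0 q1] := P01 i x.
  by rewrite ler_piMr//; have /andP[] := cball01 rho (Y i.+1 x).
have m0 : 0 <= M * (1 - rho + e1) by rewrite mulr_ge0// addr_ge0 ?subr_ge0// ltW.
have stepE i : (i < N)%N -> `|E i.+1 * a i.+1 - E i * a i - dl * (E i.+1 * b i)| <=
    E N * (3 * e1 * dl + M * (1 - rho + e1) * (p i - p i.+1)).
  move=> iN.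
  have -> : E i.+1 * a i.+1 - E i * a i - dl * (E i.+1 * b i) =
    E i.+1 * (a i.+1 - (1 - lam * dl) * a i - dl * b i) +
    E i * ((expR (lam * dl) * (1 - lam * dl) - 1) * a i) by rewrite ES; ring.
  rewrite (le_trans (ler_normD _ _))//.
  rewrite (normrM (E i.+1)) (normrM (E i)) (normrM _ (a i)) !(gtr0_norm (E0 _)).
  have q1 := step i.
  have q2 : `|expR (lam * dl) * (1 - lam * dl) - 1| * `|a i| <= e1 * dl.
    rewrite (le_trans (ler_pM _ _ expq (aB i)))//.
    rewrite (_ : _ * B = (lam ^+ 2 * B * dl) * dl); last by ring.
    rewrite ler_wpM2r ?(ltW dl0)//.
    rewrite (@le_trans _ _ (k2 * dl))//; first by rewrite ler_wpM2r ?(ltW dl0)// lerDl.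
    by rewrite mulrC -ler_pdivlMr// (le_trans dls).
  have w1 : E i.+1 * `|a i.+1 - (1 - lam * dl) * a i - dl * b i| <=
      E N * (2 * e1 * dl + M * (1 - rho + e1) * (p i - p i.+1)).
    by rewrite ler_pM// ?(ltW (E0 _))// EN.
  have w2 : E i * (`|expR (lam * dl) * (1 - lam * dl) - 1| * `|a i|) <= E N * (e1 * dl).
    by rewrite ler_pM// ?(ltW (E0 _))// ?mulr_ge0// EN// ltnW.
  rewrite (le_trans (lerD w1 w2))// -mulrDr ler_wpM2l ?(ltW (E0 _))//.
  by rewrite le_eqVlt; apply/orP; left; apply/eqP; ring.
have sumE i : (i <= N)%N ->
    `|E i * a i - a 0%N - \sum_(j < i) dl * (E j.+1 * b j)| <=
    E N * (3 * e1 * dl * i%:R + M * (1 - rho + e1) * (p 0%N - p i)).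
  elim: i => [|i IH] iN.
    rewrite /E big_ord0 mul0r mulr0 expR0 mul1r !(subrr, subr0) normr0.
    by rewrite !mulr0 addr0 mulr0.
  rewrite big_ord_recr/=; set S := \sum_(j < i) _ in IH *.
  have -> : E i.+1 * a i.+1 - a 0%N - (S + dl * (E i.+1 * b i)) =
    (E i * a i - a 0%N - S) + (E i.+1 * a i.+1 - E i * a i - dl * (E i.+1 * b i)) by ring.
  rewrite (le_trans (ler_normD _ _))// (le_trans (lerD (IH (ltnW iN)) (stepE i iN)))//.
  rewrite -mulrDr ler_wpM2l ?(ltW (E0 _))// -natr1.
  by rewrite le_eqVlt; apply/orP; left; apply/eqP; ring.
have a0 : a 0%N = \int[Q]_x (P 0%N x * cut2 psi (Y 0%N x)) by [].
apply: (le_trans (sumE N (leqnn N))).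
rewrite ler_wpM2l ?(ltW (E0 _))//.
have p01 i : 0 <= p i <= 1.
  apply/andP; split.
    by apply: Rintegral_ge0 => x _; have /andP[] := P01 i x.
  rewrite -[leRHS](expect_cst Q); apply: le_expect => //; first exact: bdmeas_cst.
  by move=> x; have /andP[] := P01 i x.
have pd : p 0%N - p N <= 1.
  by have /andP[? ?] := p01 0%N; have /andP[? ?] := p01 N; lra.
have eE : e1 * (4 + M) = e by rewrite /e1 divfK// gt_eqF.
have h1 : M * (1 - rho + e1) * (p 0%N - p N) <= M * (1 - rho) + M * e1.
  by rewrite -mulrDr -[leRHS]mulr1 ler_wpM2l.
have Nd0 : 0 <= N%:R * dl by rewrite mulr_ge0// ltW.
have h2 : 3 * e1 * dl * N%:R <= e * (N%:R * dl).
  rewrite (_ : 3 * e1 * dl * N%:R = 3 * e1 * (N%:R * dl)); last by ring.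
  rewrite ler_wpM2r// -eE mulrC ler_wpM2l ?(ltW e10)//; lra.
have h3 : M * e1 <= e by rewrite -eE mulrC ler_wpM2l ?(ltW e10)//; lra.
rewrite [e * (1 + _)]mulrDr mulr1; lra.
Qed.

End dynkin.

(** * Survival events of continuous paths *)

(** Strictness of the inequality comes from continuity at t: if h t differs from 1, so do its values
    slightly later, and the infimum stays away from t. *)
Lemma inf_hit_gtP {R : realType} (h : R -> R) (A : set R) (a t : R) :
  continuous h -> (forall r, A r <-> a <= r /\ h r = 1) -> a <= t ->
  (t%:E < ereal_inf (EFin @` A))%E <-> (forall r, a <= r <= t -> h r != 1).
Proof.
move=> ch hA at_; split => [tA r /andP[ar rt]|hne].
  apply/eqP => h1; move: tA; apply/negP; rewrite -leNgt.
  apply: (@le_trans _ _ r%:E); last by rewrite lee_fin.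
  by apply: ereal_inf_lbound; exists r => //; apply/hA.
have /nbhs_ballP[e e0 he] : \forall r \near t, h r != 1.
  have h1 : (h r - 1) @[r --> t] --> h t - 1 by apply: cvgB; [exact: ch|exact: cvg_cst].
  have h2 : h t - 1 != 0 by rewrite subr_eq0; apply: hne; rewrite at_ lexx.
  have h3 : \forall r \near t, h r - 1 != 0 by exact: cvgr_neq0 h1 h2.
  by apply: filterS h3 => r; rewrite subr_eq0.
apply: (@lt_le_trans _ _ (t + e)%:E); first by rewrite lte_fin ltrDl.
apply: le_ereal_inf_tmp => _ [r /hA[ar hr] <-]; rewrite lee_fin leNgt.
apply/negP => rte; have [rt|tr] := leP r t.
  by have := hne r; rewrite ar rt hr eqxx => /(_ isT).
have : h r != 1.
  by apply: he; rewrite /ball/= ltr0_norm ?subr_lt0// opprB ltrBlDl.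
by rewrite hr eqxx.
Qed.

Section survival.
Context {R : realType} {d : measure_display} {T : measurableType d}.
Variable X : R -> T -> R.
Hypothesis mX : forall r, measurable_fun setT (X r).
Hypothesis cX : forall z, continuous (X ^~ z).

Definition surv (t : R) : set T := [set z | forall r, 0 <= r <= t -> `|X r z| < 1].

(** Hitting times are defined through equality with 1, so this is what survival means before the
    starting point is known to lie inside. *)
Definition avoid (t : R) : set T := [set z | forall r, 0 <= r <= t -> `|X r z| != 1].

Definition inner (rho : R) (r : R) (z : T) : R := rho - `|X r z|.

(** Nonnegativity says that the path keeps a distance 1/(k+1) from the boundary; by compactness,
    avoidance is the union of these closed events. *)
Definition gap (k : nat) (r : R) (z : T) : R := `| `|X r z| - 1| - k.+1%:R^-1.

Let cnX z : continuous (fun r => `|X r z|).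
Proof. by move=> r; apply: continuous_cvg; [exact: norm_continuous|exact: cX]. Qed.

Let mnX r : measurable_fun setT (fun z => `|X r z|).
Proof. by apply: measurableT_comp => //; exact: mX. Qed.

Lemma measurable_inner rho r : measurable_fun setT (inner rho r).
Proof. by apply: measurable_funB => //; exact: mnX. Qed.

Lemma continuous_inner rho z : continuous (inner rho ^~ z).
Proof. by move=> r; apply: cvgB; [exact: cvg_cst|exact: cnX]. Qed.

Let measurable_gap k r : measurable_fun setT (gap k r).
Proof.
apply: measurable_funB => //; apply: measurableT_comp => //.
by apply: measurable_funB => //; exact: mnX.
Qed.

Let continuous_gap k z : continuous (gap k ^~ z).
Proof.
move=> r; apply: cvgB; last exact: cvg_cst.
apply: continuous_cvg; first exact: norm_continuous.
by apply: cvgB; [exact: cnX|exact: cvg_cst].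
Qed.

Lemma measurable_path_inner rho t : 0 <= t -> measurable (path_ge0 (inner rho) t).
Proof.
apply: (measurable_path_ge0 ltr01); first exact: measurable_inner.
exact: continuous_inner.
Qed.

(* the path stays inside a smaller ball, by compactness of [0, t] *)
Lemma surv_inner t z : 0 <= t -> surv t z ->
  \forall k \near \oo, path_ge0 (inner (1 - k.+1%:R^-1)) t z.
Proof.
move=> t0 zS; have [c] := @EVT_max R (fun r => `|X r z|) 0 t t0
  (continuous_subspaceT (@cnX z)).
rewrite in_itv/= => ct hc.
have c1 : 0 < 1 - `|X c z| by rewrite subr_gt0; exact: zS.
have /cvgrPdist_lt/(_ _ c1) := @cvg_harmonic R.
apply: filterS => k; rewrite sub0r normrN /harmonic ger0_norm ?invr_ge0// => kc r rt.
rewrite /inner subr_ge0.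
have /(_ r) := hc; rewrite in_itv/= => /(_ rt) h.
by rewrite (le_trans h)// lerBrDl -lerBrDr ltW.
Qed.

Lemma inner_surv rho t : rho < 1 -> path_ge0 (inner rho) t `<=` surv t.
Proof. by move=> r1 z h r rt; rewrite (le_lt_trans _ r1)// -subr_ge0; exact: h. Qed.

Lemma surv_cvg t z : 0 <= t ->
  \1_(path_ge0 (inner (1 - k.+1%:R^-1)) t) z @[k --> \oo] --> (\1_(surv t) z : R).
Proof.
move=> t0; apply: cvg_near_cst; have [zS|zS] := pselect (surv t z).
  near=> k; rewrite !indicE !mem_set//; near: k; exact: surv_inner.
near=> k; rewrite !indicE !memNset// => h; apply: zS.
by apply: inner_surv h; rewrite ltrBlDr ltrDl invr_gt0.
Unshelve. all: by end_near. Qed.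

Lemma measurable_surv t : 0 <= t -> measurable (surv t).
Proof.
move=> t0; rewrite (_ : surv t = \bigcup_k path_ge0 (inner (1 - k.+1%:R^-1)) t).
  by apply: bigcup_measurable => k _; exact: measurable_path_inner.
apply/seteqP; split => [z zS|z [k _]].
  by have [k _ hk] := surv_inner t0 zS; exists k => //; exact: (hk k (leqnn k)).
by apply: inner_surv; rewrite ltrBlDr ltrDl invr_gt0.
Qed.

Lemma measurable_avoid t : 0 <= t -> measurable (avoid t).
Proof.
move=> t0; rewrite (_ : avoid t = \bigcup_k path_ge0 (gap k) t).
  apply: bigcup_measurable => k _.
  exact: (measurable_path_ge0 ltr01).
apply/seteqP; split => [z zA|z [k _] h r rt]; last first.
  have := h r rt; rewrite /gap; apply: contraTneq => ->.
  by rewrite subrr normr0 sub0r oppr_ge0 -ltNge invr_gt0.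
have cg : continuous (fun r => `| `|X r z| - 1|).
  move=> r; apply: continuous_cvg; first exact: norm_continuous.
  by apply: cvgB; [exact: cnX|exact: cvg_cst].
have [c] := @EVT_min R _ 0 t t0 (continuous_subspaceT cg).
rewrite in_itv/= => ct hc.
have c0 : 0 < `| `|X c z| - 1| by rewrite normr_gt0 subr_eq0; exact: zA.
have /cvgrPdist_lt/(_ _ c0)[k _ /(_ k (leqnn k))] := @cvg_harmonic R.
rewrite sub0r normrN /harmonic ger0_norm ?invr_ge0// => kc; exists k => // r rt.
rewrite /gap subr_ge0; have /(_ r) := hc; rewrite in_itv/= => /(_ rt).
by apply: le_trans; exact: ltW.
Qed.

(** Intermediate value theorem: a path started inside cannot leave without hitting 1. *)
Lemma avoid_survP t z : 0 <= t -> `|X 0 z| < 1 -> avoid t z <-> surv t z.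
Proof.
move=> t0 X0; split => [zA r /andP[r0 rt]|zS r /zS]; last by move/lt_eqF => ->.
rewrite ltNge; apply/negP => rX.
have := @IVT R (fun r => `|X r z|) 0 r 1 r0 (continuous_subspaceT (@cnX z)).
rewrite ge_min (ltW X0)/= le_max rX orbT => /(_ isT)[c].
rewrite in_itv/= => /andP[c0 cr] /eqP; apply/negP; apply: zA.
by rewrite c0 (le_trans cr).
Qed.

End survival.

(** * Initial laws carried by (-1, 1) *)

Section inside.
Context {R : realType}.
Variable nu : probability R R.
Hypothesis nu1 : nu `]-1, 1[%classic = 1%E.

Lemma probability_out0 : nu (~` `]-1, 1[%classic) = 0%E.
Proof. by rewrite probability_setC ?nu1 ?subee//; exact: measurable_itv. Qed.

Lemma expect_inside1 (F G : R -> R) : bdmeas F -> bdmeas G ->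
  (forall x, `|x| < 1 -> F x = G x) -> \int[nu]_x F x = \int[nu]_x G x.
Proof.
move=> [mF _] [mG _] FG; rewrite /Rintegral; congr fine.
apply: ae_eq_integral => //; [exact/measurable_EFinP|exact/measurable_EFinP|].
exists (~` `]-1, 1[%classic); split.
- by apply: measurableC; exact: measurable_itv.
- exact: probability_out0.
- move=> x /= h; rewrite in_itv/= => x1; apply: h => _.
  by rewrite FG// ltr_norml.
Qed.

Context {d : measure_display} {Omega : measurableType d}.
Variable P : probability Omega R.

Lemma expect_inside (F G : R * Omega -> R) : bdmeas F -> bdmeas G ->
  (forall z, `|z.1| < 1 -> F z = G z) ->
  \int[prodp nu P]_z F z = \int[prodp nu P]_z G z.
Proof.
move=> bF bG FG; rewrite !expect_prod//; apply: expect_inside1.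
- exact: bdmeas_fubini.
- exact: bdmeas_fubini.
- by move=> x x1; apply: eq_Rintegral => w _; rewrite FG.
Qed.

Lemma integral_xsection (D : set (R * Omega)) (F : R * Omega -> R) :
  measurable D -> bdmeas F ->
  (\int[nu]_x \int[P]_(w in xsection D x) (F (x, w))%:E)%E =
  (\int[prodp nu P]_z (\1_D z * F z))%:E.
Proof.
move=> mD bF.
have bDF : bdmeas (fun z => \1_D z * F z) by apply: bdmeasM => //; exact: bdmeas_indic.
rewrite expect_prod// -expectE; last exact: (bdmeas_fubini P bDF).
apply: eq_integral => x _; rewrite -expectE; last first.
  by apply: bdmeas_comp bDF _; exact: pair1_measurable.
rewrite integral_mkcond; apply: eq_integral => w _.
rewrite patchE indicE mem_xsection; case: ifPn => _; by rewrite ?mul1r ?mul0r.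
Qed.

Lemma integral_measure_xsection (D : set (R * Omega)) : measurable D ->
  (\int[nu]_x P (xsection D x))%E = (\int[prodp nu P]_z \1_D z)%:E.
Proof.
move=> mD; have := integral_xsection mD (bdmeas_cst 1).
under [X in (_ = X%:E)%E -> _]eq_Rintegral do rewrite mulr1.
move=> <-; apply: eq_integral => x _.
have mx : measurable (xsection D x) by exact: measurable_xsection.
by rewrite integral_cst// mul1e.
Qed.

End inside.

(** * Brownian motion divided by a moving radius *)

Section process.
Context {R : realType} {d : measure_display} {Omega : measurableType d}.
Variables (P : probability Omega R) (W : R -> Omega -> R).
Hypothesis BM : is_std_BM P W.
Variables (c : R) (h : R -> R).
Hypothesis ch : continuous h.
Hypothesis h0 : forall r, 0 < h r.
Hypothesis hc : h 0 = c.

(* W is only continuous on [0, +oo[, hence the truncation at 0 *)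
Definition proc (r : R) (z : R * Omega) : R :=
  (c * z.1 + W (Num.max r 0) z.2) / h r.

Lemma measurable_proc r : measurable_fun setT (proc r).
Proof.
have [mW _] := BM.
apply: measurable_funM => //; apply: measurable_funD.
  by apply: measurable_funM => //; exact: measurable_fst.
exact: (measurableT_comp (mW _) measurable_snd).
Qed.

Lemma continuous_proc z : continuous (proc ^~ z).
Proof.
have [_ [_ [cW _]]] := BM.
have cp : continuous (fun r : R => Num.max r 0).
  by move=> r; apply: continuous_max; [exact: cvg_id|exact: cvg_cst].
move=> r; apply: cvgM; last first.
  by apply: cvgV; [rewrite gt_eqF|exact: ch].
apply: cvgD; first exact: cvg_cst.
have /subspace_continuousP/(_ (Num.max r 0)) := cW z.2.
rewrite /= in_itv/= le_max lexx orbT => /(_ isT) cWr.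
apply: cvg_trans cWr => A /= hA.
have : \forall y \near Num.max r 0, `[0, +oo[%classic y -> A (W y z.2) by exact: hA.
move=> /(cp r) hr.
have {}hr : \forall y \near r, `[0, +oo[%classic (Num.max y 0) -> A (W (Num.max y 0) z.2) by exact: hr.
apply: filterS hr => y; apply.
by rewrite /= in_itv/= le_max lexx orbT.
Qed.

Lemma proc0 z : proc 0 z = z.1.
Proof.
have [_ [W0 _]] := BM.
by rewrite /proc maxxx W0 addr0 hc mulrC mulKf// -hc gt_eqF.
Qed.

Lemma proc_grid (n i : nat) (t : R) z : 0 < t ->
  proc (i%:R * mesh t n) z = (c * z.1 + W (i%:R * mesh t n) z.2) / h (i%:R * mesh t n).
Proof.
move=> t0; rewrite /proc (_ : Num.max _ 0 = i%:R * mesh t n)//.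
by apply/max_idPl; rewrite mulr_ge0// ltW// mesh_gt0.
Qed.

(** Bridge between the two pictures: the unscaled walk in growing balls, for which the chain
    estimates are stated, and the scaled process in a fixed ball. *)
Lemma prod_cball_grid (t rho : R) (n i : nat) z : 0 < t ->
  \prod_(j < i.+1) \1_(cball (rho * h (j%:R * mesh t n)))
    (c * z.1 + W (j%:R * mesh t n) z.2) =
  \1_(grid_ge0 t (inner proc rho) n i) z :> R.
Proof.
move=> t0.
have cE j : \1_(cball (rho * h (j%:R * mesh t n))) (c * z.1 + W (j%:R * mesh t n) z.2) =
    (0 <= inner proc rho (j%:R * mesh t n) z)%R%:R :> R.
  rewrite cballE /inner subr_ge0 proc_grid// normrM (gtr0_norm (x := _^-1)) ?invr_gt0//.
  by rewrite ler_pdivrMr.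
have [zg|zg] := pselect (grid_ge0 t (inner proc rho) n i z).
  rewrite [RHS]indicE mem_set// big1// => j _.
  by rewrite cE zg// -ltnS.
rewrite [RHS]indicE memNset//.
have [j ji hj] : exists2 j, (j <= i)%N & inner proc rho (j%:R * mesh t n) z < 0.
  apply: contrapT => hn; apply: zg => j ji; rewrite leNgt; apply/negP => hj.
  by apply: hn; exists j.
rewrite -ltnS in ji.
by rewrite (bigD1 (Ordinal ji))//= cE leNgt hj mul0r.
Qed.

Variable nu : probability R R.

Lemma grid_expect_cvg (t rho r : R) (F : R -> R) : 0 < t -> 0 <= r ->
  continuous F -> bdmeas F ->
  (\int[prodp nu P]_z (\1_(grid_ge0 t (inner proc rho) n (Num.trunc (r / mesh t n))) z *
     F (proc ((Num.trunc (r / mesh t n))%:R * mesh t n) z))) @[n --> \oo] -->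
  \int[prodp nu P]_z (\1_(path_ge0 (inner proc rho) r) z * F (proc r z)).
Proof.
move=> t0 r0 cF bF; have [_ [M hM]] := bF.
have mi := measurable_inner measurable_proc.
have ci := continuous_inner continuous_proc.
apply: (@expect_cvg _ _ _ (prodp nu P) _ _ M).
- move=> n; apply: (bdmeasM (bdmeas_indic _) (bdmeas_comp bF (measurable_proc _))).1.
  exact: measurable_grid_ge0.
- move=> n z; rewrite normrM indicE; case: (_ \in _).
    by rewrite normr1 mul1r.
  by rewrite normr0 mul0r (le_trans _ (hM 0)).
- move=> z; apply: cvgM; first exact: (grid_ge0_cvg t0 (ci rho) r0).
  apply: continuous_cvg; first exact: cF.
  exact: continuous_cvg (@continuous_proc z r) (trunc_mesh_cvg t0 r0).
Qed.

End process.

(** * Continuous extension off the interval *)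

Section clamp.
Context {R : realType}.

(** Replaces [cut2], which may jump at -2 and 2, where the passage to the limit in the mesh needs a
    continuous test function; the two agree on [-1, 1]. *)
Definition clamp (psi : R -> R) (y : R) : R := psi (Num.max (-1) (Num.min y 1)).

Lemma clampE psi y : `|y| <= 1 -> clamp psi y = psi y.
Proof.
rewrite ler_norml => /andP[y1 y2]; rewrite /clamp (_ : Num.min y 1 = y).
  by congr psi; apply/max_idPr.
by apply/min_idPl.
Qed.

Let clamp_itv (y : R) : `|Num.max (-1) (Num.min y 1)| <= 1.
Proof.
rewrite ler_norml le_max lexx/= ge_max ge_min lexx orbT andbT; lra.
Qed.

Lemma continuous_clamp psi psi1 psi2 : C2_near psi psi1 psi2 -> continuous (clamp psi).
Proof.
move=> hpsi y; have /hpsi[dp _ _] : Num.max (-1) (Num.min y 1) \in `]-3, 3[.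
  by have := clamp_itv y; rewrite ler_norml in_itv/= => /andP[? ?]; apply/andP; split; lra.
have ct : {for y, continuous (fun u : R => Num.max (-1) (Num.min u 1))}.
  apply: (@continuous_max R R (cst (-1)) (fun u : R => Num.min u 1)); first exact: cvg_cst.
  by apply: (@continuous_min R R id (cst 1)); [exact: cvg_id|exact: cvg_cst].
exact: continuous_cvg (is_derive_continuous dp) ct.
Qed.

Lemma bdmeas_clamp psi psi1 psi2 : C2_near psi psi1 psi2 -> bdmeas (clamp psi).
Proof.
move=> hpsi; split.
  by apply: continuous_measurable_fun; exact: continuous_clamp hpsi.
have [_ [M hM]] := C2_cut2 hpsi; exists M => y.
have y1 := clamp_itv y.
have y2 : `|Num.max (-1) (Num.min y 1)| <= 2 by rewrite (le_trans y1)// ler1n.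
by rewrite /clamp -(cut2E psi y2).
Qed.

End clamp.

(** * Dynkin's formula for Brownian motion killed at the boundary *)

Section killed_brownian_motion.
Context {R : realType} {d : measure_display} {Omega : measurableType d}.
Variables (P : probability Omega R) (W : R -> Omega -> R).
Hypothesis BM : is_std_BM P W.
Local Notation lam := (@lambda_Bm R).
Local Notation mu := (@lebesgue_measure R).

Definition bproc : R -> R * Omega -> R := proc W 1 (fun=> 1).

Let c1 : continuous (fun _ : R => 1 : R). Proof. by move=> r; exact: cvg_cst. Qed.
Let p1 (r : R) : 0 < (fun _ : R => 1 : R) r. Proof. exact: ltr01. Qed.
Let mX r : measurable_fun setT (bproc r). Proof. exact: measurable_proc BM _ _ _. Qed.
Let cX z : continuous (bproc ^~ z). Proof. exact: (@continuous_proc _ _ _ P W BM 1 (fun=> 1) c1 p1 z). Qed.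

Variable nu : probability R R.
Local Notation Q := (prodp nu P).

Definition killed (r : R) (F : R -> R) : R :=
  \int[Q]_z (\1_(surv bproc r) z * F (bproc r z)).

Let pkilled (rho r : R) (F : R -> R) : R :=
  \int[Q]_z (\1_(path_ge0 (inner bproc rho) r) z * F (bproc r z)).

Lemma bdmeas_killed (r : R) (F : R -> R) : 0 <= r -> bdmeas F ->
  bdmeas (fun z : R * Omega => \1_(surv bproc r) z * F (bproc r z)).
Proof.
move=> r0 bF; apply: (bdmeasM (bdmeas_indic _) (bdmeas_comp bF (mX _))).
exact: measurable_surv.
Qed.

Let pkilled_cvg (r : R) (F : R -> R) : 0 <= r -> bdmeas F ->
  pkilled (1 - k.+1%:R^-1) r F @[k --> \oo] --> killed r F.
Proof.
move=> r0 bF; have [_ [M hM]] := bF.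
apply: (@expect_cvg _ _ _ Q _ _ M).
- move=> n; apply: (bdmeasM (bdmeas_indic _) (bdmeas_comp bF (mX _))).1.
  exact: measurable_path_inner.
- move=> n z; rewrite normrM indicE; case: (_ \in _).
    by rewrite normr1 mul1r.
  by rewrite normr0 mul0r (le_trans _ (hM 0)).
- by move=> z; apply: cvgM; [exact: surv_cvg|exact: cvg_cst].
Qed.

Section dynkin_formula.
Variables (f psi psi1 : R -> R) (t : R).
Hypothesis t0 : 0 < t.
Hypothesis cf : continuous f.
Hypothesis bf : bdmeas f.
Hypothesis hpsi : C2_near psi psi1 (fun x => 2 * f x - (pi / 2) ^+ 2 * psi x).
Hypothesis psiN1 : psi (-1) = 0.
Hypothesis psi_1 : psi 1 = 0.

Let bpsi := bdmeas_clamp hpsi.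
Let cpsi := continuous_clamp hpsi.

(** The limit of [dynkin_grid] as the mesh tends to 0 with rho fixed: the sum becomes an integral by
    [riemann_cvg], and the arbitrary e leaves only the exit error. *)
Let pdynkin : exists2 M, 0 <= M & forall rho : R, 0 < rho -> rho <= 1 ->
  measurable_fun `[0, t[ (fun r => expR (lam * r) * pkilled rho r f) /\
  `| expR (lam * t) * pkilled rho t (clamp psi) - pkilled rho 0 (clamp psi)
     - \int[mu]_(r in `[0, t]) (expR (lam * r) * pkilled rho r f) | <=
  expR (lam * t) * (M * (1 - rho)).
Proof.
have [M M0 hM] := dynkin_grid bf hpsi psiN1 psi_1.
exists M => // rho rho0 rho1.
have l0 := @lambda_Bm_gt0 R.
have [_ [B hB]] := bf.
have B0 : 0 <= B by rewrite (le_trans _ (hB 0)).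
pose G n i (F : R -> R) := \int[Q]_z (\1_(grid_ge0 t (inner bproc rho) n i) z *
     F (bproc (i%:R * mesh t n) z)).
have Gcvg (F : R -> R) (r : R) : 0 <= r -> continuous F -> bdmeas F ->
    G n (Num.trunc (r / mesh t n)) F @[n --> \oo] --> pkilled rho r F.
  by move=> r0 cF bF; exact: (@grid_expect_cvg _ _ _ P W BM 1 (fun=> 1) c1 p1 nu t rho r F t0 r0 cF bF).
have GB n i (F : R -> R) (K : R) : bdmeas F -> (forall y, `|F y| <= K) -> `|G n i F| <= K.
  move=> bF FK; apply: expect_le_bound.
    apply: (bdmeasM (bdmeas_indic _) (bdmeas_comp bF (mX _))).
    by apply: measurable_grid_ge0; exact: measurable_inner.
  move=> z; rewrite normrM indicE; case: (_ \in _).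
    by rewrite normr1 mul1r.
  by rewrite normr0 mul0r (le_trans _ (FK 0)).
have tn n : n.+1%:R * mesh t n = t by rewrite /mesh mulrCA divff ?mulr1.
have trn n : Num.trunc (t / mesh t n) = n.+1.
  by rewrite -{1}(tn n) mulfK ?gt_eqF ?mesh_gt0// natrK.
pose v n (i : nat) := expR (lam * (i.+1%:R * mesh t n)) * G n i f.
(* The extension by 0 provides the bound over all indices that [riemann_cvg] asks for. *)
pose v' n i := if (i < n.+1)%N then v n i else 0.
have := @riemann_cvg R 0 t (expR (lam * t) * B) v' (fun r => expR (lam * r) * pkilled rho r f) t0.
case.
- move=> n i; rewrite /v'; case: ltnP => ni; last by rewrite normr0 mulr_ge0// expR_ge0.
  rewrite normrM ger0_norm ?expR_ge0// ler_pM ?expR_ge0 ?GB//.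
  by rewrite ler_expR ler_wpM2l ?(ltW l0)// -[leRHS](tn n) ler_wpM2r ?(ltW (mesh_gt0 _ _))// ler_nat.
- move=> r /andP[r0 rt].
  have -> : (fun n => v' n (Num.trunc ((r - 0) / ((t - 0) / n.+1%:R)))) =
      (fun n => v n (Num.trunc (r / mesh t n))).
    apply/funext => n; rewrite !subr0 -/(mesh t n) /v' ifT//.
    have /andP[h1 _] := trunc_mesh t0 n r0.
    by rewrite -(ltr_nat R) -(ltr_pM2r (mesh_gt0 t0 n)) tn (le_lt_trans h1).
  apply: cvgM; last exact: Gcvg.
  apply: continuous_cvg; first exact: continuous_expR.
  apply: cvgM; first exact: cvg_cst.
  have -> : (fun n => (Num.trunc (r / mesh t n)).+1%:R * mesh t n) =
      (fun n => (Num.trunc (r / mesh t n))%:R * mesh t n + mesh t n).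
    by apply/funext => n; rewrite -natr1 mulrDl mul1r.
  rewrite -[X in _ --> X]addr0.
  by apply: cvgD; [exact: trunc_mesh_cvg|exact: mesh_cvg0].
move=> mf Rcvg; split => //.
apply/ler_addgt0Pr => e e0.
pose e1 := e / (expR (lam * t) * (1 + t)).
have e10 : 0 < e1 by rewrite divr_gt0// mulr_gt0 ?expR_gt0// addr_gt0.
have [s0 s00 hs] := hM e1 e10.
pose Sn n := expR (lam * t) * G n n.+1 (clamp psi) - G n 0%N (clamp psi)
  - (t - 0) / n.+1%:R * \sum_(i < n.+1) v' n i.
have Scvg : Sn n @[n --> \oo] --> expR (lam * t) * pkilled rho t (clamp psi)
    - pkilled rho 0 (clamp psi)
    - \int[mu]_(r in `[0, t]) (expR (lam * r) * pkilled rho r f).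
  apply: cvgB; last exact: Rcvg.
  apply: cvgB.
    apply: cvgM; first exact: cvg_cst.
    have -> : (fun n => G n n.+1 (clamp psi)) = (fun n => G n (Num.trunc (t / mesh t n)) (clamp psi)).
      by apply/funext => n; rewrite trn.
    by apply: Gcvg => //; exact: ltW.
  have -> : (fun n => G n 0%N (clamp psi)) = (fun n => G n (Num.trunc (0 / mesh t n)) (clamp psi)).
    by apply/funext => n; rewrite mul0r trunc0.
  exact: Gcvg.
have mc : \forall n \near \oo, mesh t n < s0 ^+ 2.
  by apply: (cvgr_lt _ (mesh_cvg0 t)); rewrite exprn_gt0.
apply: (ler_cvg_to (cvg_norm Scvg) (cvg_cst (expR (lam * t) * (M * (1 - rho)) + e))).
near=> n.
have mn : mesh t n < s0 ^+ 2 by near: n.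
have m0 := mesh_gt0 t0 n.
have chn := chain_BM BM nu 1 m0.
have := hs _ _ Q _ (Num.sqrt (mesh t n)) rho n.+1 chn.
rewrite sqrtr_gt0 m0 sqr_sqrtr ?(ltW m0)// tn => /(_ isT).
have sm : Num.sqrt (mesh t n) <= s0.
  by rewrite -(ger0_norm (ltW s00)) -sqrtr_sqr ler_wsqrtr// ltW.
move=> /(_ sm rho0 rho1).
have GE i (F F' : R -> R) : bdmeas F -> (forall y, `|y| <= 1 -> F y = F' y) ->
   \int[Q]_z (\prod_(j < i.+1) \1_(cball rho) (1 * z.1 + W (j%:R * mesh t n) z.2) *
     F (1 * z.1 + W (i%:R * mesh t n) z.2)) = G n i F'.
  move=> bF FF'; apply: eq_Rintegral => z _.
  have := prod_cball_grid W 1 p1 rho n i z t0; rewrite mulr1 => ->.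
  rewrite [bproc _ _]proc_grid// divr1 indicE.
  case: (boolP (_ \in _)); last by rewrite !mul0r.
  rewrite inE => /(_ i (leqnn i)); rewrite /inner subr_ge0 proc_grid// divr1 => y1.
  by rewrite (FF' _ (le_trans y1 rho1)).
cbv beta zeta.
have ccE y : `|y| <= 1 -> cut2 psi y = clamp psi y.
  by move=> y1; rewrite clampE// cut2E// (le_trans y1)// ler1n.
have := GE n.+1 (cut2 psi) (clamp psi) (C2_cut2 hpsi) ccE; rewrite tn => ->.
rewrite (GE 0%N (cut2 psi) (clamp psi))//; last exact: C2_cut2 hpsi.
have -> : \sum_(i < n.+1) mesh t n * (expR (lam * (i.+1%:R * mesh t n)) *
    \int[Q]_z (\prod_(j < i.+1) \1_(cball rho) (1 * z.1 + W (j%:R * mesh t n) z.2) *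
     f (1 * z.1 + W (i%:R * mesh t n) z.2))) =
   (t - 0) / n.+1%:R * \sum_(i < n.+1) v' n i.
  rewrite subr0 -/(mesh t n) mulr_sumr; apply: eq_bigr => i _.
  by rewrite (GE i f f)// /v' ltn_ord.
move=> /le_trans; apply; rewrite mulrDr lerD2l.
rewrite (_ : _ * (e1 * _) = e)// /e1.
by field; rewrite !gt_eqF// ?expR_gt0// addr_gt0.
Unshelve. all: by end_near. Qed.

(** Let rho increase to 1 in [pdynkin]: the exit error vanishes, and paths confined to closed inner
    balls exhaust survival. *)
Lemma dynkin :
  measurable_fun `[0, t[ (fun r => expR (lam * r) * killed r f) /\
  expR (lam * t) * killed t (clamp psi) = killed 0 (clamp psi) +
    \int[mu]_(r in `[0, t]) (expR (lam * r) * killed r f).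
Proof.
have [M M0 hM] := pdynkin.
have l0 := @lambda_Bm_gt0 R.
have [_ [B hB]] := bf.
have B0 : 0 <= B by rewrite (le_trans _ (hB 0)).
(* The offset 2 keeps the radius positive at k = 0. *)
pose rho k : R := 1 - k.+2%:R^-1.
have rho0 k : 0 < rho k by rewrite subr_gt0 invf_lt1// ltr1n.
have rho1 k : rho k <= 1 by rewrite lerBlDr lerDl.
have kc (r : R) F : 0 <= r -> bdmeas F -> pkilled (rho k) r F @[k --> \oo] --> killed r F.
  move=> r0 bF; have := pkilled_cvg r0 bF.
  by rewrite -(cvg_shiftS (fun k => pkilled (1 - k.+1%:R^-1) r F)).
pose q k r := expR (lam * r) * pkilled (rho k) r f.
pose q' r := expR (lam * r) * killed r f.
have mq k : measurable_fun `[0, t[ (q k) by have [] := hM _ (rho0 k) (rho1 k).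
have qc (r : R) : 0 <= r < t -> q k r @[k --> \oo] --> q' r.
  by move=> /andP[r0 rt]; apply: cvgM; [exact: cvg_cst|exact: kc].
split; first exact: (measurable_fun_cvg (h := q)).
have Ic : (\int[mu]_(r in `[0, t]) q k r) @[k --> \oo] --> \int[mu]_(r in `[0, t]) q' r.
  apply: (@Rintegral_itv_cvg R 0 t (expR (lam * t) * B)) => // k r /andP[r0 rt].
  rewrite normrM ger0_norm ?expR_ge0// ler_pM ?expR_ge0//.
    by rewrite ler_expR ler_wpM2l ?(ltW l0)// ltW.
  apply: expect_le_bound.
    apply: (bdmeasM (bdmeas_indic _) (bdmeas_comp bf (mX _))).
    exact: measurable_path_inner.
  move=> z; rewrite normrM indicE; case: (_ \in _).
    by rewrite normr1 mul1r.
  by rewrite normr0 mul0r (le_trans _ (hB 0)).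
pose D k := expR (lam * t) * pkilled (rho k) t (clamp psi) - pkilled (rho k) 0 (clamp psi)
  - \int[mu]_(r in `[0, t]) q k r.
pose D' := expR (lam * t) * killed t (clamp psi) - killed 0 (clamp psi)
  - \int[mu]_(r in `[0, t]) q' r.
have Dc : D k @[k --> \oo] --> D'.
  apply: cvgB; last exact: Ic.
  apply: cvgB; last exact: kc.
  by apply: cvgM; [exact: cvg_cst|apply: kc => //; exact: ltW].
have D0 : D k @[k --> \oo] --> (0 : R).
  apply/cvgr0Pnorm_le => e e0.
  pose E := expR (lam * t) * M + 1.
  have E0 : 0 < E by rewrite ltr_wpDl// mulr_ge0// expR_ge0.
  have e1 : 0 < e / E by rewrite divr_gt0.
  have hc : harmonic k.+1 @[k --> \oo] --> (0 : R).
    by have := @cvg_harmonic R; rewrite -(cvg_shiftS (@harmonic R)).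
  have hk : \forall k \near \oo, harmonic k.+1 < e / E by exact: (cvgr_lt _ hc).
  apply: filterS hk => k; rewrite /harmonic/= => ke.
  have [_ h] := hM _ (rho0 k) (rho1 k).
  apply: (le_trans h); rewrite /rho subKr.
  apply: (@le_trans _ _ (E * k.+2%:R^-1)).
    by rewrite mulrA ler_wpM2r ?invr_ge0// lerDl.
  by rewrite mulrC -ler_pdivlMr// ltW.
have := cvg_unique _ Dc D0.
by rewrite /D' => h; apply/eqP; rewrite -subr_eq0 opprD addrA; apply/eqP; exact: h.
Qed.

End dynkin_formula.
End killed_brownian_motion.

Lemma bdmeas_continuous {R : realType} (f : R -> R) : continuous f ->
  (exists M, forall x, `|f x| <= M) -> bdmeas f.
Proof. by move=> cf fM; split => //; exact: continuous_measurable_fun. Qed.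

Lemma bdmeas_phi {R : realType} : bdmeas (@phi R).
Proof.
apply: bdmeas_continuous; first exact: continuous_phi.
by exists 1 => x; exact: phi_le1.
Qed.

Lemma probability_gt0 {R : realType} (nu : probability R R) (F : R -> R) :
  nu `]-1, 1[%classic = 1%E -> bdmeas F -> (forall x, 0 <= F x) ->
  (forall x, `|x| < 1 -> 0 < F x) -> 0 < \int[nu]_x F x.
Proof.
move=> nu1 bF F0 Fp; rewrite lt_neqAle Rintegral_ge0// andbT eq_sym; apply/eqP => I0.
have mF : measurable_fun setT (EFin \o F) by apply/measurable_EFinP; case: bF.
have : (\int[nu]_x `|(EFin \o F) x|)%E = 0%E.
  under eq_integral do rewrite gee0_abs ?lee_fin//.
  by rewrite expectE// I0.
move=> /(ae_eq_integral_abs nu measurableT mF)[N [mN N0 hN]].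
have : (nu `](-1)%R, 1%R[%classic <= nu N)%E.
  apply: le_measure; [by rewrite inE; exact: measurable_itv|by rewrite inE|].
  move=> x; rewrite /= in_itv/= -ltr_norml => x1; apply: hN => /= /(_ I) [Fx].
  by have := Fp x x1; rewrite Fx ltxx.
by rewrite nu1 N0 lee_fin ler10.
Qed.

(** * The killed semigroup and the ground state *)

Section quasi_stationary.
Context {R : realType} {d : measure_display} {Omega : measurableType d}.
Variables (P : probability Omega R) (W : R -> Omega -> R).
Hypothesis BM : is_std_BM P W.
Local Notation lam := (@lambda_Bm R).
Local Notation mu := (@lebesgue_measure R).
Local Notation bproc := (bproc W).

Let c1 : continuous (fun _ : R => 1 : R). Proof. by move=> r; exact: cvg_cst. Qed.
Let p1 (r : R) : 0 < (fun _ : R => 1 : R) r. Proof. exact: ltr01. Qed.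
Let mX r : measurable_fun setT (bproc r). Proof. exact: measurable_proc BM _ _ _. Qed.
Let cX z : continuous (bproc ^~ z).
Proof. exact: (@continuous_proc _ _ _ P W BM 1 (fun=> 1) c1 p1 z). Qed.
Let X0 z : bproc 0 z = z.1. Proof. exact: (@proc0 _ _ _ P W BM 1 (fun=> 1) p1 erefl z). Qed.

Lemma bprocE r x w : 0 <= r -> bproc r (x, w) = x + W r w.
Proof. by move=> r0; rewrite /bproc /proc divr1 mul1r (max_idPl r0). Qed.

Lemma survBE x t : 0 <= t -> survB W x t = xsection (avoid bproc t) x.
Proof.
move=> t0; apply/seteqP; split => w; rewrite /xsection/=.
  rewrite inE /survB/= /tauB => h.
  have /(inf_hit_gtP (a := 0) (h := fun r => `|bproc r (x, w)|)) := h; apply => //.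
    by move=> r; apply: continuous_cvg; [exact: norm_continuous|exact: cX].
  by move=> r; cbv beta; split => -[r0 hr]; split=> //; move: hr; rewrite bprocE.
rewrite inE /survB/= /tauB => h.
apply/(inf_hit_gtP (a := 0) (h := fun r => `|bproc r (x, w)|)) => //.
  by move=> r; apply: continuous_cvg; [exact: norm_continuous|exact: cX].
by move=> r; cbv beta; split => -[r0 hr]; split=> //; move: hr; rewrite bprocE.
Qed.

Lemma measurable_survB t : 0 <= t -> measurable_fun setT (fun x => P (survB W x t)).
Proof.
move=> t0; under eq_fun do rewrite survBE//.
by apply: measurable_fun_xsection; exact: measurable_avoid.
Qed.

Section start.
Variable nu : probability R R.
Hypothesis nu1 : nu `]-1, 1[%classic = 1%E.
Local Notation Q := (prodp nu P).
Local Notation killed := (killed P W nu).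

Lemma killed_avoid t (F : R -> R) : 0 <= t -> bdmeas F ->
  \int[Q]_z (\1_(avoid bproc t) z * F (bproc t z)) = killed t F.
Proof.
move=> t0 bF; apply: (expect_inside nu1).
- apply: (bdmeasM (bdmeas_indic _) (bdmeas_comp bF (mX _))).
  exact: measurable_avoid.
- exact: (bdmeas_killed BM).
move=> z z1; congr (_ * _); rewrite !indicE; congr ((_ : bool)%:R).
have z0 : `|bproc 0 z| < 1 by rewrite X0.
by apply/idP/idP; rewrite !inE => /(avoid_survP cX t0 z0).
Qed.

Lemma killed0 (F : R -> R) : bdmeas F -> killed 0 F = \int[nu]_x F x.
Proof.
move=> bF; have bF1 : bdmeas (fun z : R * Omega => F z.1).
  by apply: bdmeas_comp bF _; exact: measurable_fst.
transitivity (\int[Q]_z F z.1).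
  apply: (expect_inside nu1) => //; first exact: (bdmeas_killed BM).
  move=> z z1; rewrite X0 indicE mem_set ?mul1r// => r /andP[r0 r1].
  by rewrite (_ : r = 0) ?X0//; apply/eqP; rewrite eq_le r0 r1.
by rewrite expect_prod//; apply: eq_Rintegral => x _ /=; rewrite expect_cst.
Qed.

Lemma eq_killed t (F G : R -> R) : 0 <= t -> (forall x, `|x| < 1 -> F x = G x) ->
  killed t F = killed t G.
Proof.
move=> t0 FG; apply: eq_Rintegral => z _; rewrite indicE.
case: (boolP (z \in _)); last by rewrite !mul0r.
by rewrite inE => /(_ t); rewrite t0 lexx => /(_ isT) /FG ->.
Qed.

Lemma integral_survB t : 0 <= t ->
  (\int[nu]_x P (survB W x t))%E = (killed t (fun=> 1))%:E.
Proof.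
move=> t0; rewrite -killed_avoid//; last exact: bdmeas_cst.
under eq_integral do rewrite survBE//.
rewrite integral_measure_xsection; last exact: measurable_avoid.
by congr EFin; apply: eq_Rintegral => z _; rewrite mulr1.
Qed.

Lemma integral_survB_at t (A : set R) : 0 <= t -> measurable A ->
  (\int[nu]_x P ([set w | A (x + W t w)%R] `&` survB W x t))%E =
  (killed t \1_A)%:E.
Proof.
move=> t0 mA; rewrite -killed_avoid//; last exact: (bdmeas_indic mA).
have mD : measurable (bproc t @^-1` A `&` avoid bproc t).
  apply: measurableI; last exact: measurable_avoid.
  by rewrite -[X in measurable X]setTI; exact: mX.
rewrite (eq_integral (fun x => P (xsection (bproc t @^-1` A `&` avoid bproc t) x))); last first.
  move=> x _; congr (P _); rewrite survBE//; apply/seteqP; split => w; rewrite /xsection/= !inE/=.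
    by rewrite bprocE.
  by rewrite bprocE.
rewrite integral_measure_xsection//.
congr EFin; apply: eq_Rintegral => z _.
by rewrite mulrC indicI.
Qed.

(** [dynkin] with psi = [phi] and f = 0. *)
Lemma killed_phi t : 0 <= t -> killed t phi = expR (- (lam * t)) * \int[nu]_x phi x.
Proof.
rewrite le_eqVlt => /predU1P[<-|t0].
  by rewrite killed0 ?mulr0 ?oppr0 ?expR0 ?mul1r//; exact: bdmeas_phi.
have hphi : C2_near phi (fun x : R => - (pi / 2) * sin (pi / 2 * x))
    (fun x => 2 * (fun=> 0) x - (pi / 2) ^+ 2 * phi x).
  have -> : (fun x : R => 2 * (fun=> 0) x - (pi / 2) ^+ 2 * phi x) = (fun x => - (pi / 2) ^+ 2 * phi x).
    by apply/funext => x; rewrite mulr0 sub0r mulNr.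
  exact: phi_C2.
have phiN1 : phi (- 1 : R) = 0 by rewrite phiN phi1.
have [_] := dynkin BM nu t0 (fun=> cvg_cst _) (bdmeas_cst 0) hphi phiN1 phi1.
have pc (x : R) : `|x| < 1 -> clamp phi x = phi x by move=> x1; rewrite clampE// ltW.
rewrite (eq_killed (ltW t0) pc) (eq_killed (lexx 0) pc) killed0; last exact: bdmeas_phi.
have k0 r : killed r (fun=> 0) = 0.
  rewrite -[RHS](expect_cst Q); apply: eq_Rintegral => z _; exact: mulr0.
have -> : \int[mu]_(r in `[0, t]) (expR (lam * r) * killed r (fun=> 0)) = 0.
  rewrite -[RHS](mul0r (fine (mu `[0, t]%classic))) -Rintegral_cst//.
  by apply: eq_Rintegral => r _; rewrite k0 mulr0.
by rewrite addr0 => <-; rewrite mulrA -expRD addNr expR0 mul1r.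
Qed.

End start.
End quasi_stationary.

(** * Limits of functions with bounded integrals *)

Section mean_bounded.
Context {R : realType}.
Local Notation mu := (@lebesgue_measure R).
Variables (h : R -> R) (H K : R).
Hypothesis mh : forall t : R, 0 < t -> measurable_fun `[0, t[ h.
Hypothesis hH : forall r, 0 <= r -> `|h r| <= H.

Lemma bounded_itv_integrable (t : R) : 0 < t -> mu.-integrable `[0, t[ (EFin \o h).
Proof.
move=> t0; apply: measurable_bounded_integrable => //.
- by rewrite [X in (X < _)%E]lebesgue_measure_itv/= lte_fin t0 -EFinB ltry.
- exact: mh.
- exists H; split; rewrite ?num_real // => x Hx y; rewrite /= in_itv/= => /andP[y0 _].
  exact: le_trans (hH y0) (ltW Hx).
Qed.

(** A positive limit would make the integrals grow linearly. *)
Lemma mean_le0 (l : R) : h r @[r --> +oo] --> l ->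
  (forall t, 0 < t -> \int[mu]_(r in `[0, t]) h r <= K) -> l <= 0.
Proof.
move=> hl hK; rewrite leNgt; apply/negP => l0.
have [T [Treal hT]] : \forall r \near +oo, l / 2 < h r.
  by apply: (cvgr_gt _ hl); rewrite ltr_pdivrMr// mulr_natr mulr2n ltrDl.
pose T0 := Num.max T 0 + 1.
have T00 : 0 < T0 by rewrite ltr_pwDr// le_max lexx orbT.
have H0 : 0 <= H by rewrite (le_trans _ (hH (lexx 0))).
pose C := H + l / 2.
have C0 : 0 <= C by rewrite addr_ge0// divr_ge0// ltW.
pose g r := l / 2 - C * \1_(`[0, T0]%classic) r.
have gh r : 0 <= r -> g r <= h r.
  move=> r0; rewrite /g indicE; case: (boolP (r \in _)).
    move=> _; rewrite mulr1 /C opprD addrCA subrr addr0.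
    by have := hH r0; rewrite ler_norml => /andP[].
  rewrite notin_setE /= in_itv/= r0/= => /negP; rewrite -ltNge => rT.
  rewrite mulr0 subr0 ltW// hT// (lt_trans _ rT)//.
  by rewrite (@le_lt_trans _ _ (Num.max T 0)) ?le_max ?lexx// ltrDl.
(* At this time the integral of the minorant [g], namely (l / 2) t - C T0, already exceeds [K]. *)
pose t := T0 + (`|K| + C * T0 + 1) / (l / 2).
have l20 : 0 < l / 2 by rewrite divr_gt0.
have Tt : T0 < t by rewrite ltrDl divr_gt0// ltr_wpDl// addr_ge0// mulr_ge0// ltW.
have t0 : 0 < t by exact: lt_trans Tt.
have fin : (mu `[0%R, t[%classic < +oo)%E.
  by rewrite [X in (X < _)%E]lebesgue_measure_itv/= lte_fin t0 -EFinB ltry.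
have bI : bdmeas (\1_(`[0, T0]%classic) : R -> R) by apply: bdmeas_indic; exact: measurable_itv.
have ib (F : R -> R) : bdmeas F -> mu.-integrable `[0, t[ (EFin \o F).
  move=> [mF [M hM]]; apply: measurable_bounded_integrable => //.
    exact: measurable_funTS.
  by exists M; split; rewrite ?num_real // => x Hx y _; exact: le_trans (hM y) (ltW Hx).
have bg : bdmeas g by apply: bdmeasB; [exact: bdmeas_cst|exact: bdmeasZ].
have tE : fine (mu `[0%R, t[%classic) = t.
  by rewrite [X in fine X]lebesgue_measure_itv/= lte_fin t0 -EFinB subr0.
have Ig : \int[mu]_(r in `[0, t[) g r = l / 2 * t - C * T0.
  rewrite /g RintegralB//; [|apply: ib; exact: bdmeas_cst|apply: ib; exact: bdmeasZ].
  rewrite Rintegral_cst// tE; congr (_ - _).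
  rewrite RintegralZl//; last exact: ib.
  congr (_ * _); rewrite /Rintegral integral_indic//.
  rewrite setIidl; last first.
    by move=> r; rewrite /= !in_itv/= => /andP[-> /le_lt_trans ->].
  by rewrite [X in fine X]lebesgue_measure_itv/= lte_fin T00 -EFinB subr0.
have := hK t t0; apply/negP; rewrite -ltNge.
rewrite -(Rintegral_itv_bndo_bndc (bounded_itv_integrable t0)).
apply: (@lt_le_trans _ _ (\int[mu]_(r in `[0, t[) g r)); last first.
  apply: le_Rintegral => //; first exact: ib.
    exact: bounded_itv_integrable.
  by move=> r; rewrite /= in_itv/= => /andP[r0 _]; exact: gh.
rewrite Ig /t mulrDr mulrCA divff ?gt_eqF// mulr1.
have := ler_norm K; have : 0 < l / 2 * T0 by rewrite mulr_gt0.
lra.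
Qed.

End mean_bounded.

(** * Identification of alpha, eta and beta through the ground state *)

Section quasi_stationary_identification.
Context {R : realType} {d : measure_display} {Omega : measurableType d}.
Variables (P : probability Omega R) (W : R -> Omega -> R).
Hypothesis BM : is_std_BM P W.
Local Notation lam := (@lambda_Bm R).
Local Notation mu := (@lebesgue_measure R).

Definition phi_int (F : R -> R) : R := \int[mu]_(y in `[-1, 1]) (phi y * F y).

Let cint (F : R -> R) : continuous F -> mu.-integrable `[-1, 1] (EFin \o (fun y => phi y * F y)).
Proof.
move=> cF; apply: continuous_compact_integrable; first exact: segment_compact.
apply: continuous_subspaceT => x.
by apply: cvgM; [exact: continuous_phi|exact: cF].
Qed.

Lemma phi_int_comb (a b : R) (F G : R -> R) : continuous F -> continuous G ->
  phi_int (fun y => a * F y - b * G y) = a * phi_int F - b * phi_int G.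
Proof.
move=> cF cG; rewrite /phi_int -!RintegralZl//; [|exact: cint|exact: cint].
rewrite -RintegralB//; [|exact: (integrableZl _ a (cint cF))|exact: (integrableZl _ b (cint cG))].
by apply: eq_Rintegral => y _; ring.
Qed.

Section start.
Variable nu : probability R R.
Local Notation Q := (prodp nu P).

Lemma killed_comb t (a b : R) (F G : R -> R) : 0 <= t -> bdmeas F -> bdmeas G ->
  killed P W nu t (fun y => a * F y - b * G y) =
  a * killed P W nu t F - b * killed P W nu t G.
Proof.
move=> t0 bF bG; have bkF := bdmeas_killed BM t0 bF; have bkG := bdmeas_killed BM t0 bG.
rewrite /killed -!expectZ// -expectB//; [|exact: bdmeasZ|exact: bdmeasZ].
by apply: eq_Rintegral => z _; ring.
Qed.

Lemma le_killed t (F G : R -> R) : 0 <= t -> bdmeas F -> bdmeas G ->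
  (forall x, `|x| < 1 -> F x <= G x) -> killed P W nu t F <= killed P W nu t G.
Proof.
move=> t0 bF bG FG; apply: le_expect; [exact: (bdmeas_killed BM)|exact: (bdmeas_killed BM)|].
move=> z; rewrite indicE; case: (boolP (z \in _)); last by rewrite !mul0r.
rewrite inE => /(_ t); rewrite t0 lexx => /(_ isT) /FG h.
by rewrite !mul1r.
Qed.

End start.

Section qsd.
Variable alpha : probability R R.
Hypothesis hq : is_QSD_Bm P W alpha.
Local Notation Q := (prodp alpha P).
Local Notation killed := (killed P W alpha).

Let a1 : alpha `]-1, 1[%classic = 1%E. Proof. by case: hq. Qed.

Lemma qsd_killed_indic t (A : set R) : 0 <= t -> measurable A ->
  killed t \1_A = killed t (fun=> 1) * fine (alpha A).
Proof.
move=> t0 mA; have aE : (fine (alpha A))%:E = alpha A by rewrite fineK// fin_num_measure.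
have [_ /(_ t t0 A mA)[_]] := hq.
rewrite integral_survB// integral_survB_at// => h.
have : (killed t \1_A)%:E = (fine (alpha A) * killed t (fun=> 1))%:E.
  by rewrite h EFinM aE.
by move=> [->]; rewrite mulrC.
Qed.

(** Quasi-stationarity says that the sub-probability law at time t is a multiple of alpha as a
    measure; comparing integrals extends it from sets to functions. *)
Lemma qsd_killed t (F : R -> R) : 0 <= t -> bdmeas F ->
  killed t F = killed t (fun=> 1) * \int[alpha]_x F x.
Proof.
move=> t0.
have mX := measurable_proc BM 1 (fun=> 1) t.
have k0 : 0 <= killed t (fun=> 1).
  by apply: Rintegral_ge0 => z _; rewrite mulr1 indicE; case: (_ \in _).
have pos (G : R -> R) : bdmeas G -> (forall x, 0 <= G x) ->
    killed t G = killed t (fun=> 1) * \int[alpha]_x G x.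
  move=> bG G0.
  have bS : bdmeas (\1_(surv (bproc W) t) : R * Omega -> R).
    have := bdmeas_killed BM t0 (bdmeas_cst 1).
    by under eq_fun do rewrite mulr1.
  have S0 z : 0 <= \1_(surv (bproc W) t) z :> R by rewrite indicE; case: (_ \in _).
  pose m := wlaw Q bS S0 mX.
  have e1 : (\int[m]_x (G x)%:E = (killed t G)%:E)%E.
    rewrite expect_wlaw//; congr EFin; apply: eq_Rintegral => z _.
    by rewrite mulrC.
  have e2 : (\int[m]_x (G x)%:E = \int[mscale (NngNum k0) alpha]_x (G x)%:E)%E.
    apply: eq_measure_integral => A mA _.
    rewrite -[LHS]/(wlaw Q bS S0 mX A) wlawE// /mscale/=.
    transitivity ((killed t \1_A)%:E).
      rewrite -expectE; last by apply: (bdmeas_killed BM) => //; exact: (bdmeas_indic mA).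
      by apply: eq_integral => z _; rewrite mulrC.
    by rewrite qsd_killed_indic// EFinM (fineK (fin_num_measure alpha A mA)).
  have : (killed t G)%:E = (killed t (fun=> 1) * \int[alpha]_x G x)%:E.
    rewrite -e1 e2 ge0_integral_mscale//; last 2 first.
    - by apply/measurable_EFinP; case: bG.
    - by move=> x _; rewrite lee_fin.
    by rewrite expectE// -EFinM.
  by case.
move=> bF; have [_ [M hM]] := bF.
have M0 : 0 <= M by rewrite (le_trans _ (hM 0)).
have FE : F = (fun x => 1 * (F x + M) - M * (fun=> 1) x).
  by apply/funext => x; ring.
have bFM : bdmeas (fun x => F x + M) by apply: bdmeasD => //; exact: bdmeas_cst.
rewrite {1}FE killed_comb//; last exact: bdmeas_cst.
rewrite pos//; last by move=> x; have := hM x; rewrite ler_norml => /andP[? _]; lra.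
rewrite expectD//; last exact: bdmeas_cst.
by rewrite expect_cst; ring.
Qed.

Lemma qsd_phi_gt0 : 0 < \int[alpha]_x phi x.
Proof.
have bp : bdmeas (fun x : R => Num.max (phi x) 0).
  have [mp _] := @bdmeas_phi R; split; first exact: measurable_maxr.
  by exists 1 => x; rewrite ger0_norm ?le_max ?lexx ?orbT// ge_max ler01 andbT (le_trans (ler_norm _))// phi_le1.
rewrite (expect_inside1 a1 bdmeas_phi bp); last first.
  by move=> x x1; apply/esym/max_idPl; rewrite phi_ge0// ltW.
apply: probability_gt0 => // x.
  by rewrite le_max lexx orbT.
by move=> x1; rewrite lt_max phi_gt0.
Qed.

(** The rate is read off by testing against [phi]: its killed mean decays like exp(- lambda t) by
    [killed_phi], and alpha gives it positive mass. *)
Lemma qsd_decay t : 0 <= t -> killed t (fun=> 1) = expR (- (lam * t)).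
Proof.
move=> t0; have := qsd_killed t0 bdmeas_phi; rewrite (killed_phi BM a1)// => /esym.
by apply: mulIf; rewrite gt_eqF// qsd_phi_gt0.
Qed.

(** Solve the resolvent equation for f. Under alpha, exp(lambda t) times the killed mean of a
    function is constant in t, so in [dynkin] the two psi terms cancel and the integral of the
    constant alpha(f) over [0, 1] is 0. *)
Lemma qsd_zero (f : R -> R) : continuous f -> bdmeas f -> phi_int f = 0 ->
  \int[alpha]_x f x = 0.
Proof.
move=> cf bf f0; have [psi [psi1 [hpsi pN p1]]] := ode cf f0.
have [_] := dynkin BM alpha ltr01 cf bf hpsi pN p1.
have bp := bdmeas_clamp hpsi.
rewrite (qsd_killed ler01 bp) (killed0 BM a1 bp) qsd_decay// mulrA -expRD subrr expR0 mul1r.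
have -> : \int[mu]_(r in `[0, 1]) (expR (lam * r) * killed r f) =
    \int[mu]_(r in `[0, 1]) (\int[alpha]_x f x).
  apply: eq_Rintegral => r; rewrite inE/= in_itv/= => /andP[r0 _].
  by rewrite (qsd_killed r0 bf) qsd_decay// mulrA -expRD subrr expR0 mul1r.
rewrite Rintegral_cst// [X in fine X]lebesgue_measure_itv/= lte_fin ltr01 -EFinB subr0/= mulr1.
by move=> /eqP; rewrite -subr_eq0 opprD addrA subrr sub0r oppr_eq0 => /eqP.
Qed.

(** [qsd_zero] applied to F minus its component along [phi]; with F = 1 this identifies alpha as the
    normalised [phi] dx. *)
Lemma qsd_phi_int (F : R -> R) : continuous F -> bdmeas F ->
  phi_int phi * \int[alpha]_x F x = phi_int F * \int[alpha]_x phi x.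
Proof.
move=> cF bF.
have cp := @continuous_phi R; have bp := @bdmeas_phi R.
have /qsd_zero : continuous (fun y => phi_int phi * F y - phi_int F * phi y).
  move=> y; apply: cvgB; apply: cvgM; [exact: cvg_cst|exact: cF|exact: cvg_cst|exact: cp].
have bz : bdmeas (fun y => phi_int phi * F y - phi_int F * phi y).
  by apply: bdmeasB; exact: bdmeasZ.
move=> /(_ bz); rewrite phi_int_comb// mulrC subrr => /(_ erefl).
rewrite expectB ?expectZ//; [|exact: bdmeasZ|exact: bdmeasZ].
by move/eqP; rewrite subr_eq0 => /eqP.
Qed.

(** Otherwise [qsd_zero] would give [phi] mean 0 under alpha. *)
Lemma phi_int_phi_neq0 : phi_int phi != 0.
Proof.
apply/eqP => h; have := qsd_phi_gt0.
by rewrite (qsd_zero (@continuous_phi R) bdmeas_phi h) ltxx.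
Qed.

End qsd.

(** Take f = c - c0 phi orthogonal to [phi], with psi solving the resolvent equation. Then
    exp(lambda r) times the killed mean of f converges to c e - c0 phi(x). Its integrals stay
    bounded by [dynkin], as |psi| <= A phi and [phi] decays exactly at rate lambda. A convergent
    function with bounded integrals has limit 0. *)
Lemma eta_phi_int (alpha : probability R R) (x e : R) : is_QSD_Bm P W alpha -> `|x| < 1 ->
  (expR (lam * t) * fine (P (survB W x t))) @[t --> +oo] --> e ->
  e * phi_int phi = phi_int (fun=> 1) * phi x.
Proof.
move=> hq x1 he.
have Iphi := phi_int_phi_neq0 hq.
pose nu : probability R R := \d_x.
have nu1 : nu `]-1, 1[%classic = 1%E.
  by rewrite /nu/= diracE mem_set//= in_itv/= -ltr_norml.
have enu (F : R -> R) : bdmeas F -> \int[nu]_y F y = F x.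
  move=> [mF _]; rewrite /Rintegral integral_dirac//; last exact/measurable_EFinP.
  by rewrite diracT mul1e.
pose c := phi_int (@phi R); pose c0 := phi_int (fun=> 1).
have cone : continuous (fun _ : R => 1 : R) by move=> y; exact: cvg_cst.
have bone : bdmeas (fun _ : R => 1 : R) by exact: bdmeas_cst.
have cp := @continuous_phi R; have bp := @bdmeas_phi R.
pose f y := c * 1 - c0 * phi y.
have cf : continuous f.
  by move=> y; apply: cvgB; first exact: cvg_cst; apply: cvgM; [exact: cvg_cst|exact: cp].
have bf : bdmeas f by apply: bdmeasB; exact: bdmeasZ.
have f0 : phi_int f = 0.
  by rewrite (phi_int_comb c c0 cone cp) mulrC subrr.
have [psi [psi1 [hpsi pN p1]]] := ode cf f0.
have [A A0 hA] := C2_vanish_le_phi hpsi pN p1.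
have bpsi := bdmeas_clamp hpsi.
pose h r := expR (lam * r) * killed P W nu r f.
pose a r := expR (lam * r) * killed P W nu r (fun=> 1).
have hE (r : R) : 0 <= r -> h r = c * a r - c0 * phi x.
  move=> r0; rewrite /h (killed_comb _ _ _ r0 bone bp) (killed_phi BM nu1 r0) enu//.
  have e1 : expR (lam * r) * expR (- (lam * r)) = 1 by rewrite -expRD subrr expR0.
  rewrite (_ : _ * _ = c * a r - c0 * (expR (lam * r) * expR (- (lam * r)) * phi x)).
    by rewrite e1 mul1r.
  by rewrite /a; ring.
have ac : a r @[r --> +oo] --> e.
  apply: cvg_trans he; apply: near_eq_cvg; near=> r.
  have r0 : 0 <= r by near: r; exact: nbhs_pinfty_ge.
  have := integral_survB BM nu1 r0; rewrite /nu integral_dirac//; last first.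
    exact: (measurable_survB BM r0).
  by rewrite diracT mul1e /a => ->.
have hc : h r @[r --> +oo] --> c * e - c0 * phi x.
  apply: cvg_trans (_ : (c * a r - c0 * phi x) @[r --> +oo] --> _).
    by apply: near_eq_cvg; near=> r; rewrite hE.
  apply: cvgB; last exact: cvg_cst.
  by apply: cvgM; first exact: cvg_cst.
have k1 (r : R) : 0 <= r -> 0 <= killed P W nu r (fun=> 1) <= 1.
  move=> r0; apply/andP; split.
    by apply: Rintegral_ge0 => z _; rewrite mulr1 indicE; case: (_ \in _).
  rewrite -[leRHS](expect_cst (prodp nu P)); apply: le_expect.
  - exact: (bdmeas_killed BM r0 bone).
  - exact: bdmeas_cst.
  - by move=> z; rewrite mulr1 indicE; case: (_ \in _).
have l0 := @lambda_Bm_gt0 R.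
(* Convergence bounds [h] near infinity; before that, survival probabilities are at most 1. *)
have [H hH] : exists H : R, forall r : R, 0 <= r -> `|h r| <= H.
  have [T [_ hT]] : \forall r \near +oo, `|e - a r| < 1.
    by move/cvgrPdist_lt : ac; apply.
  exists (`|c| * (expR (lam * `|T|) + (`|e| + 1)) + `|c0 * phi x|) => r r0.
  rewrite hE// (le_trans (ler_normB _ _))// lerD2r normrM ler_wpM2l//.
  have [rT|Tr] := leP r T.
    rewrite (@le_trans _ _ (expR (lam * `|T|)))// ?lerDl ?addr_ge0//.
    have /andP[q0 q1] := k1 r r0.
    rewrite ger0_norm ?mulr_ge0 ?expR_ge0// -[leRHS]mulr1 ler_pM ?expR_ge0//.
    by rewrite ler_expR ler_wpM2l ?(ltW l0)// (le_trans rT)// ler_norm.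
  rewrite (@le_trans _ _ (`|e| + 1))// ?lerDr ?expR_ge0//.
  rewrite -[a r](subKr e) (le_trans (ler_normB _ _))// lerD2l ltW//.
  exact: hT.
have hD (t : R) : 0 < t -> measurable_fun `[0, t[ h /\
    expR (lam * t) * killed P W nu t (clamp psi) =
    clamp psi x + \int[mu]_(r in `[0, t]) h r.
  move=> t0; have [mh E] := dynkin BM nu t0 cf bf hpsi pN p1; split => //.
  by rewrite E (killed0 BM nu1 bpsi) enu.
have hB (t : R) : 0 < t -> `|expR (lam * t) * killed P W nu t (clamp psi)| <= A * phi x.
  move=> t0; have t00 := ltW t0.
  have kphi (b : R) : expR (lam * t) * killed P W nu t (fun y => b * phi y - 0 * phi y) = b * phi x.
    rewrite (killed_comb _ _ _ t00 bp bp) mul0r subr0 (killed_phi BM nu1 t00) enu//.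
    rewrite (_ : _ * _ = b * phi x * (expR (lam * t) * expR (- (lam * t)))); last by ring.
    by rewrite -expRD subrr expR0 mulr1.
  have bA (b : R) : bdmeas (fun y => b * phi y - 0 * phi y : R) by apply: bdmeasB; exact: bdmeasZ.
  have cA (y : R) : `|y| < 1 -> `|clamp psi y| <= A * phi y.
    by move=> /ltW y1; rewrite clampE//; exact: hA.
  rewrite ler_norml; apply/andP; split.
    rewrite -mulNr -kphi ler_wpM2l ?expR_ge0//.
    apply: (@le_killed nu t _ _ t00 (bA (- A)) bpsi) => y /cA.
    by rewrite mul0r subr0 mulNr ler_norml => /andP[].
  rewrite -kphi ler_wpM2l ?expR_ge0//.
  apply: (@le_killed nu t _ _ t00 bpsi (bA A)) => y /cA.
  by rewrite mul0r subr0 ler_norml => /andP[].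
have hI (t : R) : 0 < t -> `|\int[mu]_(r in `[0, t]) h r| <= A * phi x + `|clamp psi x|.
  move=> t0; have [_ E] := hD t t0.
  rewrite (_ : \int[mu]_(r in _) _ = expR (lam * t) * killed P W nu t (clamp psi) - clamp psi x).
    by rewrite (le_trans (ler_normB _ _))// lerD2r hB.
  by rewrite E addrAC subrr add0r.
have mh (t : R) : 0 < t -> measurable_fun `[0, t[ h by move=> /hD[].
have le1 : c * e - c0 * phi x <= 0.
  apply: (mean_le0 mh hH hc) => t t0.
  exact: le_trans (ler_norm _) (hI t t0).
have le2 : - (c * e - c0 * phi x) <= 0.
  apply: (@mean_le0 _ (fun r => - h r) H (A * phi x + `|clamp psi x|)).
  - by move=> t t0; apply: measurable_funN; exact: mh.
  - by move=> r r0; rewrite normrN hH.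
  - exact: cvgN.
  - move=> t t0.
    have -> : \int[mu]_(r in `[0, t]) - h r = - \int[mu]_(r in `[0, t]) h r.
      have iN : mu.-integrable `[0, t[ (EFin \o (fun r => - h r)).
        apply: (@bounded_itv_integrable _ _ H) => //.
          by move=> u u0; apply: measurable_funN; exact: mh.
        by move=> r r0; rewrite normrN hH.
      have ih := bounded_itv_integrable mh hH t0.
      rewrite -(Rintegral_itv_bndo_bndc iN) -(Rintegral_itv_bndo_bndc ih).
      rewrite -mulN1r -RintegralZl//.
      by apply: eq_Rintegral => r _; rewrite mulN1r.
    by rewrite (le_trans (ler_norm _))// normrN hI.
have /eqP : c * e - c0 * phi x == 0 by rewrite eq_le le1 -oppr_le0 le2.
by move/eqP; rewrite subr_eq0 => /eqP <-; rewrite mulrC.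
Unshelve. all: by end_near. Qed.

(** alpha and eta both being proportional to [phi], beta is the normalised [phi]^2 dx. *)
Lemma qsd_eta_integral (alpha : probability R R) (eta f : R -> R) : is_QSD_Bm P W alpha ->
  (forall x : R, `]-1, 1[%classic x ->
     (expR (lam * t) * fine (P (survB W x t))) @[t --> +oo] --> eta x) ->
  continuous f -> bdmeas f ->
  Rintegral alpha `]-1, 1[%classic (fun x => f x * eta x) =
  phi_int (fun y => f y * phi y) / phi_int phi.
Proof.
move=> hq heta cf bf; have [a1 _] := hq.
have cp := @continuous_phi R; have bp := @bdmeas_phi R.
have I0 := phi_int_phi_neq0 hq.
have etaE x : `|x| < 1 -> eta x = phi_int (fun=> 1) / phi_int phi * phi x.
  move=> x1; have xi : `](-1)%R, 1%R[%classic x by rewrite /= in_itv/= -ltr_norml.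
  have := eta_phi_int hq x1 (heta x xi) => h.
  by rewrite mulrAC -h mulfK.
pose c := phi_int (fun=> 1) / phi_int (@phi R).
pose g x := c * (f x * phi x).
have bfp : bdmeas (fun x => f x * phi x) by exact: bdmeasM.
have mI : measurable (`](-1)%R, 1%R[%classic : set R) by exact: measurable_itv.
transitivity (\int[alpha]_(x in `](-1)%R, 1%R[) g x).
  apply: eq_Rintegral => x; rewrite inE/= in_itv/= -ltr_norml => /etaE ->.
  by rewrite /g mulrCA !mulrA.
have -> : \int[alpha]_(x in `](-1)%R, 1%R[) g x = \int[alpha]_x g x.
  rewrite Rintegral_mkcond.
  have gE : (g \_ `](-1)%R, 1%R[%classic) = (fun x => \1_(`](-1)%R, 1%R[%classic) x * g x).
    apply/funext => x; rewrite patchE indicE; case: ifPn => _; by rewrite ?mul1r ?mul0r.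
  have bg : bdmeas g by exact: bdmeasZ.
  rewrite gE; apply: (expect_inside1 a1) => //.
    by apply: bdmeasM => //; exact: (bdmeas_indic mI).
  by move=> x x1; rewrite indicE mem_set ?mul1r//= in_itv/= -ltr_norml.
rewrite /g expectZ//.
have q1 := qsd_phi_int hq (fun=> cvg_cst _) (bdmeas_cst 1).
have cfp : continuous (fun x => f x * phi x).
  by move=> x; apply: cvgM; [exact: cf|exact: cp].
have q2 := qsd_phi_int hq cfp bfp.
rewrite expect_cst mulr1 in q1.
have q3 : phi_int (fun=> 1) * \int[alpha]_x (f x * phi x) = phi_int (fun y => f y * phi y).
  apply: (mulfI I0); rewrite mulrCA q2 mulrCA {1}q1 -q1.
  by rewrite mulrC.
by rewrite mulrAC q3.
Qed.

End quasi_stationary_identification.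

Lemma continuous_powR {R : realType} (k x : R) : 0 < x ->
  {for x, continuous (fun y : R => y `^ k)}.
Proof.
move=> x0; apply: differentiable_continuous; apply/derivable1_diffP.
by apply: derivable_powR; rewrite in_itv/= x0.
Qed.

(** * The process X as a scaled Brownian motion *)

Section scaled_process.
Context {R : realType} {d : measure_display} {Omega : measurableType d}.
Variables (P : probability Omega R) (W : R -> Omega -> R) (kappa s : R).
Hypothesis BM : is_std_BM P W.
Hypothesis s0 : 0 <= s.
Local Notation mu := (@lebesgue_measure R).

(** Time is counted from s, so r = u - s. The maximum keeps the function positive and continuous on
    the whole line. *)
Definition radius (r : R) : R := (s + Num.max r 0 + 1) `^ kappa.

Definition xproc : R -> R * Omega -> R := proc W (radius 0) radius.

Let base_gt0 (r : R) : 0 < s + Num.max r 0 + 1.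
Proof. by rewrite ltr_wpDl// addr_ge0// le_max lexx orbT. Qed.

Lemma radius_gt0 r : 0 < radius r. Proof. by rewrite powR_gt0. Qed.

Lemma continuous_radius : continuous radius.
Proof.
move=> r; have cb : {for r, continuous (fun u : R => s + Num.max u 0 + 1)}.
  apply: cvgD; last exact: cvg_cst.
  apply: cvgD; first exact: cvg_cst.
  by apply: (@continuous_max R R id (cst 0)); [exact: cvg_id|exact: cvg_cst].
exact: continuous_comp cb (continuous_powR (k := kappa) (base_gt0 r)).
Qed.

Lemma radiusE r : 0 <= r -> radius r = (s + r + 1) `^ kappa.
Proof. by move=> r0; rewrite /radius (max_idPl r0). Qed.

Lemma measurable_xproc r : measurable_fun setT (xproc r).
Proof. exact: measurable_proc BM _ _ _. Qed.

Lemma continuous_xproc z : continuous (xproc ^~ z).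
Proof.
exact: (@continuous_proc _ _ _ P W BM (radius 0) radius continuous_radius radius_gt0 z).
Qed.

Lemma xproc0 z : xproc 0 z = z.1.
Proof. exact: (@proc0 _ _ _ P W BM (radius 0) radius radius_gt0 erefl z). Qed.

Lemma xprocE u x w : s <= u -> xproc (u - s) (x, w) = Xproc W kappa s x u w.
Proof.
move=> su; have us : 0 <= u - s by rewrite subr_ge0.
rewrite /xproc /proc /Xproc !radiusE// addr0 (max_idPl us) [s + (u - s)]addrC subrK.
by rewrite [_ * x]mulrC.
Qed.

Lemma survXE x t : s <= t -> survX W kappa s x t = xsection (avoid xproc (t - s)) x.
Proof.
move=> st.
have ch w : continuous (fun u => `|xproc (u - s) (x, w)|).
  move=> u; have cs : {for u, continuous (fun v : R => v - s)}.
    by apply: cvgB; [exact: cvg_id|exact: cvg_cst].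
  have cx := continuous_comp cs (@continuous_xproc (x, w) (u - s)).
  exact: continuous_comp cx (@norm_continuous _ _ _).
have hA w u : [set r | s <= r /\ `|Xproc W kappa s x r w| = 1] u <->
    s <= u /\ `|xproc (u - s) (x, w)| = 1.
  by split => -[su hu]; split=> //; move: hu; rewrite xprocE.
have avE w : avoid xproc (t - s) (x, w) <->
    (forall u, s <= u <= t -> `|xproc (u - s) (x, w)| != 1).
  split => h u /andP[u1 u2]; first by apply: h; rewrite subr_ge0 u1 lerD2r.
  by have := h (u + s); rewrite addrK; apply; rewrite lerDr u1 -lerBrDr.
apply/seteqP; split => w; rewrite /xsection/= inE /survX/= /tauX.
  by move/(inf_hit_gtP (ch w) (hA w) st)/avE.
by move/avE/(inf_hit_gtP (ch w) (hA w) st).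
Qed.

Section start.
Variable nu : probability R R.
Hypothesis nu1 : nu `]-1, 1[%classic = 1%E.
Local Notation Q := (prodp nu P).

Lemma expect_avoid t (F : R * Omega -> R) : 0 <= t -> bdmeas F ->
  \int[Q]_z (\1_(avoid xproc t) z * F z) = \int[Q]_z (\1_(surv xproc t) z * F z).
Proof.
have cX := continuous_xproc; have mX := measurable_xproc.
move=> t0 bF; apply: (expect_inside nu1).
- by apply: bdmeasM => //; apply: bdmeas_indic; exact: measurable_avoid.
- by apply: bdmeasM => //; apply: bdmeas_indic; exact: measurable_surv.
move=> z z1; congr (_ * _); rewrite !indicE; congr ((_ : bool)%:R).
have z0 : `|xproc 0 z| < 1 by rewrite xproc0.
by apply/idP/idP; rewrite !inE => /(avoid_survP cX t0 z0).
Qed.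

Lemma Pmu_survE t : s <= t ->
  fine (Pmu_surv P W nu kappa s t) = \int[Q]_z \1_(surv xproc (t - s)) z.
Proof.
move=> st; have ts : 0 <= t - s by rewrite subr_ge0.
have cX := continuous_xproc; have mX := measurable_xproc.
rewrite /Pmu_surv; under eq_integral do rewrite survXE//.
rewrite integral_measure_xsection; last exact: measurable_avoid.
have h := expect_avoid ts (bdmeas_cst 1).
transitivity (\int[Q]_z (\1_(avoid xproc (t - s)) z * 1)).
  by apply: eq_Rintegral => z _; rewrite mulr1.
by rewrite h; apply: eq_Rintegral => z _; rewrite mulr1.
Qed.

Lemma Emu_f_survE (f : R -> R) u t : bdmeas f -> s <= u -> u <= t ->
  fine (Emu_f_surv P W nu kappa s f u t) =
  \int[Q]_z (\1_(surv xproc (t - s)) z * f (xproc (u - s) z)).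
Proof.
move=> bf su ut; have ts : 0 <= t - s by rewrite subr_ge0 (le_trans su).
have cX := continuous_xproc; have mX := measurable_xproc.
have bfX : bdmeas (fun z => f (xproc (u - s) z)) by exact: bdmeas_comp bf (mX _).
have h := integral_xsection nu P (measurable_avoid mX cX ts) bfX.
transitivity (fine (\int[Q]_z (\1_(avoid xproc (t - s)) z * f (xproc (u - s) z)))%:E); last exact: (expect_avoid ts bfX).
rewrite -h.
rewrite /Emu_f_surv; apply: (congr1 fine).
apply: eq_integral => x _.
rewrite survXE; last exact: le_trans ut.
by apply: eq_integral => w _; rewrite xprocE.
Qed.

(** Path continuity gives pointwise convergence of the conditional means at grid times, which is all
    that [riemann_cvg] needs. It links the time average to functionals of the walk. *)
Lemma cesaro_riemann (f : R -> R) t : continuous f -> bdmeas f -> 0 < t -> s < t ->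
  (mesh (t - s) n * \sum_(i < n.+1)
    (\int[Q]_z (\1_(surv xproc (t - s)) z * f (xproc (i%:R * mesh (t - s) n) z)) /
     \int[Q]_z \1_(surv xproc (t - s)) z)) @[n --> \oo] -->
  t * cesaro_cond P W nu kappa s f t.
Proof.
move=> cf bf t0 st; have ts : 0 < t - s by rewrite subr_gt0.
have cX := continuous_xproc; have mX := measurable_xproc.
set p := \int[Q]_z \1_(surv xproc (t - s)) z.
have [_ [B hB]] := bf.
have B0 : 0 <= B by rewrite (le_trans _ (hB 0)).
pose v n i := \int[Q]_z (\1_(surv xproc (t - s)) z * f (xproc (i%:R * mesh (t - s) n) z)) / p.
have mS : measurable (surv xproc (t - s)) by apply: measurable_surv => //; exact: ltW.
have bv r : bdmeas (fun z => \1_(surv xproc (t - s)) z * f (xproc r z)).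
  by apply: (bdmeasM (bdmeas_indic mS)); exact: bdmeas_comp bf (mX _).
have nv r z : `|\1_(surv xproc (t - s)) z * f (xproc r z)| <= B.
  rewrite normrM indicE; case: (_ \in _); first by rewrite normr1 mul1r.
  by rewrite normr0 mul0r.
rewrite /cesaro_cond mulrA divff ?gt_eqF// mul1r.
have [||_] := @riemann_cvg R s t (B * `|p^-1|) v
  (fun u => fine (Emu_f_surv P W nu kappa s f u t) / fine (Pmu_surv P W nu kappa s t)) st.
- by move=> n i; rewrite /v normrM ler_wpM2r// expect_le_bound.
- move=> u /andP[su ut].
  rewrite Pmu_survE ?ltW// Emu_f_survE ?(ltW ut)// -/p.
  apply: cvgM; last exact: cvg_cst.
  have us : 0 <= u - s by rewrite subr_ge0.
  apply: (@expect_cvg _ _ _ Q _ _ B) => [n|n z|z]; [exact: (bv _).1|exact: nv|].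
  apply: cvgM; first exact: cvg_cst.
  apply: continuous_cvg; first exact: cf.
  exact: continuous_cvg (@cX z (u - s)) (trunc_mesh_cvg ts us).
- by [].
Qed.

End start.
End scaled_process.

(** Integrate over S the tangent bound exp z >= exp m (1 + z - m) at the conditional mean m. *)
Lemma jensen_expR {R : realType} {d : measure_display} {T : measurableType d}
    (Q : probability T R) (S : set T) (Z : T -> R) : measurable S -> bdmeas Z ->
  0 < \int[Q]_x \1_S x ->
  \int[Q]_x \1_S x * expR (\int[Q]_x (\1_S x * Z x) / \int[Q]_x \1_S x) <=
  \int[Q]_x (\1_S x * expR (Z x)).
Proof.
move=> mS bZ; set p := \int[Q]_x \1_S x => p0.
set m := \int[Q]_x (\1_S x * Z x) / p.
have bS : bdmeas (\1_S : T -> R) := bdmeas_indic mS.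
have bSZ : bdmeas (fun x => \1_S x * Z x) by exact: bdmeasM.
have -> : p * expR m =
    \int[Q]_x (expR m * (1 - m) * \1_S x + expR m * (\1_S x * Z x)).
  rewrite expectD; [|exact: bdmeasZ|exact: bdmeasZ].
  rewrite !expectZ// -/p (_ : \int[Q]_x (\1_S x * Z x) = m * p); last by rewrite /m divfK ?gt_eqF.
  by ring.
apply: le_expect.
- by apply: bdmeasD; exact: bdmeasZ.
- by apply: bdmeasM => //; exact: bdmeas_expR.
move=> x; rewrite indicE; case: (_ \in _); last by rewrite !mul0r !mulr0 addr0.
rewrite !mulr1 !mul1r -mulrDr (_ : Z x = m + (Z x - m)); last by ring.
rewrite [leRHS]expRD ler_wpM2l ?expR_ge0// (le_trans _ (expR_ge1Dx _))//.
by rewrite le_eqVlt; apply/orP; left; apply/eqP; ring.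
Qed.

(** * The intrinsic clock and its growth *)

Section clock.
Context {R : realType}.
Variables (kappa s : R).
Hypothesis s0 : 0 <= s.
Hypothesis k0 : 0 < kappa.
Hypothesis k1 : kappa < 2^-1.
Local Notation mu := (@lebesgue_measure R).
Local Notation radius := (radius kappa s).

(** Brownian time measured in units of the squared radius; survival costs about lambda per unit of
    it. *)
Definition clock (t : R) : R := \int[mu]_(r in `[0, t]) radius r ^- 2.

Let base_ge1 (r : R) : 1 <= s + Num.max r 0 + 1.
Proof. by rewrite lerDr addr_ge0// le_max lexx orbT. Qed.

Let base_gt0 (r : R) : 0 < s + Num.max r 0 + 1.
Proof. by rewrite (lt_le_trans ltr01). Qed.

Lemma radius_ge1 r : 1 <= radius r.
Proof. by rewrite -(powRr0 (s + Num.max r 0 + 1)) /radius ler_powR// ltW. Qed.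

Let rp r : 0 < radius r. Proof. by rewrite (lt_le_trans ltr01)// radius_ge1. Qed.

Let sq_ge1 r : 1 <= radius r ^+ 2. Proof. by rewrite exprn_ege1// radius_ge1. Qed.

Lemma le_radius r r' : r <= r' -> radius r <= radius r'.
Proof.
move=> rr; rewrite /radius ge0_ler_powR ?nnegrE ?(ltW k0) ?(ltW (base_gt0 _))//.
by rewrite lerD2r lerD2l ge_max !le_max lexx rr !orbT.
Qed.

Lemma radius_step r e : 0 <= r -> 0 <= e -> radius (r + e) <= (1 + e) * radius r.
Proof.
move=> r0 e0; rewrite !radiusE ?addr_ge0//.
have b0 : 0 <= s + r + 1 by rewrite !addr_ge0.
rewrite (@le_trans _ _ (((1 + e) * (s + r + 1)) `^ kappa))//.
  rewrite ge0_ler_powR ?nnegrE ?(ltW k0) ?addr_ge0 ?mulr_ge0 ?addr_ge0//.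
  have : 0 <= e * (s + r) by rewrite mulr_ge0// addr_ge0.
  lra.
rewrite powRM ?addr_ge0// ler_wpM2r ?powR_ge0// ler1_powR ?lerDl//.
by rewrite (le_trans (ltW k1))// invf_le1// ler1n.
Qed.

Let mass_ge0 r : 0 <= radius r ^- 2 <= 1.
Proof.
rewrite invr_ge0 (le_trans ler01 (sq_ge1 r))/= invf_le1 ?sq_ge1//.
exact: lt_le_trans ltr01 (sq_ge1 r).
Qed.

Lemma clock_riemann (t : R) : 0 < t ->
  mesh t n * \sum_(i < n.+1) radius (i%:R * mesh t n) ^- 2 @[n --> \oo] --> clock t.
Proof.
move=> t0; have cV : continuous (fun r => radius r ^- 2).
  move=> r; apply: cvgV; first by rewrite gt_eqF// exprn_gt0.
  rewrite expr2; have cr := @continuous_radius _ kappa s s0 r.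
  exact: (cvgM cr cr).
have [||_] := @riemann_cvg R 0 t 1 (fun n i => radius (i%:R * mesh t n) ^- 2)
  (fun r => radius r ^- 2) t0; last by rewrite !subr0.
- by move=> n i; have /andP[h1 h2] := mass_ge0 (i%:R * mesh t n); rewrite ger0_norm.
- move=> u /andP[u0 ut]; rewrite !subr0.
  exact: continuous_cvg (cV u) (trunc_mesh_cvg t0 u0).
Qed.

Let a : R := 1 - 2 * kappa.
Let a0 : 0 < a. Proof. rewrite /a; have := k1; lra. Qed.

(** Comparison of one cell with the integral of the decreasing function r^(- 2 kappa), whose
    primitive is r^a / a. *)
Let step (x y : R) : 1 <= x -> x < y -> (y - x) * (y `^ kappa) ^- 2 <= (y `^ a - x `^ a) / a.
Proof.
move=> x1 xy; have x0 : 0 < x by rewrite (lt_le_trans ltr01).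
have y0 : 0 < y by rewrite (lt_trans x0).
have yE : (y `^ kappa) ^- 2 = y `^ a / y.
  rewrite /a powRB; last by apply/implyP => _; rewrite gt_eqF.
  rewrite powRr1 ?(ltW y0)// mulrC mulrA mulVf ?gt_eqF// mul1r.
  rewrite mulr_natl mulr2n powRD; last by apply/implyP => _; rewrite gt_eqF.
  by rewrite expr2.
rewrite yE ler_pdivlMr//.
(* Young's inequality for the exponents 1/a and 1/(1-a) *)
have young : (x / y) `^ a <= a * (x / y) + (1 - a).
  have a1 : a < 1 by rewrite /a; have := k0; lra.
  have := @conjugate_powR R ((x / y) `^ a) 1 a^-1 (1 - a)^-1.
  rewrite powR_ge0 ler01 !invr_gt0 a0 subr_gt0 a1.
  have pq : a^-1^-1 + (1 - a)^-1^-1 = 1 by rewrite !invrK addrC subrK.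
  move=> /(_ isT isT isT isT pq); rewrite !invrK mulr1 -powRrM divff ?gt_eqF//.
  rewrite powRr1; last by rewrite divr_ge0// ltW.
  by rewrite powR1 mul1r [x / y * a]mulrC.
have -> : x `^ a = (x / y) `^ a * y `^ a.
  rewrite -powRM ?divfK ?gt_eqF// ?(ltW y0)//.
  by rewrite divr_ge0// ltW.
rewrite [leRHS](_ : _ = (1 - (x / y) `^ a) * y `^ a); last by ring.
rewrite [leLHS](_ : _ = (a * (1 - x / y)) * y `^ a); last by field; rewrite gt_eqF.
by rewrite ler_wpM2r ?powR_ge0//; lra.
Qed.

(** Here kappa < 1/2 enters: with a > 0 the clock is at most (s + t + 1)^a / a, and a + 2 kappa = 1.
    The eigenvalue errors, multiplied by the clock and by the squared radius, are therefore of order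
    t. *)
Lemma clock_le (t : R) : 0 < t -> clock t * radius t ^+ 2 <= (s + t + 1) / a.
Proof.
move=> t0; have t00 := ltW t0.
have b0 : 0 < s + t + 1 by rewrite ltr_wpDl// addr_ge0.
have rE : (s + t + 1) `^ a * radius t ^+ 2 = s + t + 1.
  rewrite radiusE// expr2 -!powRD; last 2 first.
  - by apply/implyP => _; rewrite gt_eqF.
  - by apply/implyP => _; rewrite gt_eqF.
  by rewrite (_ : a + (kappa + kappa) = 1) ?powRr1 ?ltW//; rewrite /a; ring.
suff h : clock t <= (s + t + 1) `^ a / a.
  rewrite (le_trans (ler_wpM2r _ h))//; first by rewrite (le_trans ler01 (sq_ge1 t)).
  by rewrite mulrAC rE.
(* [step] bounds right-endpoint sums, so the first left-endpoint term is split off; it costs at most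
   one mesh and vanishes in the limit. *)
pose base n i : R := s + i%:R * mesh t n + 1.
have sumb n : mesh t n * \sum_(i < n.+1) radius (i%:R * mesh t n) ^- 2 <=
    mesh t n + (s + t + 1) `^ a / a.
  have m0 := mesh_gt0 t0 n.
  have basei i : 1 <= base n i by rewrite lerDr addr_ge0// mulr_ge0// ltW.
  have bS i : base n i.+1 - base n i = mesh t n by rewrite /base -natr1; ring.
  have rb i : radius (i%:R * mesh t n) = base n i `^ kappa.
    by rewrite radiusE// mulr_ge0// ltW.
  rewrite big_ord_recl mulrDr lerD//.
    by rewrite ler_piMr ?(ltW m0)//; have /andP[] := mass_ge0 (0%:R * mesh t n).
  have tel j : mesh t n * \sum_(i < j) radius (i.+1%:R * mesh t n) ^- 2 <=
      (base n j `^ a - base n 0%N `^ a) / a.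
    elim: j => [|j IH]; first by rewrite big_ord0 mulr0 subrr mul0r.
    rewrite big_ord_recr/= mulrDr rb.
    have := step (basei j) (_ : base n j < base n j.+1); rewrite bS => h.
    have {}h := h (ltac:(by rewrite -subr_gt0 bS)).
    by rewrite (le_trans (lerD IH h))// -mulrDl addrC subrKA.
  apply: (le_trans (tel n)); rewrite ler_wpM2r ?invr_ge0 ?(ltW a0)//.
  rewrite lerBlDr ler_wpDr ?powR_ge0//.
  rewrite ge0_ler_powR ?nnegrE ?(ltW a0) ?(ltW b0)//.
    by rewrite (le_trans ler01).
  rewrite lerD2r lerD2l -[leRHS](mulfK (x := n.+1%:R))//.
  by rewrite mulrAC [leRHS]mulrC /mesh ler_wpM2r ?(ltW m0)// ler_nat.
have mc : mesh t n + (s + t + 1) `^ a / a @[n --> \oo] --> 0 + (s + t + 1) `^ a / a.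
  by apply: cvgD; [exact: mesh_cvg0|exact: cvg_cst].
rewrite add0r in mc.
by apply: ler_cvg_to (clock_riemann t0) mc _; near=> n; exact: sumb.
Unshelve. all: by end_near. Qed.

End clock.

(** * Survival probability and exponential moments of the time average *)

Section large_deviation_bounds.
Context {R : realType} {d : measure_display} {Omega : measurableType d}.
Variables (P : probability Omega R) (W : R -> Omega -> R) (kappa s : R).
Hypothesis BM : is_std_BM P W.
Hypothesis s0 : 0 <= s.
Hypothesis k0 : 0 < kappa.
Hypothesis k1 : kappa < 2^-1.
Variable nu : probability R R.
Hypothesis nu1 : nu `]-1, 1[%classic = 1%E.
Local Notation lam := (@lambda_Bm R).
Local Notation mu := (@lebesgue_measure R).
Local Notation Q := (prodp nu P).
Local Notation radius := (radius kappa s).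
Local Notation xproc := (xproc W kappa s).
Local Notation clock := (clock kappa s).

Let rp r : 0 < radius r. Proof. exact: radius_gt0. Qed.
Let cr : continuous radius. Proof. exact: continuous_radius. Qed.
Let mX r : measurable_fun setT (xproc r). Proof. exact: measurable_xproc BM _. Qed.
Let cX z : continuous (xproc ^~ z). Proof. exact: (continuous_xproc BM s0). Qed.

Let tn (t : R) n : n.+1%:R * mesh t n = t. Proof. by rewrite /mesh mulrCA divff ?mulr1. Qed.

Definition psurv (t : R) : R := \int[Q]_z \1_(surv xproc t) z.

Definition start_mass (ep : R) : R :=
  \int[nu]_x (phi (x / (1 - ep)) * \1_(cball (1 - ep)) x).

(** [chain_lower] for balls shrunk by the factor 1 - ep, since only closed events pass to the limit
    from the grid. The mesh goes to 0 for fixed e, and then e goes to 0. *)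
Lemma psurv_ge (ep t : R) : 0 < ep -> ep < 1 -> 0 < t ->
  expR (- (lam * clock t / (1 - ep) ^+ 2)) * start_mass ep <= psurv t.
Proof.
move=> ep0 ep1 t0; have q0 : 0 < 1 - ep by rewrite subr_gt0.
have t00 := ltW t0.
set c := clock t / (1 - ep) ^+ 2.
set m := start_mass ep.
have mS : measurable (surv xproc t) by exact: measurable_surv.
pose G n i := \int[Q]_z (\1_(grid_ge0 t (inner xproc (1 - ep)) n i) z * (fun=> 1 : R) (xproc (i%:R * mesh t n) z)).
have Gc : G n n.+1 @[n --> \oo] -->
    \int[Q]_z (\1_(path_ge0 (inner xproc (1 - ep)) t) z * (fun=> 1 : R) (xproc t z)).
  have trn n : Num.trunc (t / mesh t n) = n.+1.
    by rewrite -{1}(tn t n) mulfK ?gt_eqF ?mesh_gt0// natrK.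
  have -> : (fun n => G n n.+1) = (fun n => G n (Num.trunc (t / mesh t n))).
    by apply/funext => n; rewrite trn.
  exact: (@grid_expect_cvg _ _ _ P W BM (radius 0) radius cr rp nu t (1 - ep) t (fun=> 1) t0 t00 (fun=> cvg_cst _) (bdmeas_cst 1)).
have Pge : \int[Q]_z (\1_(path_ge0 (inner xproc (1 - ep)) t) z * (fun=> 1 : R) (xproc t z)) <= psurv t.
  apply: le_expect.
  - apply: bdmeasM; last exact: bdmeas_cst.
    by apply: bdmeas_indic; exact: measurable_path_inner.
  - exact: bdmeas_indic.
  - move=> z; rewrite mulr1 !indicE.
    case: (boolP (z \in path_ge0 _ _)) => [|_]; last by case: (_ \in _).
    rewrite inE => h; rewrite mem_set//; apply: inner_surv h.
    by rewrite ltrBlDr ltrDl.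
have key (e : R) : 0 < e -> expR (- (lam * (1 + e) * c)) * m - e * c <= psurv t.
  move=> e0; have [s1 s10 hL] := chain_lower e0.
  pose Sn n := mesh t n * \sum_(i < n.+1) radius (i%:R * mesh t n) ^- 2 / (1 - ep) ^+ 2.
  have Sc : Sn n @[n --> \oo] --> c.
    have -> : Sn = (fun n => mesh t n * \sum_(i < n.+1) radius (i%:R * mesh t n) ^- 2 / (1 - ep) ^+ 2).
      by [].
    under eq_fun do rewrite -mulr_suml mulrA.
    apply: cvgM; last exact: cvg_cst.
    exact: clock_riemann.
  have Lc : expR (- (lam * (1 + e) * Sn n)) * m - e * Sn n @[n --> \oo] -->
      expR (- (lam * (1 + e) * c)) * m - e * c.
    apply: cvgB; last by apply: cvgM; [exact: cvg_cst|exact: Sc].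
    apply: cvgM; last exact: cvg_cst.
    apply: continuous_cvg; first exact: continuous_expR.
    by apply: cvgN; apply: cvgM; [exact: cvg_cst|exact: Sc].
  apply: le_trans _ Pge; apply: (ler_cvg_to Lc Gc).
  have mc : \forall n \near \oo, mesh t n < (s1 * ((1 - ep) * radius 0)) ^+ 2.
    by apply: (cvgr_lt _ (mesh_cvg0 t)); rewrite exprn_gt0// mulr_gt0// mulr_gt0.
  near=> n.
  have mn : mesh t n < (s1 * ((1 - ep) * radius 0)) ^+ 2 by near: n.
  have m0 := mesh_gt0 t0 n.
  have chn := chain_BM BM nu (radius 0) m0.
  have ss : 0 < s1 * ((1 - ep) * radius 0) by rewrite mulr_gt0// mulr_gt0.
  pose L i := (1 - ep) * radius (i%:R * mesh t n).
  have L0 : 0 < L 0%N by rewrite mulr_gt0.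
  have LS i : L i <= L i.+1.
    rewrite ler_wpM2l ?(ltW q0)// le_radius//.
    by rewrite ler_wpM2r ?(ltW m0)// ler_nat.
  have sm : Num.sqrt (mesh t n) / L 0%N <= s1.
    rewrite ler_pdivrMr// /L mul0r -(ger0_norm (ltW ss)) -sqrtr_sqr.
    by rewrite ler_wsqrtr// ltW.
  have sp : 0 < Num.sqrt (mesh t n) by rewrite sqrtr_gt0.
  have := hL _ _ Q _ (Num.sqrt (mesh t n)) L chn sp L0 LS sm n.+1.
  have -> : \sum_(i < n.+1) (Num.sqrt (mesh t n) / L i) ^+ 2 = Sn n.
    rewrite /Sn mulr_sumr; apply: eq_bigr => i _.
    rewrite exprMn sqr_sqrtr ?(ltW m0)// /L.
    by field; rewrite !gt_eqF.
  have -> : \int[Q]_x (phi ((radius 0 * x.1 + W (0%:R * mesh t n) x.2) / L 0%N) *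
      \1_(cball (L 0%N)) (radius 0 * x.1 + W (0%:R * mesh t n) x.2)) = m.
    have [_ [W0 _]] := BM.
    rewrite /m /start_mass.
    have bF : bdmeas (fun z : R * Omega => phi (z.1 / (1 - ep)) * \1_(cball (1 - ep)) z.1).
      by apply: (bdmeas_comp (bdmeas_phi_cball (1 - ep))); exact: measurable_fst.
    transitivity (\int[Q]_z (phi (z.1 / (1 - ep)) * \1_(cball (1 - ep)) z.1)).
      apply: eq_Rintegral => z _; rewrite mul0r W0 addr0 /L mul0r !cballE.
      have -> : radius 0 * z.1 / ((1 - ep) * radius 0) = z.1 / (1 - ep).
        by field; rewrite !gt_eqF.
      congr (_ * (_ : bool)%:R).
      by rewrite normrM (gtr0_norm (rp 0)) mulrC ler_pM2r.
    by rewrite expect_prod//; apply: eq_Rintegral => x _ /=; rewrite expect_cst.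
  move=> /le_trans; apply.
  rewrite le_eqVlt; apply/orP; left; apply/eqP; apply: eq_Rintegral => z _.
  rewrite mulr1.
  exact: (@prod_cball_grid _ _ _ W (radius 0) radius rp t (1 - ep) n n.+1 z t0).
have ec : (harmonic k : R) @[k --> \oo] --> (0 : R) by exact: cvg_harmonic.
have Kc : expR (- (lam * (1 + harmonic k) * c)) * m - harmonic k * c @[k --> \oo] -->
    expR (- (lam * (1 + 0) * c)) * m - 0 * c.
  apply: cvgB; last by apply: cvgM; [exact: ec|exact: cvg_cst].
  apply: cvgM; last exact: cvg_cst.
  apply: continuous_cvg; first exact: continuous_expR.
  apply: cvgN; apply: cvgM; last exact: cvg_cst.
  apply: cvgM; first exact: cvg_cst.
  by apply: cvgD; [exact: cvg_cst|exact: ec].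
rewrite addr0 mulr1 mul0r subr0 {1}/c mulrA in Kc.
by apply: (ler_cvg_to Kc (cvg_cst (psurv t))); near=> k; apply: key; rewrite /harmonic/= invr_gt0.
Unshelve. all: by end_near. Qed.


(** Jensen under the law conditioned to survive bounds the exponential of the conditional mean by
    the exponential moment over the survival probability, and [chain_upper] controls the former.
    Both are taken on a grid and the mesh is sent to 0 after taking logarithms. *)
Lemma cesaro_upper (f psi psi1 : R -> R) (be B A ep theta om : R) :
  continuous f -> bdmeas f ->
  C2_near psi psi1 (fun x => 2 * ((be - f x) * phi x) - (pi / 2) ^+ 2 * psi x) ->
  0 <= A -> (forall x, `|x| <= 1 -> `|psi x| <= A * phi x) ->
  (forall x, `|x| <= 1 -> `|be - f x| <= B) ->
  (forall x, `|x| <= 1 -> `|f x - f (x / (1 + ep))| <= om) ->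
  0 < ep -> `|theta| * A <= 2^-1 ->
  exists C : nat, exists2 D : R, 0 < D & forall t kk, s < t -> 0 < psurv (t - s) ->
  kk = theta / ((1 + ep) * radius (t - s)) ^+ 2 ->
  kk * (t * cesaro_cond P W nu kappa s f t) <=
  ln (D * (radius (t - s) / radius 0) ^+ C / psurv (t - s)) +
  ((tilt_err B A ep theta om - lam) / (1 + ep) ^+ 2 * clock (t - s) + kk * be * (t - s)).
Proof.
move=> cf bf hpsi A0 hA hB hom ep0 thA.
have [s1 [C [D [s10 D0] hU]]] := chain_upper bf hpsi A0 hA hB hom ep0 thA.
exists C, (D + 1); first by rewrite ltr_wpDl.
move=> t kk st p0 kkE; set err := tilt_err _ _ _ _ _.
have t0 : 0 < t by rewrite (le_lt_trans s0).
set T := t - s in p0 kkE *; have T0 : 0 < T by rewrite subr_gt0.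
have T00 := ltW T0.
have e1 : 0 < 1 + ep by rewrite addr_gt0.
set p := psurv T in p0 *.
have mS : measurable (surv xproc T) by exact: measurable_surv.
pose an n := mesh T n * \sum_(i < n.+1)
    (\int[Q]_z (\1_(surv xproc T) z * f (xproc (i%:R * mesh T n) z)) / p).
have ac : an n @[n --> \oo] --> t * cesaro_cond P W nu kappa s f t.
  exact: (cesaro_riemann BM s0 nu1 cf bf t0 st).
pose cn n := mesh T n * \sum_(i < n.+1) radius (i%:R * mesh T n) ^- 2.
have cc : cn n @[n --> \oo] --> clock T by exact: clock_riemann.
pose lG := ln ((D + 1) * (radius T / radius 0) ^+ C / p).
have G0 : 0 < (D + 1) * (radius T / radius 0) ^+ C / p.
  by rewrite divr_gt0// mulr_gt0 ?ltr_wpDl// exprn_gt0// divr_gt0.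
suff key : \forall n \near \oo, kk * an n <=
    lG + ((err - lam) / (1 + ep) ^+ 2 * cn n + kk * be * T).
  have c1 : kk * an n @[n --> \oo] --> kk * (t * cesaro_cond P W nu kappa s f t).
    by apply: cvgM; [exact: cvg_cst|exact: ac].
  have c2 : lG + ((err - lam) / (1 + ep) ^+ 2 * cn n + kk * be * T) @[n --> \oo] -->
      lG + ((err - lam) / (1 + ep) ^+ 2 * clock T + kk * be * T).
    apply: cvgD; first exact: cvg_cst.
    apply: cvgD; last exact: cvg_cst.
    by apply: cvgM; [exact: cvg_cst|exact: cc].
  exact: ler_cvg_to c1 c2 key.
have mc : \forall n \near \oo, mesh T n < (s1 * ((1 + ep) * radius 0)) ^+ 2.
  by apply: (cvgr_lt _ (mesh_cvg0 T)); rewrite exprn_gt0// mulr_gt0// mulr_gt0.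
have me : \forall n \near \oo, mesh T n < ep / 2.
  by apply: (cvgr_lt _ (mesh_cvg0 T)); rewrite divr_gt0.
near=> n.
have mn : mesh T n < (s1 * ((1 + ep) * radius 0)) ^+ 2 by near: n.
have men : mesh T n < ep / 2 by near: n.
have m0 := mesh_gt0 T0 n.
have chn := chain_BM BM nu (radius 0) m0.
have ss : 0 < s1 * ((1 + ep) * radius 0) by rewrite mulr_gt0// mulr_gt0.
pose g i := radius (i%:R * mesh T n).
pose Y i z := radius 0 * z.1 + W (i%:R * mesh T n) z.2.
have g0E : g 0%N = radius 0 by rewrite /g mul0r.
have g0 : 0 < g 0%N by rewrite g0E.
have gN : g n.+1 = radius T by rewrite /g tn.
have gS i : g i <= g i.+1.
  by rewrite le_radius// ler_wpM2r ?(ltW m0)// ler_nat.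
have gS2 i : g i.+1 <= (1 + ep / 2) * g i.
  rewrite /g -natr1 mulrDl mul1r (le_trans (radius_step s0 k0 k1 _ (ltW m0)))//.
    by rewrite mulr_ge0// ltW.
  by rewrite ler_wpM2r ?(ltW (rp _))// lerD2l ltW.
have sm : Num.sqrt (mesh T n) / ((1 + ep) * g 0%N) <= s1.
  rewrite g0E ler_pdivrMr; last by rewrite mulr_gt0.
  by rewrite -(ger0_norm (ltW ss)) -sqrtr_sqr ler_wsqrtr// ltW.
have sp : 0 < Num.sqrt (mesh T n) by rewrite sqrtr_gt0.
have gNT : g n.+1 <= radius T by rewrite gN.
have := hU _ _ Q Y (Num.sqrt (mesh T n)) (radius T) g n.+1 chn sp g0 gS gS2 sm gNT.
cbv zeta; rewrite gN g0E => {}hU.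
have gp i : 0 < g i by exact: rp.
(* The radius at step j cancels: this is why the tilt was taken proportional to its square, and it
   yields an unweighted time average. *)
have vth j : (Num.sqrt (mesh T n) / ((1 + ep) * g j)) ^+ 2 * (theta * (g j / radius T) ^+ 2) =
    kk * mesh T n.
  rewrite expr_div_n sqr_sqrtr ?(ltW m0)// kkE.
  by field; rewrite !gt_eqF.
have YX j z : Y j z / g j = xproc (j%:R * mesh T n) z.
  by rewrite /xproc /g (proc_grid W (radius 0) radius n j z T0).
have rhsE : \sum_(j < n.+1) (Num.sqrt (mesh T n) / ((1 + ep) * g j)) ^+ 2 *
     (- lam + theta * (g j / radius T) ^+ 2 * be + err) =
     (err - lam) / (1 + ep) ^+ 2 * cn n + kk * be * T.
  transitivity (\sum_(j < n.+1) ((err - lam) / (1 + ep) ^+ 2 * (mesh T n * radius (j%:R * mesh T n) ^- 2)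
      + kk * be * mesh T n)).
    apply: eq_bigr => j _; have := vth j.
    set v := (_ / _) ^+ 2; set th := theta * _ => vE.
    rewrite (_ : v * _ = (err - lam) * v + v * th * be); last by ring.
    rewrite vE mulrAC; congr (_ + _).
    rewrite /v expr_div_n sqr_sqrtr ?(ltW m0)// -/(g j).
    by field; rewrite !gt_eqF.
  rewrite big_split/= -mulr_sumr sumr_const card_ord -mulr_natr /cn -mulr_sumr.
  by rewrite -[X in _ + _ * X](tn T n); ring.
rewrite rhsE in hU.
pose Z z := \sum_(j < n.+1) kk * mesh T n * f (xproc (j%:R * mesh T n) z).
have bfX r : bdmeas (fun z => f (xproc r z)) by exact: bdmeas_comp bf (mX r).
have bZ : bdmeas Z.
  apply: (@bdmeas_sum _ _ _ n.+1 (fun j z => kk * mesh T n * f (xproc (j%:R * mesh T n) z))) => j _.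
  exact: bdmeasZ.
have bSf r : bdmeas (fun z => \1_(surv xproc T) z * f (xproc r z)).
  by apply: bdmeasM => //; exact: bdmeas_indic.
have EZ : \int[Q]_z (\1_(surv xproc T) z * Z z) / p = kk * an n.
  have -> : \int[Q]_z (\1_(surv xproc T) z * Z z) =
      \int[Q]_z (\sum_(j < n.+1) kk * mesh T n * (\1_(surv xproc T) z * f (xproc (j%:R * mesh T n) z))).
    by apply: eq_Rintegral => z _; rewrite /Z mulr_sumr; apply: eq_bigr => j _; ring.
  rewrite (@expect_sum _ _ _ Q n.+1 (fun j z => kk * mesh T n * (\1_(surv xproc T) z * f (xproc (j%:R * mesh T n) z)))); last first.
    by move=> j; exact: bdmeasZ.
  rewrite /an mulrA mulr_suml mulr_sumr; apply: eq_bigr => j _.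
  by rewrite expectZ ?[RHS]mulrA//; exact: bSf.
have jen := jensen_expR mS bZ p0; rewrite -/p EZ in jen.
have Zle : \int[Q]_z (\1_(surv xproc T) z * expR (Z z)) <=
    D * (radius T / radius 0) ^+ C * expR ((err - lam) / (1 + ep) ^+ 2 * cn n + kk * be * T).
  apply: le_trans hU; apply: le_expect.
  - by apply: bdmeasM; [exact: bdmeas_indic|exact: bdmeas_expR].
  - apply: bdmeasM.
      apply: (@bdmeas_prod _ _ _ n.+2 (fun j z => \1_(cball (g j)) (Y j z))) => j _.
      apply: (bdmeas_comp (bdmeas_cball (g j))); exact: (chn.1 j).
    apply: bdmeas_expR.
    rewrite (_ : (fun z => _) = Z) //; apply/funext => z; apply: eq_bigr => j _.
    by rewrite vth YX.
  - move=> z.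
    have -> : \sum_(j < n.+1) (Num.sqrt (mesh T n) / ((1 + ep) * g j)) ^+ 2 *
       (theta * (g j / radius T) ^+ 2) * f (Y j z / g j) = Z z.
      by apply: eq_bigr => j _; rewrite vth YX.
    rewrite ler_wpM2r ?expR_ge0//.
    (* Survival in continuous time implies staying in the closed unit ball at grid times, the right
       direction for an upper bound. *)
    have := @prod_cball_grid _ _ _ W (radius 0) radius rp T 1 n n.+1 z T0.
    under eq_bigr do rewrite mul1r.
    move=> ->; rewrite !indicE.
    case: (boolP (z \in surv xproc T)) => [|_]; last by case: (_ \in _).
    rewrite inE => h; rewrite mem_set// => j jn.
    rewrite /inner subr_ge0 ltW//; apply: h.
    rewrite mulr_ge0 ?(ltW m0)//= -[leRHS](tn T n) ler_wpM2r ?(ltW m0)//.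
    by rewrite ler_nat.
have := le_trans jen Zle; set X := _ / _ * cn n + _ => h.
rewrite -ler_expR expRD lnK ?posrE// mulrAC ler_pdivlMr// mulrC.
apply: (le_trans h); rewrite ler_wpM2r ?expR_ge0// ler_wpM2r ?lerDl//.
by rewrite exprn_ge0// divr_ge0// ltW.
Unshelve. all: by end_near. Qed.

Let a : R := 1 - 2 * kappa.
Let a0 : 0 < a. Proof. rewrite /a; have := k1; lra. Qed.

(** The squared radius is (t + 1)^(2 kappa). With h = (1 - 2 kappa) / 2, the logarithm is at most (t
    + 1)^h / h, leaving a factor (t + 1)^(-h). *)
Lemma radius_rate (K e : R) : 0 <= K -> 0 < e ->
  \forall t \near +oo, radius (t - s) ^+ 2 / t * (K + K * ln (t + 1)) <= e.
Proof.
move=> K0 e0; pose h := a / 2.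
have h0 : 0 < h by rewrite divr_gt0.
pose M := 2 * (K + K / h) / e.
have M0 : 0 <= M by rewrite divr_ge0 ?(ltW e0)// mulr_ge0// addr_ge0// divr_ge0// ltW.
near=> t.
have t1 : 1 <= t by near: t; apply: nbhs_pinfty_ge; rewrite num_real.
have ts : s <= t by near: t; apply: nbhs_pinfty_ge; rewrite num_real.
have tM : M `^ h^-1 <= t by near: t; apply: nbhs_pinfty_ge; rewrite num_real.
have t0 : 0 < t by rewrite (lt_le_trans ltr01).
have b0 : 0 < t + 1 by rewrite addr_gt0.
have b1 : 1 <= t + 1 by rewrite lerDr ltW.
pose u := (t + 1) `^ h.
have u1 : 1 <= u by rewrite -(powRr0 (t + 1)) ler_powR// ltW.
have u0 : 0 < u by rewrite (lt_le_trans ltr01).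
have Mu : M <= u.
  rewrite -[leLHS](powRr1 M0) -(mulVf (lt0r_neq0 h0)) powRrM.
  rewrite ge0_ler_powR ?nnegrE ?powR_ge0 ?(ltW h0) ?(ltW b0)//.
  by rewrite (le_trans tM)// lerDl.
have lnb : ln (t + 1) <= u / h.
  by rewrite ler_pdivlMr// mulrC -ln_powR ltW// ln_sublinear.
have ln0 : 0 <= ln (t + 1) by rewrite ln_ge0.
have rE : radius (t - s) ^+ 2 * u ^+ 2 = t + 1.
  rewrite radiusE ?subr_ge0// [s + _]addrC subrK /u !expr2 -!powRD.
  - by rewrite (_ : kappa + kappa + (h + h) = 1) ?powRr1 ?(ltW b0)//; rewrite /h /a; field.
  - by apply/implyP => _; rewrite gt_eqF.
  - by apply/implyP => _; rewrite gt_eqF.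
  - by apply/implyP => _; rewrite gt_eqF.
have KK : K + K * ln (t + 1) <= (K + K / h) * u.
  rewrite mulrDl lerD//; first by rewrite ler_peMr.
  by rewrite -mulrA [_^-1 * u]mulrC ler_wpM2l.
have r2 : radius (t - s) ^+ 2 / t <= 2 / u ^+ 2.
  rewrite ler_pdivrMr// mulrAC ler_pdivlMr ?exprn_gt0// rE; lra.
rewrite (@le_trans _ _ (2 / u ^+ 2 * ((K + K / h) * u)))//.
  apply: ler_pM => //.
    by apply: divr_ge0; [rewrite exprn_ge0// ltW|exact: ltW].
  by rewrite addr_ge0// mulr_ge0.
rewrite [leLHS](_ : _ = (2 * (K + K / h)) / u); last by field; rewrite !gt_eqF.
by rewrite ler_pdivrMr// [e * u]mulrC -ler_pdivrMr.
Unshelve. all: by end_near. Qed.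

(** As ep tends to 0 these masses converge to the integral of [phi] over (-1, 1), positive because
    the initial law is carried there. *)
Lemma start_mass_gt0 : \forall k \near \oo, 0 < start_mass k.+2%:R^-1.
Proof.
pose I x : R := phi x * \1_(`](-1)%R, 1%R[%classic) x.
have ec : (harmonic k.+1 : R) @[k --> \oo] --> (0 : R).
  by have := @cvg_harmonic R; rewrite -(cvg_shiftS (@harmonic R)).
have Ic : start_mass k.+2%:R^-1 @[k --> \oo] --> \int[nu]_x I x.
  apply: (@expect_cvg _ _ _ nu _ _ 1).
  - by move=> k; exact: (bdmeas_phi_cball _).1.
  - move=> k x; rewrite normrM cballE; case: (`|x| <= _)%R.
      by rewrite normr1 mulr1 phi_le1.
    by rewrite normr0 mulr0.
  - move=> x; rewrite /I indicE; have [x1|x1] := ltP `|x| 1.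
      rewrite mem_set; last by rewrite /= in_itv/= -ltr_norml.
      apply: cvgM.
        apply: continuous_cvg; first exact: continuous_phi.
        have : x / (1 - harmonic k.+1) @[k --> \oo] --> x / (1 - 0).
          apply: cvgM; first exact: cvg_cst.
          apply: cvgV; first by rewrite subr0 oner_neq0.
          by apply: cvgB; [exact: cvg_cst|exact: ec].
        by rewrite subr0 divr1.
      apply: cvg_near_cst; have x2 : 0 < 1 - `|x| by rewrite subr_gt0.
      have hk : \forall k \near \oo, harmonic k.+1 < 1 - `|x| by exact: (cvgr_lt _ ec).
      apply: filterS hk => k; rewrite /harmonic/= => kx.
      by rewrite cballE lerBrDl -lerBrDr ltW.
    rewrite memNset ?mulr0; last by rewrite /= in_itv/= -ltr_norml => h; move: x1; rewrite leNgt h.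
    apply: cvg_near_cst; near=> k; rewrite cballE leNgt.
    by rewrite (lt_le_trans _ x1) ?mulr0// ltrBlDr ltrDl invr_gt0.
have Ip : 0 < \int[nu]_x I x.
  have i0 x : ~ (`|x| < 1) -> I x = 0.
    by move=> x1; rewrite /I indicE memNset ?mulr0// => /=; rewrite in_itv/= -ltr_norml.
  have i1 x : `|x| < 1 -> 0 < I x.
    move=> x1; rewrite /I indicE mem_set ?mulr1 ?phi_gt0//=.
    by rewrite in_itv/= -ltr_norml.
  apply: (probability_gt0 nu1) => //.
    by apply: bdmeasM; [exact: bdmeas_phi|apply: bdmeas_indic; exact: measurable_itv].
  by move=> x; have [/i1/ltW//|x1] := pselect (`|x| < 1); rewrite i0.
exact: (cvgr_gt _ Ic).
Unshelve. all: by end_near. Qed.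

(** Insert [psurv_ge] into [cesaro_upper] and multiply by ((1 + ep) radius)^2 / t. The leading terms
    in lambda [clock] cancel up to O(ep), the logarithmic prefactor vanishes by [radius_rate], and
    [clock_le] bounds the remaining eigenvalue error, leaving the theta^2 term. *)
Lemma cesaro_tilted (f psi psi1 : R -> R) (be B A theta e : R) :
  continuous f -> bdmeas f ->
  C2_near psi psi1 (fun x => 2 * ((be - f x) * phi x) - (pi / 2) ^+ 2 * psi x) ->
  0 <= A -> (forall x, `|x| <= 1 -> `|psi x| <= A * phi x) ->
  (forall x, `|x| <= 1 -> `|be - f x| <= B) ->
  `|theta| * A <= 2^-1 -> 0 < e ->
  \forall t \near +oo, theta * (cesaro_cond P W nu kappa s f t - be) <=
    4 / a * (A * B) * theta ^+ 2 + e.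
Proof.
move=> cf bf hpsi A0 hA hB thA e0.
have l0 := @lambda_Bm_gt0 R.
(* error budget : om and ep below contribute at most e / 3 *)
pose om := e * a / (12 * (`|theta| + 1)).
have th1 : 0 < `|theta| + 1 by rewrite ltr_wpDl.
have om0 : 0 < om by rewrite divr_gt0 ?mulr_gt0.
have [dl dl0 hdl] := @heine R f (-1) 1 (fun x _ => cf x) om om0.
pose el := e * a / (12 * (16 * lam + 1)).
have el0 : 0 < el by rewrite divr_gt0 ?mulr_gt0// ltr_wpDl// mulr_ge0// ltW.
have ec : (harmonic k.+1 : R) @[k --> \oo] --> (0 : R).
  by have := @cvg_harmonic R; rewrite -(cvg_shiftS (@harmonic R)).
have [k [m0 kdl kel k2]] : exists k : nat, [/\ 0 < start_mass k.+2%:R^-1,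
    k.+2%:R^-1 <= dl, k.+2%:R^-1 <= el & k.+2%:R^-1 <= 2^-1 :> R].
  have h1 := start_mass_gt0.
  have h2 : \forall k \near \oo, harmonic k.+1 < dl by exact: (cvgr_lt _ ec).
  have h3 : \forall k \near \oo, harmonic k.+1 < el by exact: (cvgr_lt _ ec).
  near \oo => k; exists k; split.
  - by near: k.
  - by apply: ltW; near: k; exact: h2.
  - by apply: ltW; near: k; exact: h3.
  - by rewrite lef_pV2 ?posrE// ler_nat.
set ep := k.+2%:R^-1 in m0 kdl kel k2.
have ep0 : 0 < ep by rewrite invr_gt0.
have ep1 : ep < 1 by lra.
have hom x : `|x| <= 1 -> `|f x - f (x / (1 + ep))| <= om.
  move=> x1; have e1 : 0 < 1 + ep by rewrite addr_gt0.
  rewrite distrC; apply: hdl; first by rewrite in_itv/= -ler_norml.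
  rewrite (_ : x / _ - _ = - x * (ep / (1 + ep))); last by field; rewrite gt_eqF.
  rewrite normrM normrN (le_trans _ kdl)// -[leRHS]mul1r; apply: ler_pM => //.
  rewrite ger0_norm ?divr_ge0 ?(ltW ep0) ?(ltW e1)//.
  by rewrite ler_pdivrMr// ler_peMr ?(ltW ep0)// lerDl ltW.
have [C [D D0 hU]] := cesaro_upper cf bf hpsi A0 hA hB hom ep0 thA.
set m := start_mass ep in m0.
(* The 4 bounds (1 + ep)^2; the rest dominates the logarithm of the prefactor, as ln of the radius
   is at most kappa ln (t + 1). *)
pose K := 4 * (`|ln D - ln m| + C%:R * kappa).
have K0 : 0 <= K by rewrite mulr_ge0// addr_ge0// mulr_ge0// ltW.
have e3 : 0 < e / 3 by rewrite divr_gt0.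
have rate := radius_rate K0 e3.
near=> t.
have t1 : 1 <= t by near: t; apply: nbhs_pinfty_ge; rewrite num_real.
have st : s < t by near: t; apply: nbhs_pinfty_gt; rewrite num_real.
have tb : 3 * `|theta * be| * s / e <= t by near: t; apply: nbhs_pinfty_ge; rewrite num_real.
have rt : radius (t - s) ^+ 2 / t * (K + K * ln (t + 1)) <= e / 3 by near: t; exact: rate.
have t0 : 0 < t by rewrite (lt_le_trans ltr01).
have T0 : 0 < t - s by rewrite subr_gt0.
have e1 : 0 < 1 + ep by rewrite addr_gt0.
have e2 : 0 < 1 - ep by rewrite subr_gt0.
have pge := psurv_ge ep0 ep1 T0.
have p0 : 0 < psurv (t - s) by rewrite (lt_le_trans _ pge)// mulr_gt0 ?expR_gt0.
have cle := clock_le s0 k0 k1 T0.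
have c0 : 0 <= clock (t - s).
  by apply: Rintegral_ge0 => r _; rewrite invr_ge0 exprn_ge0// ltW.
have := hU t _ st p0 erefl.
have B0 : 0 <= B.
  by rewrite (le_trans _ (hB 0 _)) ?normr0.
have ln0 : 0 <= ln (t + 1) by rewrite ln_ge0// lerDr ltW.
set X := cesaro_cond _ _ _ _ _ _ _; set c := clock (t - s) in cle c0 pge *.
set p := psurv (t - s) in p0 pge *; set q := radius (t - s) in cle rt *.
have q0 : 0 < q by exact: rp.
have lnp : - (lam * c / (1 - ep) ^+ 2) + ln m <= ln p.
  have -> : - (lam * c / (1 - ep) ^+ 2) + ln m = ln (expR (- (lam * c / (1 - ep) ^+ 2)) * m).
    by rewrite lnM ?posrE ?expR_gt0// expRK.
  by rewrite ler_ln ?posrE// mulr_gt0 ?expR_gt0.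
have lnq : ln (q / radius 0) <= kappa * ln (t + 1).
  rewrite (@le_trans _ _ (ln q))//.
    rewrite ler_ln ?posrE ?divr_gt0// ler_pdivrMr// ler_peMr ?(ltW q0)//.
    exact: radius_ge1.
  by rewrite /q radiusE ?(ltW T0)// [s + _]addrC subrK ln_powR.
have lnE : ln (D * (q / radius 0) ^+ C / p) = ln D + C%:R * ln (q / radius 0) - ln p.
  have qr : 0 < q / radius 0 by rewrite divr_gt0.
  rewrite ln_div ?posrE ?mulr_gt0 ?exprn_gt0// lnM ?posrE ?exprn_gt0//.
  by rewrite lnXn// mulr_natl.
pose L' := `|ln D - ln m| + C%:R * kappa * ln (t + 1).
have L'0 : 0 <= L' by rewrite addr_ge0// !mulr_ge0// ltW.
have Lle : ln (D * (q / radius 0) ^+ C / p) <= L' + lam * c / (1 - ep) ^+ 2.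
  rewrite lnE /L' -mulrA.
  have := ler_norm (ln D - ln m).
  have : C%:R * ln (q / radius 0) <= C%:R * (kappa * ln (t + 1)) by rewrite ler_wpM2l.
  move: lnp; lra.
set err := tilt_err _ _ _ _ _.
move=> hk.
(* The mismatch between the shrunk and the enlarged ball: (1 + ep)^2 F = 4 lambda ep / (1 - ep)^2 +
   err, at most 16 lambda ep + err since ep <= 1/2. *)
pose F := lam / (1 - ep) ^+ 2 + (err - lam) / (1 + ep) ^+ 2.
have {hk} h1 : theta * (X - be * ((t - s) / t)) <=
    (1 + ep) ^+ 2 * (q ^+ 2 / t * L') + (1 + ep) ^+ 2 * F * (c * q ^+ 2 / t).
  have hk' : theta / ((1 + ep) * q) ^+ 2 * (t * X - be * (t - s)) <= L' + F * c.
    move: hk Lle; rewrite /F; set kk := theta / _; set l := ln _.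
    move: (((1 - ep) ^+ 2)^-1) (((1 + ep) ^+ 2)^-1) => i1 i2; lra.
  have w0 : 0 < ((1 + ep) * q) ^+ 2 / t by rewrite divr_gt0// exprn_gt0// mulr_gt0.
  have := ler_wpM2l (ltW w0) hk'.
  rewrite [leLHS](_ : _ = theta * (X - be * ((t - s) / t))); last first.
    by field; rewrite !gt_eqF.
  move/le_trans; apply; rewrite le_eqVlt; apply/orP; left; apply/eqP.
  by field; rewrite !gt_eqF.
have ee : (1 + ep) ^+ 2 <= 4.
  rewrite -subr_ge0 (_ : _ - _ = (1 - ep) * (3 + ep)); last by ring.
  by rewrite mulr_ge0 ?(ltW e2)// addr_ge0// ltW.
have h2 : (1 + ep) ^+ 2 * (q ^+ 2 / t * L') <= e / 3.
  have qt : 0 <= q ^+ 2 / t by rewrite divr_ge0 ?(ltW t0)// exprn_ge0// ltW.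
  rewrite (@le_trans _ _ (4 * (q ^+ 2 / t * L')))//.
    by rewrite ler_wpM2r// mulr_ge0.
  rewrite mulrCA (le_trans _ rt)// ler_wpM2l// /L' /K.
  have : 0 <= `|ln D - ln m| * ln (t + 1) by rewrite mulr_ge0.
  have : 0 <= C%:R * kappa by rewrite mulr_ge0// ltW.
  move: (`|ln D - ln m|) (C%:R * kappa) (ln (t + 1)) => x y z; lra.
pose F' := 16 * lam * ep + err.
have AB0 : 0 <= A * B by rewrite mulr_ge0.
have th2 : 0 <= theta ^+ 2 by rewrite sqr_ge0.
have err0 : 0 <= err.
  have v1 : 0 <= `|theta| * om by apply: mulr_ge0 => //; exact: ltW.
  have v2 : 0 <= 2 * A * B * theta ^+ 2 by rewrite -[2 * A * B]mulrA; apply: mulr_ge0 => //; exact: mulr_ge0.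
  rewrite /err /tilt_err; lra.
have F'0 : 0 <= F'.
  apply: addr_ge0 => //; apply: mulr_ge0; last exact: ltW.
  by apply: mulr_ge0 => //; exact: ltW.
have FF' : (1 + ep) ^+ 2 * F <= F'.
  have e2' : 4^-1 <= (1 - ep) ^+ 2.
    rewrite -subr_ge0 (_ : _ - _ = (2^-1 - ep) * (2^-1 + (1 - ep))); last by field.
    by rewrite mulr_ge0 ?subr_ge0// addr_ge0// ltW.
  have -> : (1 + ep) ^+ 2 * F = lam * (4 * ep / (1 - ep) ^+ 2) + err.
    by rewrite /F; field; rewrite !gt_eqF.
  rewrite lerD2r (_ : 16 * lam * ep = lam * (16 * ep)); last by ring.
  rewrite ler_wpM2l ?(ltW l0)// ler_pdivrMr ?exprn_gt0//.
  have : ep * 4^-1 <= ep * (1 - ep) ^+ 2 by rewrite ler_wpM2l// ltW.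
  lra.
have cq : c * q ^+ 2 / t <= 2 / a.
  rewrite ler_pdivrMr// (le_trans cle)// -/a mulrAC ler_pM2r ?invr_gt0//.
  by rewrite [s + _]addrC subrK; lra.
have h3 : (1 + ep) ^+ 2 * F * (c * q ^+ 2 / t) <= 4 / a * (A * B) * theta ^+ 2 + e / 3.
  have cq0 : 0 <= c * q ^+ 2 / t.
    by rewrite divr_ge0 ?(ltW t0)// mulr_ge0// exprn_ge0// ltW.
  rewrite (le_trans (ler_wpM2r cq0 FF'))// (le_trans (ler_wpM2l F'0 cq))//.
  have u1 : (16 * lam + 1) * ep <= e * a / 12.
    have l16 : 0 < 16 * lam + 1 by rewrite ltr_wpDl// mulr_ge0// ltW.
    rewrite -ler_pdivlMl// (le_trans kel)// /el le_eqVlt; apply/orP; left; apply/eqP.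
    by field; rewrite gt_eqF.
  have u2 : `|theta| * om <= e * a / 12.
    rewrite (@le_trans _ _ ((`|theta| + 1) * om))//.
      by rewrite ler_wpM2r ?(ltW om0)// lerDl.
    rewrite /om le_eqVlt; apply/orP; left; apply/eqP.
    by field; rewrite gt_eqF.
  have -> : F' = 2 * (A * B) * theta ^+ 2 + ((16 * lam + 1) * ep + `|theta| * om).
    by rewrite /F' /err /tilt_err; ring.
  rewrite mulrDl; apply: lerD.
    by rewrite le_eqVlt; apply/orP; left; apply/eqP; field; rewrite gt_eqF.
  rewrite (@le_trans _ _ (e * a / 6 * (2 / a)))//.
    by rewrite ler_wpM2r ?divr_ge0 ?(ltW a0)//; lra.
  by rewrite le_eqVlt; apply/orP; left; apply/eqP; field; rewrite gt_eqF.
(* The average is divided by t while the window has length t - s; the discrepancy be s / t takes the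
   last third of the error. *)
have h4 : - (theta * be * (s / t)) <= e / 3.
  rewrite (@le_trans _ _ (`|theta * be| * (s / t)))//.
    by rewrite -mulNr ler_wpM2r ?divr_ge0 ?(ltW t0)// -normrN ler_norm.
  rewrite mulrA ler_pdivrMr//.
  move: tb; rewrite ler_pdivrMr//; lra.
have -> : theta * (X - be) = theta * (X - be * ((t - s) / t)) - theta * be * (s / t).
  by field; rewrite gt_eqF.
move: h1 h2 h3 h4; lra.
Unshelve. all: by end_near. Qed.

End large_deviation_bounds.

(** * Conclusion: tilting in both directions *)

Theorem theorem5 (R : realType) (d : measure_display) (Omega : measurableType d)
  (P : probability Omega R) (W : R -> Omega -> R)
  (alpha : probability R R) (eta : R -> R) (kappa : R) :
  is_std_BM P W ->
  is_QSD_Bm P W alpha ->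
  (forall x : R, `]-1, 1[%classic x ->
     (expR (lambda_Bm * t) * fine (P (survB W x t))) @[t --> +oo] --> eta x) ->
  0 < kappa < 2^-1 ->
  forall mu : probability R R, mu `]-1, 1[%classic = 1%E ->
  forall s : R, 0 <= s ->
  forall f : R -> R, continuous f -> (exists M : R, forall x, `|f x| <= M) ->
    cesaro_cond P W mu kappa s f t @[t --> +oo]
      --> Rintegral alpha `]-1, 1[%classic (fun x => f x * eta x).
Proof.
move=> BM hq heta /andP[k0 k1] nu nu1 s s0 f cf fM.
have bf := bdmeas_continuous cf fM; have [M hM] := fM.
have cp := @continuous_phi R.
have cfp : continuous (fun x => f x * phi x).
  by move=> x; apply: cvgM; [exact: cf|exact: cp].
rewrite (qsd_eta_integral BM hq heta cf bf).
have I0 := phi_int_phi_neq0 BM hq.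
set be := _ / _.
have cF : continuous (fun x => (be - f x) * phi x).
  by move=> x; apply: cvgM; [apply: cvgB; [exact: cvg_cst|exact: cf]|exact: cp].
(* Orthogonality holds exactly because [be] is the mean of f under the normalised [phi]^2; this is
   what selects the limit. *)
have F0 : phi_int (fun x => (be - f x) * phi x) = 0.
  have := phi_int_comb be 1 cp cfp; rewrite mul1r divfK// subrr => <-.
  by apply: eq_Rintegral => x _; ring.
have [psi [psi1 [hpsi pN p1]]] := ode cF F0.
have [A A0 hA] := C2_vanish_le_phi hpsi pN p1.
pose B := `|be| + M.
have hB x : `|x| <= 1 -> `|be - f x| <= B.
  by move=> _; rewrite (le_trans (ler_normB _ _))// lerD2l.
have B0 : 0 <= B by rewrite (le_trans _ (hB 0 _)) ?normr0.
have AB0 : 0 <= A * B by rewrite mulr_ge0.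
apply/cvgrPdist_le => e e0.
pose a := 1 - 2 * kappa.
have a0 : 0 < a by rewrite /a; lra.
(* The first bound keeps the tilted function positive; the second makes the quadratic error at most
   th e / 2, so that division by th leaves e in total. *)
pose th := Num.min (2 * (A + 1))^-1 (e * a / (8 * (A * B + 1))).
have A1 : 0 < A + 1 by rewrite ltr_wpDl.
have AB1 : 0 < A * B + 1 by rewrite ltr_wpDl.
have th0 : 0 < th by rewrite lt_min invr_gt0 !mulr_gt0// ?invr_gt0 ?mulr_gt0.
have thA : th * A <= 2^-1.
  rewrite (@le_trans _ _ ((2 * (A + 1))^-1 * A))//.
    by rewrite ler_wpM2r// ge_min lexx.
  rewrite invfM -mulrA ler_piMr// mulrC ler_pdivrMr// mul1r; lra.
have thB : 4 / a * (A * B) * th ^+ 2 <= th * e / 2.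
  have : th <= e * a / (8 * (A * B + 1)) by rewrite ge_min lexx orbT.
  rewrite ler_pdivlMr ?mulr_gt0// => h.
  have h2 : 8 * (A * B) * th <= e * a.
    rewrite (le_trans _ h)// mulrC ler_wpM2l ?(ltW th0)//; lra.
  have : 8 * (A * B) * th / a <= e by rewrite ler_pdivrMr.
  move=> h3; rewrite (_ : 4 / a * _ * _ = th * (8 * (A * B) * th / a) / 2); last first.
    by field; rewrite gt_eqF.
  by rewrite ler_pM2r// ler_wpM2l// ltW.
have nth : `|th| * A <= 2^-1 by rewrite gtr0_norm.
have nthN : `|- th| * A <= 2^-1 by rewrite normrN gtr0_norm.
have e2 : 0 < th * e / 2 by rewrite divr_gt0 ?mulr_gt0.
(* The tilt th bounds the average from above; the tilt - th, with the same psi, bounds it from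
   below. *)
have up := cesaro_tilted BM s0 k0 k1 nu1 cf bf hpsi A0 hA hB nth e2.
have lo := cesaro_tilted BM s0 k0 k1 nu1 cf bf hpsi A0 hA hB nthN e2.
near=> t.
have upt : th * (cesaro_cond P W nu kappa s f t - be) <=
    4 / a * (A * B) * th ^+ 2 + th * e / 2 by near: t; exact: up.
have lot : - th * (cesaro_cond P W nu kappa s f t - be) <=
    4 / a * (A * B) * (- th) ^+ 2 + th * e / 2 by near: t; exact: lo.
rewrite sqrrN in lot.
rewrite distrC ler_norml; apply/andP; split.
  rewrite -(ler_pM2l th0); move: lot thB; lra.
rewrite -(ler_pM2l th0); move: upt thB; lra.
Unshelve. all: by end_near. Qed.
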